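(* Let $C_1,C_2>0$ be the constants described in the context, and let $\theta\in(0,1]$, $\sigma\in(0,1]$, $\lambda\in(0,\frac{\sigma\theta}{C_2})$ be constants. Suppose that: (i) (small data oscillation) $\displaystyle \operatorname{osc}(f,\mathcal T)\le\lambda\sqrt{\sum_{a\in\mathcal V_{\mathcal T}}\|\breve r_a\|^2_{H^1_*(\omega_a)'}}$; (ii) (D\''orfler marking) $\mathcal M\subset\mathcal V_{\mathcal T}$ satisfies $\displaystyle \sum_{a\in\mathcal M}\|\breve r_a\|^2_{H^1_*(\omega_a)'}\ge\theta^2\sum_{a\in\mathcal V_{\mathcal T}}\|\breve r_a\|^2_{H^1_*(\omega_a)'}$; (iii) (local saturation property) $\bar U\supset U_{\mathcal T}$ is a closed subspace of $H^1_0(\Omega)$ such that $\|\breve r_a\|_{(H^1_*(\omega_a)\cap\bar U)'}\ge\sigma\|\breve r_a\|_{H^1_*(\omega_a)'}$ for all $a\in\mathcal M$. Let $\bar u\in\bar U$ denote the Galerkin solution from $\bar U$, i.e. $\int_\Omega\nabla\bar u\cdot\nabla v=\int_\Omega fv$ for all $v\in\bar U$. Then $$\|\nabla(u-\bar u)\|_\Omega \leq \sqrt{1-\frac{(\sigma \theta-C_2 \lambda)^2}{(3 C_1(1+C_2 \lambda))^2}} \,\,\|\nabla(u-u_{\mathcal T})\|_\Omega.$$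
   Context: Setting: $\Omega\subset\mathbb R^2$ is a polygon, $f\in L_2(\Omega)$, and $u\in H^1_0(\Omega)$ is the (weak) solution of $-\Delta u=f$ in $\Omega$, $u=0$ on $\partial\Omega$. $\mathcal T$ is a conforming partition of $\Omega$ into triangles, belonging to a class of uniformly shape regular triangulations. $U_{\mathcal T}\subset H^1_0(\Omega)$ is a space of continuous piecewise polynomials of (possibly) variable degree w.r.t. $\mathcal T$, with $U_{\mathcal T}\supseteq H^1_0(\Omega)\cap\prod_{T\in\mathcal T}\mathcal P_1(T)$, where $\mathcal P_k(T)$ denotes the polynomials of degree at most $k$ on $T$. For $T\in\mathcal T$, $p_T$ is the smallest integer such that $v|_T\in\mathcal P_{p_T}(T)$ for all $v\in U_{\mathcal T}$; it is understood that $p_T\ge1$. $u_{\mathcal T}\in U_{\mathcal T}$ is the Galerkin approximation of $u$ from $U_{\mathcal T}$. $\langle\cdot,\cdot\rangle_\omega$ and $\|\cdot\|_\omega$ denote the $L_2(\omega)$ (or $L_2(\omega)^2$) inner product and norm. $\mathcal V_{\mathcal T}$ is the set of vertices of $\mathcal T$, divided into the interior vertices $\mathcal V^{\rm int}_{\mathcal T}$ and boundary vertices $\mathcal V^{\rm bdr}_{\mathcal T}$. For $a\in\mathcal V_{\mathcal T}$, $\psi_a$ is the continuous piecewise linear hat function w.r.t. $\mathcal T$ with value $1$ at $a$ and $0$ at all other vertices; $\omega_a$ is the star centered at $a$, i.e. the interior of the union of the (closed) triangles of $\mathcal T$ that share the vertex $a$; $\mathcal T_a$ is the restriction of $\mathcal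 T$ to $\omega_a$; and $\mathcal E^{\rm int}_a$ is the set of interior edges of $\mathcal T_a$ (those containing $a$; for $a\in\mathcal V^{\rm bdr}_{\mathcal T}$, edges on $\partial\Omega$ contribute nothing for the functions in the space $H^1_*(\omega_a)$ defined below). $H^1_*(\omega_a):=\{v\in H^1(\omega_a):\int_{\omega_a}v=0\}$ if $a\in\mathcal V^{\rm int}_{\mathcal T}$, and $H^1_*(\omega_a):=\{v\in H^1(\omega_a): v=0\text{ on }\partial\omega_a\cap\partial\Omega\}$ if $a\in\mathcal V^{\rm bdr}_{\mathcal T}$; it is equipped with the norm $\|\nabla\cdot\|_{\omega_a}$, and its dual with the resulting dual norm. By $H^1_*(\omega_a)\cap\bar U$ is meant the space of functions in $H^1_*(\omega_a)$ that are restrictions to $\omega_a$ of functions from $\bar U$, equipped with $\|\nabla\cdot\|_{\omega_a}$, and its dual carries the resulting dual norm. For an edge $e$, $\vec n_e$ is a unit normal to $e$, and $\llbracket\cdot\rrbracket$ is the jump across $e$ in the direction of $\vec n_e$ (trace from the side $\vec n_e$ points into minus trace from the other side) when $e$ is interior to $\Omega$, and the actual trace when $e\subset\partial\Omega$. Residuals: $r_{\mathcal T}(v):=\langle f,v\rangle_\Omega-\langle\nabla u_{\mathcal T},\nabla v\rangle_\Omega$ and $$r_a(v):=r_{\mathcal T}(\psi_a v)=\sum_{T\in\mathcal T_a}\int_T v\psi_a(f+\Delta u_{\mathcal T})+\sum_{e\in\mathcal E^{\rm int}_a}\int_e v\psi_a\llbracket\nabla u_{\mathcal T}\cdot\vec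 n_e\rrbracket.$$ With $Q_{p,T}$ the $L_2(T)$-orthogonal projector onto $\mathcal P_p(T)$, set $(Q_{\mathcal T_a}w)|_T:=Q_{p_T-1,T}w$ if $p_T\ge2$ and $(Q_{\mathcal T_a}w)|_T:=\frac{\int_T\psi_a w}{\int_T\psi_a}$ if $p_T=1$, and $$\breve r_a(v):=\sum_{T\in\mathcal T_a}\int_T v\psi_a\big((Q_{\mathcal T_a}f)|_T+\Delta u_{\mathcal T}\big)+\sum_{e\in\mathcal E^{\rm int}_a}\int_e v\psi_a\llbracket\nabla u_{\mathcal T}\cdot\vec n_e\rrbracket.$$ Data oscillation: $\operatorname{osc}(f,\mathcal T)=\sqrt{\sum_{T\in\mathcal T}\operatorname{diam}(T)^2\inf_{f_{p_T-1}\in\mathcal P_{p_T-1}(T)}\|f-f_{p_T-1}\|_T^2}$. Constants: $C_1$ and $C_2$ are fixed constants, independent of the partition $\mathcal T$ (within the uniformly shape regular class), of the polynomial degrees, of $a$ and of $\bar U$, with the following defining properties. $C_1$ is the constant in the efficiency bounds $\|r_a\|_{H^1_*(\omega_a)'}\le C_1\|\nabla(u-u_{\mathcal T})\|_{\omega_a}$ and $\|r_a\|_{(H^1_*(\omega_a)\cap\bar U)'}\le C_1\|\nabla(\bar u-u_{\mathcal T})\|_{\omega_a}$ for all $a\in\mathcal V_{\mathcal T}$ and all closed subspaces $\bar U\supset U_{\mathcal T}$ of $H^1_0(\Omega)$ with Galerkin solution $\bar u$. $C_2$ is the constant in $$\left|\sqrt{\sum_{a\in\mathcal V_{\mathcal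 T}}\|\breve r_a\|^2_{H^1_*(\omega_a)'}}-\sqrt{\sum_{a\in\mathcal V_{\mathcal T}}\|r_a\|^2_{H^1_*(\omega_a)'}}\right|\le C_2\operatorname{osc}(f,\mathcal T),$$ which is also valid when the dual norms are taken w.r.t. closed subspaces of the spaces $H^1_*(\omega_a)$, such as $H^1_*(\omega_a)\cap\bar U$. *)

(* Defs.v *)
From HB Require Import structures.
From mathcomp Require Import all_boot all_order all_algebra.
From mathcomp Require Import all_classical all_reals all_analysis.

Set Implicit Arguments.
Unset Strict Implicit.
Unset Printing Implicit Defensive.

Import Order.TTheory GRing.Theory Num.Theory.
Import numFieldNormedType.Exports.

Local Open Scope classical_set_scope.
Local Open Scope ring_scope.

Notation plane R := (measurableTypeR R * measurableTypeR R)%type.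

(* The canonical norm of the product type [R * R] is the sup norm; Euclidean
   quantities are therefore defined through [dot]. *)
Definition dot (R : realType) (x y : plane R) : R := x.1 * y.1 + x.2 * y.2.

Definition euclid (R : realType) (x : plane R) : R := Num.sqrt (dot x x).

Definition diameter (R : realType) (A : set (plane R)) : R :=
  sup [set d | exists x y, [/\ A x, A y & d = euclid (x - y)]].

Definition bdry (R : realType) (A : set (plane R)) : set (plane R) :=
  closure A `\` A°.

Definition segpt (R : realType) (p q : plane R) (t : R) : plane R :=
  (p.1 + t * (q.1 - p.1), p.2 + t * (q.2 - p.2)).

Definition segment (R : realType) (p q : plane R) : set (plane R) :=
  [set x | exists t : R, 0 <= t <= 1 /\ x = segpt p q t].

(* [Omega = (closure Omega)°] excludes slits and punctures; holes are
   allowed. *)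
Definition polygon (R : realType) (Omega : set (plane R)) : Prop :=
  [/\ open Omega, Omega !=set0, connected Omega, bounded_set Omega &
      Omega = (closure Omega)° /\
      exists s : seq (plane R * plane R),
        bdry Omega = [set x | exists2 e, e \in s & segment e.1 e.2 x]].

Notation mu2 R := (@lebesgue_measure R \x @lebesgue_measure R)%E.

Definition unitI (R : realType) : set (measurableTypeR R) :=
  `[0%R : R, 1%R : R]%classic.
Arguments unitI R : clear implicits.

Definition int2 (R : realType) (D : set (plane R)) (v : plane R -> R) : R :=
  \int[mu2 R]_(x in D) v x.

Definition L2 (R : realType) (D : set (plane R)) (v : plane R -> R) : Prop :=
  measurable_fun D v /\
  (\int[mu2 R]_(x in D)
     ((v x) ^+ 2)%:E < +oo)%E.

Definition l2norm (R : realType) (D : set (plane R)) (v : plane R -> R) : R :=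
  Num.sqrt (int2 D (fun x => v x ^+ 2)).

Definition pd1 (R : realType) (v : plane R -> R) (x : plane R) : R :=
  derive1 (fun t : R => v (t, x.2)) x.1.

Definition pd2 (R : realType) (v : plane R -> R) (x : plane R) : R :=
  derive1 (fun t : R => v (x.1, t)) x.2.

Definition cgrad (R : realType) (v : plane R -> R) (x : plane R) : plane R :=
  (pd1 v x, pd2 v x).

Definition lapl (R : realType) (v : plane R -> R) (x : plane R) : R :=
  pd1 (pd1 v) x + pd2 (pd2 v) x.

Fixpoint Ck (R : realType) (k : nat) (v : plane R -> R) : Prop :=
  continuous v /\
  if k is k'.+1 then
    (forall x : plane R, derivable (fun t : R => v (t, x.2)) x.1 1 /\
                         derivable (fun t : R => v (x.1, t)) x.2 1) /\
    Ck k' (pd1 v) /\ Ck k' (pd2 v)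
  else True.

Definition smooth (R : realType) (v : plane R -> R) : Prop :=
  forall k, Ck k v.

Definition test_fun (R : realType) (D : set (plane R)) (v : plane R -> R) :
  Prop :=
  smooth v /\
  exists K : set (plane R),
    [/\ compact K, K `<=` D & forall x, ~ K x -> v x = 0].

(* Elements of function spaces over an open set [D] are total functions on the
   plane of which only the values on [D] matter. *)
Definition is_wgrad (R : realType) (D : set (plane R)) (v : plane R -> R)
    (g : plane R -> plane R) : Prop :=
  [/\ L2 D (fun x => (g x).1), L2 D (fun x => (g x).2) &
      forall phi, test_fun D phi ->
        int2 D (fun x => v x * pd1 phi x)
          = - int2 D (fun x => (g x).1 * phi x) /\
        int2 D (fun x => v x * pd2 phi x)
          = - int2 D (fun x => (g x).2 * phi x)].

Definition H1 (R : realType) (D : set (plane R)) (v : plane R -> R) : Prop :=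
  L2 D v /\ exists g, is_wgrad D v g.

(* The weak gradient is unique up to a null set, so any choice will do. *)
Definition wgrad (R : realType) (D : set (plane R)) (v : plane R -> R) :
  plane R -> plane R :=
  xget (fun=> (0, 0)) [set g | is_wgrad D v g].

Definition gradnorm (R : realType) (D : set (plane R)) (v : plane R -> R) : R :=
  Num.sqrt (int2 D (fun x => dot (wgrad D v x) (wgrad D v x))).

Definition H1norm (R : realType) (D : set (plane R)) (v : plane R -> R) : R :=
  Num.sqrt (l2norm D v ^+ 2 + gradnorm D v ^+ 2).

Definition H10 (R : realType) (D : set (plane R)) (v : plane R -> R) : Prop :=
  H1 D v /\
  forall eps : R, 0 < eps ->
    exists2 phi, test_fun D phi & H1norm D (fun x => v x - phi x) < eps.

Definition subspace (R : realType) (U : set (plane R -> R)) : Prop :=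
  U (fun=> 0) /\
  forall (c : R) v w, U v -> U w -> U (fun x => c * v x + w x).

Definition closed_subspace (R : realType) (X : set (plane R -> R))
    (nrm : (plane R -> R) -> R) (W : set (plane R -> R)) : Prop :=
  [/\ subspace W, W `<=` X &
      forall v, X v ->
        (forall eps : R, 0 < eps ->
           exists2 w, W w & nrm (fun x => v x - w x) < eps) ->
        W v].

(* [g], as a function of the parameter [t] in [0, 1], is the trace on the
   segment from [p] to [q] of [v] in [H1 D]: the restriction to the segment
   extended by continuity from smooth functions. *)
Definition is_trace (R : realType) (D : set (plane R)) (p q : plane R)
    (v : plane R -> R) (g : measurableTypeR R -> R) : Prop :=
  [/\ measurable_fun (unitI R) g,
      (\int[@lebesgue_measure R]_(t in unitI R) ((g t) ^+ 2)%:E < +oo)%E &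
      forall eps : R, 0 < eps ->
        exists phi, [/\ smooth phi,
          H1norm D (fun x => v x - phi x) < eps &
          \int[@lebesgue_measure R]_(t in unitI R)
             (phi (segpt p q t) - g t) ^+ 2 < eps]].

Definition polyfun (R : realType) (k : nat) (P : plane R -> R) : Prop :=
  exists c : nat -> nat -> R, forall x,
    P x = \sum_(i < k.+1) \sum_(j < k.+1 | (i + j <= k)%N)
            c i j * x.1 ^+ i * x.2 ^+ j.

Definition poly_on (R : realType) (k : nat) (A : set (plane R))
    (v : plane R -> R) : Prop :=
  exists2 P, polyfun k P & forall x, A x -> v x = P x.

(* The vertices are indexed by a finite type and a triangle is the set of its
   three vertices. *)
Record mesh (R : realType) := Mesh {
  vtx : finType;
  pos : vtx -> plane R;
  tris : {set {set vtx}} }.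

Definition hull (R : realType) (m : mesh R) (S : {set vtx m}) :
  set (plane R) :=
  [set x | exists lam : vtx m -> R,
     [/\ forall a, 0 <= lam a,
         forall a, a \notin S -> lam a = 0,
         \sum_a lam a = 1,
         x.1 = \sum_a lam a * (pos a).1 &
         x.2 = \sum_a lam a * (pos a).2]].

(* Integrals over a triangle are taken over its interior: functions on the
   domain need not be measurable on its boundary. *)
Definition otri (R : realType) (m : mesh R) (T : {set vtx m}) :
  set (plane R) := (hull T)°.

Definition conforming (R : realType) (Omega : set (plane R)) (m : mesh R) :
  Prop :=
  [/\ injective (@pos R m),
      forall T, T \in tris m -> #|T| = 3%N /\ otri T !=set0,
      forall T1 T2, T1 \in tris m -> T2 \in tris m ->
        hull T1 `&` hull T2 = hull (T1 :&: T2)%SET,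
      forall a : vtx m, exists2 T, T \in tris m & a \in T &
      closure Omega = [set x | exists2 T, T \in tris m & hull T x]].

Definition shape_regular (R : realType) (kappa : R) (m : mesh R) : Prop :=
  forall T, T \in tris m ->
    diameter (hull T) ^+ 2 <= kappa * int2 (otri T) (fun=> 1).

Definition interior_vertex (R : realType) (Omega : set (plane R)) (m : mesh R)
    (a : vtx m) : Prop := Omega (pos a).

Definition star (R : realType) (m : mesh R) (a : vtx m) : set (plane R) :=
  [set x | exists T, [/\ T \in tris m, a \in T & hull T x]]°.

(* An edge not on the boundary of the domain is one shared by two triangles. *)
Definition interior_edge (R : realType) (m : mesh R) (a b : vtx m) : bool :=
  (a != b) &&
  (#|[set T in tris m | [set a; b] \subset T]%SET| == 2%N).

Definition is_hat (R : realType) (Omega : set (plane R)) (m : mesh R)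
    (a : vtx m) (w : plane R -> R) : Prop :=
  [/\ {within closure Omega, continuous w},
      forall T, T \in tris m -> poly_on 1 (hull T) w,
      forall b : vtx m, w (pos b) = (b == a)%:R &
      forall x, ~ closure Omega x -> w x = 0].

Definition is_edge_normal (R : realType) (m : mesh R)
    (nrm : {set vtx m} -> plane R) : Prop :=
  forall (a b : vtx m) T, T \in tris m -> a \in T -> b \in T -> a != b ->
    dot (nrm [set a; b]%SET) (nrm [set a; b]%SET) = 1 /\
    dot (nrm [set a; b]%SET) (pos b - pos a) = 0.

Definition fe_space (R : realType) (Omega : set (plane R)) (m : mesh R)
    (U : set (plane R -> R)) : Prop :=
  [/\ subspace U,
      forall v, U v ->
        [/\ H10 Omega v, {within closure Omega, continuous v} &
            forall T, T \in tris m -> exists k, poly_on k (hull T) v] &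
      forall v, H10 Omega v ->
        (forall T, T \in tris m -> poly_on 1 (hull T) v) -> U v].

(* Triangles on which all elements of [U] vanish are given degree [1]. *)
Definition is_local_degree (R : realType) (m : mesh R)
    (U : set (plane R -> R)) (p : {set vtx m} -> nat) : Prop :=
  forall T, T \in tris m ->
    [/\ (1 <= p T)%N,
        forall v, U v -> poly_on (p T) (hull T) v &
        forall k, (1 <= k)%N -> (forall v, U v -> poly_on k (hull T) v) ->
          (p T <= k)%N].

Definition galerkin (R : realType) (Omega : set (plane R))
    (f : plane R -> R) (U : set (plane R -> R)) (w : plane R -> R) : Prop :=
  U w /\
  forall v, U v ->
    int2 Omega (fun x => dot (wgrad Omega w x) (wgrad Omega v x))
    = int2 Omega (fun x => f x * v x).

Definition H1star (R : realType) (Omega : set (plane R)) (m : mesh R)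
    (a : vtx m) : set (plane R -> R) :=
  [set v | [/\ H1 (star a) v,
     interior_vertex Omega a -> int2 (star a) v = 0 &
     ~ interior_vertex Omega a ->
       forall T (b c : vtx m), T \in tris m -> a \in T ->
         b \in T -> c \in T -> b != c ->
         hull [set b; c]%SET `<=` bdry (star a) `&` bdry Omega ->
         is_trace (otri T) (pos b) (pos c) v (fun=> 0)]].

Definition H1star_cap (R : realType) (Omega : set (plane R)) (m : mesh R)
    (Ubar : set (plane R -> R)) (a : vtx m) : set (plane R -> R) :=
  [set v | H1star Omega a v /\
           exists2 w, Ubar w & forall x, star a x -> v x = w x].

(* Extended-real valued: [+oo] for a functional that is unbounded on [W]. *)
Definition dual_norm (R : realType) (m : mesh R) (a : vtx m)
    (W : set (plane R -> R)) (l : (plane R -> R) -> R) : \bar R :=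
  ereal_sup [set (`|l v|)%:E | v in [set v | W v /\ gradnorm (star a) v <= 1]].

Definition residual (R : realType) (Omega : set (plane R))
    (f uT v : plane R -> R) : R :=
  int2 Omega (fun x => f x * v x)
  - int2 Omega (fun x => dot (wgrad Omega uT x) (wgrad Omega v x)).

(* For [v] in [H1 (star a)], [psi a x * v x] is, on [Omega], the extension by
   zero of its restriction to the star. *)
Definition res_loc (R : realType) (Omega : set (plane R)) (m : mesh R)
    (psi : vtx m -> plane R -> R) (f uT : plane R -> R) (a : vtx m)
    (v : plane R -> R) : R :=
  residual Omega f uT (fun x => psi a x * v x).

(* The polynomial that coincides with [v] on the triangle [T]. *)
Definition tpoly (R : realType) (m : mesh R) (T : {set vtx m})
    (v : plane R -> R) : plane R -> R :=
  xget (fun=> 0)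
    [set P | (exists k, polyfun k P) /\ forall x, hull T x -> P x = v x].

Definition L2proj (R : realType) (m : mesh R) (k : nat) (T : {set vtx m})
    (w : plane R -> R) : plane R -> R :=
  xget (fun=> 0)
    [set q | polyfun k q /\ forall r, polyfun k r ->
               int2 (otri T) (fun x => (w x - q x) * r x) = 0].

Definition Qproj (R : realType) (m : mesh R) (psi : vtx m -> plane R -> R)
    (p : {set vtx m} -> nat) (a : vtx m) (T : {set vtx m})
    (w : plane R -> R) : plane R -> R :=
  if (2 <= p T)%N then L2proj (p T).-1 T w
  else fun=> int2 (otri T) (fun x => psi a x * w x) / int2 (otri T) (psi a).

(* Jump over the edge [[set a; b]] of the normal derivative: the inner sum is
   over the single vertex [c] of [T] opposite to the edge, and the sign is [1]
   on the side into which the normal points and [-1] on the other side. *)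
Definition jump (R : realType) (m : mesh R) (nrm : {set vtx m} -> plane R)
    (uT : plane R -> R) (a b : vtx m) (x : plane R) : R :=
  let n := nrm [set a; b]%SET in
  \sum_(T in tris m | [set a; b]%SET \subset T)
    \sum_(c in T :\: [set a; b]%SET)
      Num.sg (dot n (pos c - pos a)) * dot (cgrad (tpoly T uT) x) n.

(* The traces from the adjacent triangles coincide on an interior edge. *)
Definition edge_trace (R : realType) (m : mesh R) (a b : vtx m)
    (v : plane R -> R) : measurableTypeR R -> R :=
  xget (fun=> 0)
    [set g | forall T, T \in tris m -> a \in T -> b \in T ->
               is_trace (otri T) (pos a) (pos b) v g].

Definition res_breve (R : realType) (m : mesh R)
    (psi : vtx m -> plane R -> R) (nrm : {set vtx m} -> plane R)
    (p : {set vtx m} -> nat) (f uT : plane R -> R) (a : vtx m)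
    (v : plane R -> R) : R :=
  \sum_(T in tris m | a \in T)
    int2 (otri T)
      (fun x => v x * psi a x * (Qproj psi p a T f x + lapl (tpoly T uT) x))
  + \sum_(b | interior_edge a b)
      euclid (pos b - pos a) *
      \int[@lebesgue_measure R]_(t in unitI R)
        (edge_trace a b v t * psi a (segpt (pos a) (pos b) t) *
         jump nrm uT a b (segpt (pos a) (pos b) t)).

Definition osc (R : realType) (m : mesh R) (p : {set vtx m} -> nat)
    (f : plane R -> R) : R :=
  Num.sqrt (\sum_(T in tris m)
    diameter (hull T) ^+ 2 *
    inf [set d | exists2 q, polyfun (p T).-1 q &
                   d = l2norm (otri T) (fun x => f x - q x) ^+ 2]).

(* Only the subspace [Ubar] at hand is considered.  No [C1] serves for all closed
   [Ubar] containing the finite element space: the latter is one of them, with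
   [ubar = uT], and the local residuals do not vanish on it in general. *)
Definition efficiency_constant (R : realType) (Omega : set (plane R))
    (m : mesh R) (psi : vtx m -> plane R -> R) (f u uT : plane R -> R)
    (Ubar : set (plane R -> R)) (ubar : plane R -> R) (C1 : R) : Prop :=
  forall a : vtx m,
    (dual_norm a (H1star Omega a) (res_loc Omega psi f uT a)
      <= (C1 * gradnorm (star a) (fun x => u x - uT x))%:E)%E /\
    (dual_norm a (H1star_cap Omega Ubar a) (res_loc Omega psi f uT a)
      <= (C1 * gradnorm (star a) (fun x => ubar x - uT x))%:E)%E.

Definition osc_bound (R : realType) (Omega : set (plane R))
    (m : mesh R) (psi : vtx m -> plane R -> R)
    (nrm : {set vtx m} -> plane R) (p : {set vtx m} -> nat)
    (f uT : plane R -> R) (W : vtx m -> set (plane R -> R)) (C2 : R) : Prop :=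
  (`| sqrte (\sum_(a : vtx m)
               dual_norm a (W a) (res_breve psi nrm p f uT a) ^+ 2)
      - sqrte (\sum_(a : vtx m)
                 dual_norm a (W a) (res_loc Omega psi f uT a) ^+ 2) |
    <= (C2 * osc p f)%:E)%E.

Definition osc_constant (R : realType) (Omega : set (plane R))
    (m : mesh R) (psi : vtx m -> plane R -> R)
    (nrm : {set vtx m} -> plane R) (p : {set vtx m} -> nat)
    (f uT : plane R -> R) (U : set (plane R -> R)) (C2 : R) : Prop :=
  osc_bound Omega psi nrm p f uT (@H1star R Omega m) C2 /\
  forall W : vtx m -> set (plane R -> R),
    (forall a,
       closed_subspace (H1star Omega a) (gradnorm (star a)) (W a) \/
       exists2 V, closed_subspace (H10 Omega) (H1norm Omega) V /\ U `<=` V &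
         W a = H1star_cap Omega V a) ->
    osc_bound Omega psi nrm p f uT W C2.

(* Main.v *)
Require Import Defs.
From HB Require Import structures.
From mathcomp Require Import all_boot all_order all_algebra.
From mathcomp Require Import all_classical all_reals all_analysis.
From mathcomp Require Import measurable_realfun lebesgue_integrable.
From mathcomp Require Import ring lra.

(** By Galerkin orthogonality |grad (u - uT)|^2 = |grad (u - ubar)|^2 +
    |grad (ubar - uT)|^2, so it suffices to bound |grad (ubar - uT)| from below
    by a multiple of |grad (u - uT)|.

    Efficiency, where each point lies in at most three stars, bounds the
    estimator with respect to [Ubar] by sqrt 3 C1 |grad (ubar - uT)|; marking,
    saturation and the two oscillation bounds compare it with the full estimator
    eta, the l2-norm of the dual norms of the r_a.

    It remains to show the reliability |grad (u - uT)| <= sqrt 3 eta.  As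
    u - uT is in H10, it is enough to bound the residual on test functions phi.
    There residual phi = \sum_a residual (psi_a (phi - c_a)) with c_a the mean of
    phi over the star if a is interior and c_a = 0 otherwise, because the hat
    functions sum to 1 and residual psi_a = 0 for interior a.  Each phi - c_a is
    in H1star.  That psi_a is in H10 for interior a follows by mollifying
    max (psi_a - delta) 0, which has compact support in Omega. *)

Set Implicit Arguments.
Unset Strict Implicit.
Unset Printing Implicit Defensive.

Import Order.TTheory GRing.Theory Num.Theory.
Import numFieldNormedType.Exports.

Local Open Scope classical_set_scope.
Local Open Scope ring_scope.

Section PlaneMeasure.
Context {R : realType}.
Implicit Types (D : set (plane R)) (v w : plane R -> R) (p q x : plane R).

Definition obox p q : set (plane R) :=
  [set x | p.1 < x.1 < q.1 /\ p.2 < x.2 < q.2].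

Definition cbox p q : set (plane R) :=
  [set x | p.1 <= x.1 <= q.1 /\ p.2 <= x.2 <= q.2].

Lemma obox_setX p q : obox p q = `]p.1, q.1[%classic `*` `]p.2, q.2[%classic.
Proof. by apply/seteqP; split=> x /=; rewrite /obox /= !in_itv. Qed.

Lemma cbox_setX p q : cbox p q = `[p.1, q.1]%classic `*` `[p.2, q.2]%classic.
Proof. by apply/seteqP; split=> x /=; rewrite /cbox /= !in_itv. Qed.

Lemma measurable_obox p q : measurable (obox p q).
Proof. by rewrite obox_setX; apply: measurableX; exact: measurable_itv. Qed.

Lemma measurable_cbox p q : measurable (cbox p q).
Proof. by rewrite cbox_setX; apply: measurableX; exact: measurable_itv. Qed.

Lemma mu2_cboxE p q : p.1 <= q.1 -> p.2 <= q.2 ->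
  mu2 R (cbox p q) = ((q.1 - p.1) * (q.2 - p.2))%:E.
Proof.
move=> h1 h2; rewrite cbox_setX product_measure1E; try exact: measurable_itv.
have mE (a b : R) : a <= b ->
    @lebesgue_measure R `[a, b]%classic = (b - a)%:E.
  move=> ab; have -> := @lebesgue_measure_itv R `[a, b]%R.
  rewrite /= lte_fin; case: ltP => // ba.
  by rewrite (_ : b - a = 0) //; lra.
by rewrite EFinM -(mE _ _ h1) -(mE _ _ h2).
Qed.

Lemma continuous_fst_plane : continuous (fun x : plane R => x.1 : R).
Proof. by move=> x; exact: cvg_fst. Qed.

Lemma continuous_snd_plane : continuous (fun x : plane R => x.2 : R).
Proof. by move=> x; exact: cvg_snd. Qed.

Lemma nbhs_planeP x (P : set (plane R)) :
  nbhs x P <-> exists2 e : R, 0 < e &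
    forall y : plane R, `|x.1 - y.1| < e -> `|x.2 - y.2| < e -> P y.
Proof.
split.
  move=> /nbhs_ballP [e /= e0 h]; exists e => // y h1 h2; apply: h.
  by split; rewrite /= -ball_normE.
move=> [e e0 h]; apply/nbhs_ballP; exists e => // y [].
by rewrite -!ball_normE /= => h1 h2; exact: h.
Qed.

Lemma cvg_plane (T : Type) (F : set_system T) (FF : Filter F)
    (f g : T -> R) (x : plane R) :
  f @ F --> (x.1 : R) -> g @ F --> (x.2 : R) ->
  (fun t => (f t, g t) : plane R) @ F --> x.
Proof.
move=> fa gb P /nbhs_planeP[e e0 h].
have h1 : \forall t \near F, `|x.1 - f t| < e by move/cvgrPdist_lt: fa; exact.
have h2 : \forall t \near F, `|x.2 - g t| < e by move/cvgrPdist_lt: gb; exact.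
by apply: filterS2 h1 h2 => t a b; exact: (h (f t, g t)).
Qed.

Lemma open_planeP D : open D <-> forall x, D x -> exists2 e : R, 0 < e &
    forall y : plane R, `|x.1 - y.1| < e -> `|x.2 - y.2| < e -> D y.
Proof.
rewrite openE; split => h x Dx; first by apply/nbhs_planeP; exact: h.
by apply/nbhs_planeP; exact: h.
Qed.

Definition rbox (s : rat * rat * rat * rat) : set (plane R) :=
  obox (ratr s.1.1.1, ratr s.1.1.2) (ratr s.1.2, ratr s.2).

Definition crbox (s : rat * rat * rat * rat) : set (plane R) :=
  cbox (ratr s.1.1.1, ratr s.1.1.2) (ratr s.1.2, ratr s.2).

Lemma obox_sub_cbox p q : obox p q `<=` cbox p q.
Proof. by move=> x [/andP[a b] /andP[c d]]; split; rewrite !ltW. Qed.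

Lemma open_bigcup_rbox D : open D ->
  D = \bigcup_(s : rat * rat * rat * rat) (if `[< crbox s `<=` D >] then rbox s
                                           else set0).
Proof.
move=> /open_planeP oD; apply/seteqP; split => [x Dx|x [s _]]; last first.
  by case: asboolP => // h /obox_sub_cbox /h.
have [e e0 he] := oD _ Dx.
have [a ha] := @rat_in_itvoo R (x.1 - e) x.1 ltac:(lra).
have [b hb] := @rat_in_itvoo R (x.2 - e) x.2 ltac:(lra).
have [c hc] := @rat_in_itvoo R x.1 (x.1 + e) ltac:(lra).
have [d hd] := @rat_in_itvoo R x.2 (x.2 + e) ltac:(lra).
rewrite !in_itv /= in ha hb hc hd.
exists (a, b, c, d) => //; case: asboolP => [_|[]].
  by rewrite /rbox /obox /=; split; lra.
move=> y; rewrite /crbox /cbox /= => -[h1 h2].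
by apply: he; rewrite ltr_norml; lra.
Qed.

Lemma measurable_open_plane D : open D -> measurable D.
Proof.
move=> oD; rewrite (open_bigcup_rbox oD); apply: countable_bigcupT_measurable.
  exact: countableP.
by move=> s; case: asboolP => // _; exact: measurable_obox.
Qed.

Lemma measurable_closed_plane D : closed D -> measurable D.
Proof.
move=> cD; rewrite -[D]setCK; apply: measurableC.
by apply: measurable_open_plane; exact: closed_openC.
Qed.

Lemma measurable_fun_continuous_plane v : continuous v ->
  measurable_fun setT v.
Proof.
move=> /continuousP cv; apply: (measurability _ (RGenOpens.measurableE R)).
move=> _ [_ [a [b ->] <-]]; rewrite setTI; apply: measurable_open_plane.
by apply: cv; exact: interval_open.
Qed.

Lemma measurable_fun_within_plane D v : measurable D ->
  {within D, continuous v} -> measurable_fun D v.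
Proof.
move=> mD /continuousP cv; apply: (measurability _ (RGenOpens.measurableE R)).
move=> _ [_ [a [b ->] <-]].
have : open (v @^-1` `]a, b[ : set (subspace D)).
  by apply: cv; exact: interval_open.
move=> /open_subspaceP[V oV VD]; rewrite setIC -VD.
by apply: measurableI => //; exact: measurable_open_plane.
Qed.

End PlaneMeasure.
Section PlaneIntegral.
Context {R : realType}.
Implicit Types (D E : set (plane R)) (v w : plane R -> R).

Definition integ D v : Prop := (mu2 R).-integrable D (EFin \o v).

Lemma integ_measurable D v : integ D v -> measurable_fun D v.
Proof. by move=> /measurable_int /measurable_EFinP. Qed.

Lemma integD D v w : measurable D -> integ D v -> integ D w ->
  integ D (fun x => v x + w x).
Proof. by move=> mD iv iw; exact: (integrableD mD iv iw). Qed.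

Lemma integZ D c v : measurable D -> integ D v -> integ D (fun x => c * v x).
Proof. by move=> mD iv; exact: (integrableZl mD c iv). Qed.

Lemma eq_integ D v w : measurable D -> (forall x, D x -> v x = w x) ->
  integ D v -> integ D w.
Proof.
move=> mD vw; apply: eq_integrable => // x /set_mem Dx /=.
by rewrite vw.
Qed.

Lemma eq_int2 D v w : (forall x, D x -> v x = w x) -> int2 D v = int2 D w.
Proof. by move=> vw; apply: eq_Rintegral => x /set_mem; exact: vw. Qed.

Lemma integN D v : measurable D -> integ D v -> integ D (fun x => - v x).
Proof.
move=> mD iv; apply: eq_integ (integZ (-1) mD iv) => // x _ /=.
by rewrite mulN1r.
Qed.

Lemma integS D E v : measurable D -> measurable E -> D `<=` E -> integ E v ->
  integ D v.
Proof. by move=> mD mE DE; exact: integrableS. Qed.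

Lemma integ0 D : integ D (fun=> 0).
Proof. exact: integrable0. Qed.

Lemma integ_le D v w : measurable D -> measurable_fun D v ->
  (forall x, D x -> `|v x| <= w x) -> integ D w -> integ D v.
Proof.
move=> mD mv vw iw; apply: (le_integrable mD _ _ iw) => /=.
  exact/measurable_EFinP.
move=> x Dx /=; rewrite lee_fin (le_trans (vw _ Dx)) //; exact: ler_norm.
Qed.

Lemma integ_bounded D v (M : R) : measurable D -> (mu2 R D < +oo)%E ->
  measurable_fun D v -> (forall x, D x -> `|v x| <= M) -> integ D v.
Proof.
move=> mD Doo mv vM; apply: measurable_bounded_integrable => //.
exists M; split; first exact: num_real.
by move=> N MN x Dx; exact: (le_trans (vM _ Dx) (ltW MN)).
Qed.

Lemma int2D D v w : measurable D -> integ D v -> integ D w ->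
  int2 D (fun x => v x + w x) = int2 D v + int2 D w.
Proof. by move=> mD iv iw; exact: RintegralD. Qed.

Lemma int2Z D c v : measurable D -> integ D v ->
  int2 D (fun x => c * v x) = c * int2 D v.
Proof. by move=> mD iv; exact: RintegralZl. Qed.

Lemma int2N D v : measurable D -> integ D v ->
  int2 D (fun x => - v x) = - int2 D v.
Proof.
move=> mD iv; rewrite -mulN1r -int2Z //.
by apply: eq_int2 => x _; rewrite mulN1r.
Qed.

Lemma int2B D v w : measurable D -> integ D v -> integ D w ->
  int2 D (fun x => v x - w x) = int2 D v - int2 D w.
Proof.
by move=> mD iv iw; rewrite int2D ?int2N //; exact: integN.
Qed.

Lemma int2_0 D : int2 D (fun=> 0) = 0.
Proof. by rewrite /int2 /Rintegral integral0. Qed.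

Lemma int2_cst D c : measurable D -> int2 D (fun=> c) = c * fine (mu2 R D).
Proof. by move=> mD; exact: Rintegral_cst. Qed.

Lemma integ_sum (I : Type) (s : seq I) (P : pred I) D (F : I -> plane R -> R) :
  measurable D -> (forall i, integ D (F i)) ->
  integ D (fun x => \sum_(i <- s | P i) F i x).
Proof.
move=> mD iF; elim: s => [|i s IH].
  by apply: eq_integ (integ0 D) => // x _; rewrite big_nil.
apply: (@eq_integ _ (fun x => (if P i then F i x else 0) +
                              \sum_(j <- s | P j) F j x)) => //.
  by move=> x _; rewrite big_cons; case: (P i); rewrite ?add0r.
by apply: integD => //; case: (P i) => //; exact: integ0.
Qed.

Lemma int2_sum (I : Type) (s : seq I) (P : pred I) D (F : I -> plane R -> R) :
  measurable D -> (forall i, integ D (F i)) ->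
  int2 D (fun x => \sum_(i <- s | P i) F i x) = \sum_(i <- s | P i) int2 D (F i).
Proof.
move=> mD iF; elim: s => [|i s IH].
  by rewrite big_nil -[RHS](int2_0 D); apply: eq_int2 => x _; rewrite big_nil.
rewrite big_cons -IH; case: ifPn => Pi.
  rewrite -int2D //; last exact: integ_sum.
  by apply: eq_int2 => x _; rewrite big_cons Pi.
by apply: eq_int2 => x _; rewrite big_cons (negbTE Pi).
Qed.

Lemma int2_ge0 D v : (forall x, D x -> 0 <= v x) -> 0 <= int2 D v.
Proof. exact: Rintegral_ge0. Qed.

Lemma le_int2 D v w : measurable D -> integ D v -> integ D w ->
  (forall x, D x -> v x <= w x) -> int2 D v <= int2 D w.
Proof. exact: le_Rintegral. Qed.

Lemma le_norm_int2 D v : measurable D -> integ D v ->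
  `|int2 D v| <= int2 D (fun x => `|v x|).
Proof. exact: le_normr_Rintegral. Qed.

Lemma integ_norm D v : measurable D -> integ D v -> integ D (fun x => `|v x|).
Proof. by move=> mD iv; apply: (integrable_norm iv). Qed.

Lemma le_norm_int2_dom D v w : measurable D -> integ D w ->
  measurable_fun D v -> (forall x, D x -> `|v x| <= w x) ->
  `|int2 D v| <= int2 D w.
Proof.
move=> mD iw mv vw; have iv := integ_le mD mv vw iw.
apply: le_trans (le_norm_int2 mD iv) _; apply: le_int2 => //.
exact: integ_norm.
Qed.

Lemma le_norm_int2_cst D v (M : R) : measurable D -> (mu2 R D < +oo)%E ->
  measurable_fun D v -> (forall x, D x -> `|v x| <= M) ->
  `|int2 D v| <= M * fine (mu2 R D).
Proof.
move=> mD Doo mv vM; rewrite -int2_cst //; apply: le_norm_int2_dom => //.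
by apply: (@integ_bounded _ _ `|M|) => //; exact: measurable_cst.
Qed.

Lemma int2_restrict D E v : measurable D -> measurable E -> D `<=` E ->
  (forall x, E x -> ~ D x -> v x = 0) -> int2 E v = int2 D v.
Proof.
move=> mD mE DE v0; rewrite /int2 Rintegral_mkcond [RHS]Rintegral_mkcond.
congr Rintegral; apply/funext => x; rewrite /patch.
case: ifPn => [/set_mem Ex|nE]; case: ifPn => [/set_mem Dx|/negP nD] //.
  by apply: v0 => // Dx; apply: nD; exact: mem_set.
by case/negP: nE; apply: mem_set; exact: DE.
Qed.

Lemma integ_restrict D E v : measurable D -> measurable E -> D `<=` E ->
  (forall x, E x -> ~ D x -> v x = 0) -> integ D v -> integ E v.
Proof.
move=> mD mE DE v0 iv.
have iv1 := (integrable_mkcond (EFin \o v) mD).1 iv.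
have iv2 : (mu2 R).-integrable E ((EFin \o v) \_ D).
  exact: (integrableS measurableT mE (@subsetT _ E) iv1).
apply: eq_integrable iv2 => // x /set_mem Ex; rewrite /patch /=.
case: ifPn => // /negP nD; rewrite v0 //.
by move=> Dx; apply: nD; exact: mem_set.
Qed.

Lemma int2_ae_eq D v w : measurable D -> measurable_fun D v ->
  measurable_fun D w -> ae_eq (mu2 R) D v w -> int2 D v = int2 D w.
Proof.
move=> mD mv mw vw; rewrite /int2 /Rintegral; congr fine.
apply: ae_eq_integral => //; try exact/measurable_EFinP.
by apply: filterS vw => x h /h /= ->.
Qed.

Lemma integ_ae_eq D v w : measurable D -> measurable_fun D w ->
  ae_eq (mu2 R) D v w -> integ D v -> integ D w.
Proof.
move=> mD mw vw /integrableP[mv voo]; apply/integrableP; split.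
  exact/measurable_EFinP.
apply: le_lt_trans voo; rewrite le_eqVlt; apply/orP; left; apply/eqP.
apply: ae_eq_integral => //; try exact: measurableT_comp.
- by apply: measurableT_comp => //; exact/measurable_EFinP.
- by apply: filterS vw => x h /h /= ->.
Qed.

Lemma int2_dct D (F : nat -> plane R -> R) v g : measurable D ->
  (forall n, measurable_fun D (F n)) -> measurable_fun D v ->
  {ae mu2 R, forall x, D x -> F ^~ x @ \oo --> v x} ->
  integ D g -> (forall n x, D x -> `|F n x| <= g x) ->
  integ D v /\ (fun n => int2 D (F n)) @ \oo --> int2 D v.
Proof.
move=> mD mF mv Fv ig Fg.
have [iv _ h] := @dominated_convergence _ _ R (mu2 R) D mD
  (fun n => EFin \o F n) (EFin \o v) (EFin \o g)
  (fun n => (measurable_EFinP _ _).2 (mF n)) ((measurable_EFinP _ _).2 mv)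
  ltac:(by apply: filterS Fv => x h /h hx; apply/fine_cvgP; split; [exact: nearW|exact: hx])
  ig ltac:(by apply: aeW => x n /Fg; rewrite lee_fin).
split=> //; apply: fine_cvg.
rewrite /int2 /Rintegral fineK; first exact: h.
exact: integrable_fin_num.
Qed.

End PlaneIntegral.
Section L2Plane.
Context {R : realType}.
Implicit Types (D E : set (plane R)) (v w : plane R -> R).
Implicit Types g h : plane R -> plane R.

Lemma L2P D v : measurable D ->
  L2 D v <-> measurable_fun D v /\ integ D (fun x => v x ^+ 2).
Proof.
move=> mD; split => -[mv voo]; split => //; last first.
  have /integrableP[_] := voo; apply: le_lt_trans.
  rewrite le_eqVlt; apply/orP; left; apply/eqP; apply: eq_integral => x _ /=.
  by rewrite ger0_norm // sqr_ge0.
apply/integrableP; split.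
  by apply/measurable_EFinP; exact: measurable_funX.
apply: le_lt_trans voo; rewrite le_eqVlt; apply/orP; left; apply/eqP.
by apply: eq_integral => x _ /=; rewrite ger0_norm // sqr_ge0.
Qed.

Lemma L2_measurable D v : L2 D v -> measurable_fun D v.
Proof. by case. Qed.

Lemma L2_sqr D v : measurable D -> L2 D v -> integ D (fun x => v x ^+ 2).
Proof. by move=> mD /(L2P _ mD) []. Qed.

Lemma L2_mul D v w : measurable D -> L2 D v -> L2 D w ->
  integ D (fun x => v x * w x).
Proof.
move=> mD Lv Lw.
apply: (@integ_le _ _ _ (fun x => v x ^+ 2 + w x ^+ 2)) => //.
- by apply: measurable_funM; exact: L2_measurable.
- move=> x _; rewrite normrM -(real_normK (num_real (v x))).
  rewrite -(real_normK (num_real (w x))).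
  by move: (normr_ge0 (v x)) (normr_ge0 (w x)); nra.
- by apply: integD => //; exact: L2_sqr.
Qed.

Lemma L2_le D v w : measurable D -> measurable_fun D v ->
  (forall x, D x -> `|v x| <= `|w x|) -> L2 D w -> L2 D v.
Proof.
move=> mD mv vw Lw; apply/(L2P _ mD); split => //.
apply: (@integ_le _ _ _ (fun x => w x ^+ 2)) => //.
- exact: measurable_funX.
- move=> x Dx; rewrite normrX -(real_normK (num_real (w x))).
  by rewrite lerXn2r ?nnegrE // vw.
- exact: L2_sqr.
Qed.

Lemma L2Z D c v : measurable D -> L2 D v -> L2 D (fun x => c * v x).
Proof.
move=> mD Lv; apply/(L2P _ mD); split.
  by apply: measurable_funM => //; exact: L2_measurable.
apply: eq_integ (integZ (c ^+ 2) mD (L2_sqr mD Lv)) => // x _.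
by rewrite exprMn.
Qed.

Lemma L2D D v w : measurable D -> L2 D v -> L2 D w ->
  L2 D (fun x => v x + w x).
Proof.
move=> mD Lv Lw; apply/(L2P _ mD); split.
  by apply: measurable_funD; exact: L2_measurable.
have := integD mD (integD mD (L2_sqr mD Lv) (L2_sqr mD Lw))
  (integZ 2 mD (L2_mul mD Lv Lw)).
by apply: eq_integ => // x _; ring.
Qed.

Lemma L2B D v w : measurable D -> L2 D v -> L2 D w ->
  L2 D (fun x => v x - w x).
Proof.
move=> mD Lv Lw.
have -> : (fun x => v x - w x) = (fun x => v x + -1 * w x).
  by apply/funext => x; rewrite mulN1r.
by apply: L2D => //; exact: L2Z.
Qed.

Lemma L2S D E v : measurable D -> measurable E -> D `<=` E -> L2 E v -> L2 D v.
Proof.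
move=> mD mE DE /(L2P _ mE)[mv iv]; apply/(L2P _ mD); split.
  exact: measurable_funS mv.
exact: integS iv.
Qed.

Lemma L2_bounded D v (M : R) : measurable D -> (mu2 R D < +oo)%E ->
  measurable_fun D v -> (forall x, D x -> `|v x| <= M) -> L2 D v.
Proof.
move=> mD Doo mv vM; apply/(L2P _ mD); split => //.
apply: (@integ_bounded _ _ _ (M ^+ 2)) => //; first exact: measurable_funX.
move=> x Dx; rewrite normrX lerXn2r ?nnegrE ?vM //.
exact: le_trans (vM _ Dx).
Qed.

Lemma L2_0 D : L2 D (fun=> 0).
Proof.
split; first exact: measurable_cst.
by under eq_integral do rewrite expr0n /=; rewrite integral0.
Qed.

Lemma L2_mul_bounded D v w (M : R) : measurable D -> measurable_fun D v ->
  (forall x, D x -> `|v x| <= M) -> L2 D w -> L2 D (fun x => v x * w x).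
Proof.
move=> mD mv vM Lw; apply: (@L2_le _ _ (fun x => M * w x)) => //.
- by apply: measurable_funM => //; exact: L2_measurable.
- move=> x Dx; rewrite !normrM ler_wpM2r //.
  exact: le_trans (vM _ Dx) (ler_norm _).
- exact: L2Z.
Qed.

Lemma L2_integ D v : measurable D -> (mu2 R D < +oo)%E -> L2 D v -> integ D v.
Proof.
move=> mD Doo Lv; apply: (eq_integ mD _ (L2_mul mD Lv (w := fun=> 1) _)).
  by move=> x _; rewrite mulr1.
by apply: (@L2_bounded _ _ 1) => // x _; rewrite normr1.
Qed.

Lemma discriminant_le (a b c : R) : 0 <= a -> 0 <= c ->
  (forall t, 0 <= a + 2 * b * t + c * t ^+ 2) -> `|b| <= Num.sqrt a * Num.sqrt c.
Proof.
move=> a0 c0 h; rewrite -sqrtrM // -sqrtr_sqr ler_sqrt; last exact: mulr_ge0.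
move: c0; rewrite le_eqVlt => /predU1P[c0|c0].
  rewrite -c0 mulr0.
  suff -> : b = 0 by rewrite expr0n.
  apply/eqP/negPn/negP => b0.
  have := h (- (a + 1) / (2 * b)); rewrite -c0 mul0r addr0.
  have -> : a + 2 * b * (- (a + 1) / (2 * b)) = -1 by field.
  lra.
have := h (- b / c).
have -> : a + 2 * b * (- b / c) + c * (- b / c) ^+ 2 = (a * c - b ^+ 2) / c.
  by field; rewrite gt_eqF.
by rewrite pmulr_lge0 ?invr_gt0 // subr_ge0.
Qed.

Definition L2v D g : Prop := L2 D (fun x => (g x).1) /\ L2 D (fun x => (g x).2).

Definition vnorm D g : R := Num.sqrt (int2 D (fun x => dot (g x) (g x))).

Lemma L2v_dot D g h : measurable D -> L2v D g -> L2v D h ->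
  integ D (fun x => dot (g x) (h x)).
Proof. by move=> mD [? ?] [? ?]; apply: integD => //; exact: L2_mul. Qed.

Lemma dot_ge0 (x : plane R) : 0 <= dot x x.
Proof. by rewrite /dot addr_ge0 // -expr2 sqr_ge0. Qed.

Lemma int2_dot_ge0 D g : 0 <= int2 D (fun x => dot (g x) (g x)).
Proof. by apply: int2_ge0 => x _; exact: dot_ge0. Qed.

Lemma vnorm_ge0 D g : 0 <= vnorm D g. Proof. exact: sqrtr_ge0. Qed.

Lemma vnorm_sqr D g : vnorm D g ^+ 2 = int2 D (fun x => dot (g x) (g x)).
Proof. by rewrite sqr_sqrtr // int2_dot_ge0. Qed.

Definition vlin (c : R) g h : plane R -> plane R :=
  fun x => (c * (g x).1 + (h x).1, c * (g x).2 + (h x).2).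

Lemma L2v_lin D c g h : measurable D -> L2v D g -> L2v D h ->
  L2v D (vlin c g h).
Proof. by move=> mD [? ?] [? ?]; split; apply: L2D => //; exact: L2Z. Qed.

Lemma int2_dot_vlin D c g h : measurable D -> L2v D g -> L2v D h ->
  int2 D (fun x => dot (vlin c g h x) (vlin c g h x)) =
  int2 D (fun x => dot (h x) (h x)) + 2 * c * int2 D (fun x => dot (g x) (h x))
  + c ^+ 2 * int2 D (fun x => dot (g x) (g x)).
Proof.
move=> mD Lg Lh.
rewrite -int2Z //; last exact: L2v_dot.
rewrite -[c ^+ 2 * _]int2Z //; last exact: L2v_dot.
rewrite -int2D //; [|exact: L2v_dot|by apply: integZ => //; exact: L2v_dot].
rewrite -int2D //; last 2 first.
- by apply: integD => //; [exact: L2v_dot|apply: integZ => //; exact: L2v_dot].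
- by apply: integZ => //; exact: L2v_dot.
by apply: eq_int2 => x _; rewrite /dot /=; ring.
Qed.

Lemma int2_dot_linl D c g h k : measurable D -> L2v D g -> L2v D h ->
  L2v D k -> int2 D (fun x => dot (vlin c g h x) (k x)) =
  c * int2 D (fun x => dot (g x) (k x)) + int2 D (fun x => dot (h x) (k x)).
Proof.
move=> mD Lg Lh Lk; rewrite -int2Z //; last exact: L2v_dot.
rewrite -int2D //; [|by apply: integZ => //; exact: L2v_dot|exact: L2v_dot].
by apply: eq_int2 => x _; rewrite /dot /=; ring.
Qed.

Lemma vnorm_CS D g h : measurable D -> L2v D g -> L2v D h ->
  `|int2 D (fun x => dot (g x) (h x))| <= vnorm D g * vnorm D h.
Proof.
move=> mD Lg Lh; rewrite mulrC; apply: discriminant_le; try exact: int2_dot_ge0.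
move=> t; have := int2_dot_ge0 D (vlin t g h).
by rewrite int2_dot_vlin //; congr (_ <= _); ring.
Qed.

Lemma vnorm_triangle D g h : measurable D -> L2v D g -> L2v D h ->
  vnorm D (vlin 1 g h) <= vnorm D g + vnorm D h.
Proof.
move=> mD Lg Lh; rewrite -(@ler_pXn2r _ 2) ?nnegrE ?addr_ge0 ?vnorm_ge0 //.
rewrite sqrrD !vnorm_sqr int2_dot_vlin //.
have := le_trans (ler_norm _) (vnorm_CS mD Lg Lh); rewrite mulr2n.
by move: (int2 _ _) (int2 _ _) (int2 _ _) => a b c; nra.
Qed.

Lemma L2_CS D v w : measurable D -> L2 D v -> L2 D w ->
  `|int2 D (fun x => v x * w x)| <= l2norm D v * l2norm D w.
Proof.
move=> mD Lv Lw.
have := @vnorm_CS D (fun x => (v x, 0)) (fun x => (w x, 0)) mD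
  (conj Lv (L2_0 D)) (conj Lw (L2_0 D)).
rewrite /vnorm /dot /=.
by congr (`|_| <= Num.sqrt _ * Num.sqrt _); apply: eq_int2 => x _;
  rewrite mulr0 addr0.
Qed.

End L2Plane.
Section Smooth1.
Context {R : realType}.
Implicit Types (f g h : R -> R) (t : R).

Lemma is_derive1_derivable h t d : is_derive t 1 h d ->
  derivable h t 1 /\ h^`()%classic t = d.
Proof. by move=> [dh <-]; split => //; rewrite derive1E. Qed.

Lemma derivable_is_derive1 h t : derivable h t 1 ->
  is_derive t 1 h (h^`()%classic t).
Proof. by move=> dh; rewrite derive1E; exact: DeriveDef. Qed.

Lemma eq_is_derive1 h t (d e : R) : is_derive t 1 h d -> d = e ->
  is_derive t 1 h e.
Proof. by move=> hd <-. Qed.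

Lemma derivable_continuous1 h : (forall t, derivable h t 1) -> continuous h.
Proof. by move=> dh t; apply/differentiable_continuous/derivable1_diffP. Qed.

Fixpoint Ck1 (k : nat) h : Prop :=
  if k is k'.+1 then (forall t, derivable h t 1) /\ Ck1 k' h^`()%classic
  else continuous h.

Definition smooth1 h := forall k, Ck1 k h.

Lemma Ck1W k h : Ck1 k.+1 h -> Ck1 k h.
Proof.
elim: k h => [|k IH] h /= [dh ch]; first exact: derivable_continuous1.
by split => //; exact: IH.
Qed.

Lemma Ck1D k f g : Ck1 k f -> Ck1 k g -> Ck1 k (fun t => f t + g t).
Proof.
elim: k f g => [|k IH] f g /= => [cf cg t|[df cf] [dg cg]].
  by apply: cvgD; [exact: cf|exact: cg].
have d t : is_derive t 1 (fun t => f t + g t) (f^`()%classic t + g^`()%classic t).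
  by apply: is_deriveD; exact: derivable_is_derive1.
split; first by move=> t; have [] := is_derive1_derivable (d t).
have -> : (fun t => f t + g t)^`()%classic =
    (fun t => f^`()%classic t + g^`()%classic t).
  by apply/funext => t; have [] := is_derive1_derivable (d t).
exact: IH.
Qed.

Lemma is_derive1M f g t (df dg : R) : is_derive t 1 f df -> is_derive t 1 g dg ->
  is_derive t 1 (fun t => f t * g t) (df * g t + f t * dg).
Proof.
move=> hf hg.
have H : is_derive t 1 (fun t => f t * g t) (f t *: dg + g t *: df).
  exact: is_deriveM hf hg.
apply: (eq_is_derive1 H).
by rewrite /GRing.scale /= addrC [g t * _]mulrC.
Qed.

Lemma Ck1M k f g : Ck1 k f -> Ck1 k g -> Ck1 k (fun t => f t * g t).
Proof.
elim: k f g => [|k IH] f g.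
  by move=> cf cg t; apply: cvgM; [exact: cf|exact: cg].
move=> cf1 cg1; have cf0 := Ck1W cf1; have cg0 := Ck1W cg1.
move: cf1 cg1 => /= -[df cf] [dg cg].
have d t : is_derive t 1 (fun t => f t * g t)
    (f^`()%classic t * g t + f t * g^`()%classic t).
  by apply: is_derive1M; exact: derivable_is_derive1.
split; first by move=> t; have [] := is_derive1_derivable (d t).
have -> : (fun t => f t * g t)^`()%classic =
    (fun t => f^`()%classic t * g t + f t * g^`()%classic t).
  by apply/funext => t; have [] := is_derive1_derivable (d t).
by apply: Ck1D; exact: IH.
Qed.

Lemma Ck1_cst k (c : R) : Ck1 k (fun=> c).
Proof.
elim: k c => [|k IH] c /=; first exact: cst_continuous.
have d t : is_derive t 1 (fun=> c) (0 : R) by exact: is_derive_cst.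
split; first by move=> t; have [] := is_derive1_derivable (d t).
have -> : (fun=> c)^`()%classic = (fun=> 0 : R).
  by apply/funext => t; have [] := is_derive1_derivable (d t).
exact: IH.
Qed.

Lemma is_derive1_affine (a b t : R) : is_derive t 1 (fun t => a + b * t) b.
Proof.
have h1 : is_derive t 1 (fun=> a) (0 : R) by exact: is_derive_cst.
have h2 : is_derive t 1 (fun t : R => b * t) (0 * t + b * 1).
  exact: (is_derive1M (is_derive_cst b t 1) (is_derive_id t 1)).
have H : is_derive t 1 (fun t => a + b * t) (0 + (0 * t + b * 1)).
  exact: is_deriveD h1 h2.
by apply: (eq_is_derive1 H); ring.
Qed.

Lemma is_derive1_comp_affine h (a b t d : R) : is_derive (a + b * t) 1 h d ->
  is_derive t 1 (fun t => h (a + b * t)) (d * b).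
Proof.
move=> hd.
exact: (is_derive1_comp (g := fun t => a + b * t) hd (is_derive1_affine a b t)).
Qed.

Lemma Ck1_comp_affine k h (a b : R) : Ck1 k h -> Ck1 k (fun t => h (a + b * t)).
Proof.
elim: k h => [|k IH] h /= => [ch t|[dh ch]].
  apply: (@continuous_comp _ _ _ (fun t => a + b * t) h); last exact: ch.
  apply: differentiable_continuous; apply/derivable1_diffP.
  by have [] := is_derive1_derivable (is_derive1_affine a b t).
have d t : is_derive t 1 (fun t => h (a + b * t))
    (h^`()%classic (a + b * t) * b).
  by apply: is_derive1_comp_affine; exact: derivable_is_derive1.
split; first by move=> t; have [] := is_derive1_derivable (d t).
have -> : (fun t => h (a + b * t))^`()%classic =
    (fun t => h^`()%classic (a + b * t) * b).
  by apply/funext => t; have [] := is_derive1_derivable (d t).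
by apply: Ck1M; [exact: IH|exact: Ck1_cst].
Qed.

Lemma smooth1_derive h : smooth1 h -> smooth1 h^`()%classic.
Proof. by move=> sh k; have [] := sh k.+1. Qed.

Lemma smooth1_derivable h t : smooth1 h -> derivable h t 1.
Proof. by move=> sh; have [] := sh 1%N. Qed.

Lemma smooth1_continuous h : smooth1 h -> continuous h.
Proof. by move=> sh; exact: (sh 0%N). Qed.

Lemma smooth1_is_derive h t : smooth1 h -> is_derive t 1 h (h^`()%classic t).
Proof. by move=> sh; apply: derivable_is_derive1; exact: smooth1_derivable. Qed.

Definition expinv (c : R) (p : {poly R}) (t : R) : R :=
  if 0 < t then p.[t^-1] * expR (- (c / t)) else 0.

Lemma expR_ge_pow (y : R) (n : nat) : 0 <= y ->
  (y / n.+1%:R) ^+ n.+1 <= expR y.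
Proof.
move=> y0; have -> : expR y = expR (y / n.+1%:R) ^+ n.+1.
  by rewrite -expRM_natl mulrC divfK // pnatr_eq0.
rewrite lerXn2r ?nnegrE ?expR_ge0 //; first by rewrite divr_ge0.
by apply: le_trans (expR_ge1Dx _); rewrite lerDr.
Qed.

Lemma horner_bound (p : {poly R}) (y : R) : 1 <= y ->
  `|p.[y]| <= (\sum_(i < size p) `|p`_i|) * y ^+ size p.
Proof.
move=> y1; have y0 : 0 <= y by lra.
rewrite horner_coef (le_trans (ler_norm_sum _ _ _)) // mulr_suml ler_sum //.
move=> i _; rewrite normrM normrX (ger0_norm y0) ler_wpM2l //.
by apply: ler_weXn2l => //; exact: ltnW.
Qed.

Lemma expinv_bound c p : 0 < c -> exists2 K : R, 0 <= K & forall t : R,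
  `|t| <= 1 -> `|expinv c p t| <= K * t ^+ 2.
Proof.
move=> c0; pose n := (size p).+1; pose S := \sum_(i < size p) `|p`_i|.
have S0 : 0 <= S by apply: sumr_ge0.
exists (S * (n.+1%:R / c) ^+ n.+1).
  by rewrite mulr_ge0 // exprn_ge0 // divr_ge0 // ltW.
move=> t t1; rewrite /expinv; case: ifPn => t0; last first.
  by rewrite normr0 mulr_ge0 ?sqr_ge0 // mulr_ge0 // exprn_ge0 // divr_ge0 // ltW.
rewrite gtr0_norm // in t1.
have y1 : 1 <= t^-1 by rewrite invf_ge1.
rewrite normrM (ger0_norm (expR_ge0 _)) expRN.
have h := @expR_ge_pow (c / t) n ltac:(by rewrite divr_ge0 // ltW).
have E0 : 0 < (c / t / n.+1%:R) ^+ n.+1 by rewrite exprn_gt0 // !divr_gt0.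
have h2 : (expR (c / t))^-1 <= ((c / t / n.+1%:R) ^+ n.+1)^-1.
  by rewrite lef_pV2 // posrE ?expR_gt0.
apply: le_trans (ler_pM (normr_ge0 _) _ (horner_bound p y1) h2) _.
  by rewrite invr_ge0 expR_ge0.
rewrite -exprVn -/S.
have -> : (c / t / n.+1%:R)^-1 = n.+1%:R / c * t.
  by rewrite !invfM !invrK mulrC mulrA.
have E (C : R) s : t^-1 ^+ s * (C * t) ^+ s.+2 = C ^+ s.+2 * t ^+ 2.
  rewrite exprMn (_ : t ^+ s.+2 = t ^+ s * t ^+ 2); last first.
    by rewrite -exprD addn2.
  by rewrite mulrCA mulrA mulrA -!mulrA [t^-1 ^+ s * _]mulrA -exprMn mulVf ?gt_eqF // expr1n mul1r.
by rewrite -[X in X <= _]mulrA E mulrA.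
Qed.

Lemma is_derive_quadratic h (K : R) : h 0 = 0 ->
  (forall t, `|t| <= 1 -> `|h t| <= K * t ^+ 2) -> is_derive (0 : R) 1 h 0.
Proof.
move=> h0 hK.
have K1 : 0 < `|K| + 1 by have := normr_ge0 K; lra.
have lim : t^-1 *: (h (t *: 1 + 0) - h 0) @[t --> (0:R)^'] --> (0 : R).
  apply/cvgrPdist_lt => e e0; near=> t.
  have t0 : t != 0 by near: t; exact: nbhs_dnbhs_neq.
  have tK : `|t| < e / (`|K| + 1).
    by near: t; apply: dnbhs0_lt; exact: divr_gt0.
  have t1 : `|t| < 1 by near: t; exact: dnbhs0_lt.
  rewrite h0 subr0 sub0r normrN addr0 /GRing.scale /= mulr1 normrM normfV.
  rewrite mulrC ltr_pdivrMr ?normr_gt0 //.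
  apply: le_lt_trans (hK _ (ltW t1)) _.
  rewrite -(real_normK (num_real t)) expr2 mulrA ltr_pM2r ?normr_gt0 //.
  apply: le_lt_trans (_ : (`|K| + 1) * `|t| < _).
    by rewrite ler_wpM2r // (le_trans (ler_norm _)) // lerDl.
  by rewrite mulrC -ltr_pdivlMr.
apply: DeriveDef; first by apply/cvg_ex; exists 0.
exact/cvg_lim.
Unshelve. all: by end_near. Qed.

Lemma is_derive_expinv c p t : 0 < c ->
  is_derive t 1 (expinv c p) (expinv c ('X ^+ 2 * (c *: p - p^`())) t).
Proof.
move=> c0; have [t0|t0|->] := ltgtP t 0.
- rewrite {2}/expinv ltNge ltW //=.
  apply: (@near_eq_is_derive _ _ _ (fun=> 0)).
  near=> s; rewrite /expinv; case: ifPn => // s0.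
  have : s < 0 by near: s; exact: lt_nbhsl.
  by move/(lt_trans s0); rewrite ltxx.
- rewrite {2}/expinv t0.
  have dV : is_derive t 1 (fun s : R => s^-1) (- t ^- 2).
    have H : is_derive t 1 (fun s : R => s^-1) (- t ^- 2 *: (1 : R)).
      exact: (is_deriveV (f := id) (lt0r_neq0 t0) (is_derive_id _ _)).
    by apply: (eq_is_derive1 H); rewrite /GRing.scale /= mulr1.
  have d1 : is_derive t 1 (fun s : R => p.[s^-1]) (p^`().[t^-1] * - t ^- 2).
    exact: (is_derive1_comp (g := fun s : R => s^-1) (is_derive_poly p t^-1) dV).
  have d2 : is_derive t 1 (fun s : R => - c * s^-1) (- c * - t ^- 2).
    apply: (eq_is_derive1 (is_derive1M (is_derive_cst (- c) t 1) dV)).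
    by rewrite mul0r add0r.
  have d3 : is_derive t 1 (fun s : R => expR (- c * s^-1))
      (expR (- c * t^-1) * (- c * - t ^- 2)).
    exact: (is_derive1_comp (g := fun s : R => - c * s^-1) (is_derive_expR _) d2).
  have d4 : is_derive t 1 (fun s => p.[s^-1] * expR (- c * s^-1))
      (('X ^+ 2 * (c *: p - p^`())).[t^-1] * expR (- (c / t))).
    apply: (eq_is_derive1 (is_derive1M d1 d3)).
    rewrite !hornerE mulNr.
    by rewrite /=; field; rewrite gt_eqF.
  apply: (near_eq_is_derive _ d4).
  near=> s; rewrite /expinv; case: ifPn => [_|/negP[]].
    by rewrite mulNr.
  by near: s; exact: lt_nbhsr.
- rewrite {2}/expinv ltxx.
  have [K K0 hK] := expinv_bound p c0.
  by apply: (is_derive_quadratic (K := K)) => //; rewrite /expinv ltxx.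
Unshelve. all: by end_near. Qed.

Lemma smooth1_expinv c p : 0 < c -> smooth1 (expinv c p).
Proof.
move=> c0 k; elim: k p => [|k IH] p /=.
  apply: derivable_continuous1 => t.
  by have [] := is_derive1_derivable (is_derive_expinv p t c0).
split.
  by move=> t; have [] := is_derive1_derivable (is_derive_expinv p t c0).
have -> : (expinv c p)^`()%classic = expinv c ('X ^+ 2 * (c *: p - p^`())).
  by apply/funext => t; have [] := is_derive1_derivable (is_derive_expinv p t c0).
exact: IH.
Qed.

Definition bumpf (c a b t : R) : R :=
  expinv c 1 (- a + 1 * t) * expinv c 1 (b + -1 * t).

Lemma bumpfE c a b t : bumpf c a b t =
  if a < t < b then expR (- (c / (t - a))) * expR (- (c / (b - t))) else 0.
Proof.
rewrite /bumpf /expinv !hornerE mulN1r (addrC (- a)) !subr_gt0.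
by case: ifP => //= _; [case: ifP => // _; rewrite mulr0|rewrite mul0r].
Qed.

Lemma smooth1_bumpf c a b : 0 < c -> smooth1 (bumpf c a b).
Proof.
by move=> c0 k; apply: Ck1M; apply: Ck1_comp_affine; exact: smooth1_expinv.
Qed.

Lemma bumpf_ge0 c a b t : 0 <= bumpf c a b t.
Proof. by rewrite bumpfE; case: ifP => // _; rewrite mulr_ge0 ?expR_ge0. Qed.

Lemma bumpf_le1 c a b t : 0 < c -> bumpf c a b t <= 1.
Proof.
move=> c0; rewrite bumpfE; case: ifP => // /andP[ta tb].
rewrite -expRD -[X in _ <= X]expR0 ler_expR -opprD oppr_le0.
by rewrite addr_ge0 // divr_ge0 ?subr_ge0 // ltW.
Qed.

Lemma bumpf_gt0 c a b t : a < t < b -> 0 < bumpf c a b t.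
Proof. by move=> h; rewrite bumpfE h mulr_gt0 ?expR_gt0. Qed.

Lemma bumpf_out c a b t : ~~ (a < t < b) -> bumpf c a b t = 0.
Proof. by move=> /negbTE h; rewrite bumpfE h. Qed.

Lemma bumpf_cvg a b t :
  (fun n => bumpf n.+1%:R^-1 a b t) @ \oo --> ((a < t < b)%R%:R : R).
Proof.
case: (boolP (a < t < b)) => h; last first.
  by under eq_fun do rewrite bumpf_out //; exact: cvg_cst.
have cv (d : R) : (fun n => expR (- (n.+1%:R^-1 / d))) @ \oo --> (1 : R).
  have H : (fun n => n.+1%:R^-1 : R) @ \oo --> (0 : R) by exact: cvg_harmonic.
  have H2 : (fun n => - (n.+1%:R^-1 / d) : R) @ \oo --> (- (0 / d) : R).
    exact: (cvgN (cvgM H (cvg_cst d^-1))).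
  have H3 := cvg_comp _ _ H2 (@continuous_expR R (- (0 / d))).
  by rewrite mul0r oppr0 expR0 in H3.
under eq_fun do rewrite bumpfE h.
by have H := cvgM (cv (t - a)) (cv (b - t)); rewrite mulr1 in H; exact: H.
Qed.

End Smooth1.
Section CkPlane.
Context {R : realType}.
Implicit Types (v w : plane R -> R) (D K : set (plane R)) (x : plane R).

Definition has_pd1 v x (d : R) := is_derive (x.1 : R) 1 (fun t : R => v (t, x.2)) d.
Definition has_pd2 v x (d : R) := is_derive (x.2 : R) 1 (fun t : R => v (x.1, t)) d.

Lemma has_pd1E v x d : has_pd1 v x d ->
  derivable (fun t : R => v (t, x.2)) x.1 1 /\ pd1 v x = d.
Proof. exact: is_derive1_derivable. Qed.

Lemma has_pd2E v x d : has_pd2 v x d ->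
  derivable (fun t : R => v (x.1, t)) x.2 1 /\ pd2 v x = d.
Proof. exact: is_derive1_derivable. Qed.

Lemma Ck_has_pd1 k v x : Ck k.+1 v -> has_pd1 v x (pd1 v x).
Proof. by move=> [_ [dv _]]; have [h _] := dv x; exact: derivable_is_derive1. Qed.

Lemma Ck_has_pd2 k v x : Ck k.+1 v -> has_pd2 v x (pd2 v x).
Proof. by move=> [_ [dv _]]; have [_ h] := dv x; exact: derivable_is_derive1. Qed.

Lemma Ck_continuous k v : Ck k v -> continuous v.
Proof. by case: k => [|k] []. Qed.

Lemma CkS k v (d1 d2 : plane R -> R) : continuous v ->
  (forall x, has_pd1 v x (d1 x)) -> (forall x, has_pd2 v x (d2 x)) ->
  Ck k d1 -> Ck k d2 -> Ck k.+1 v.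
Proof.
move=> cv h1 h2 c1 c2; split; [exact: cv|split].
  by move=> x; split; [have [] := has_pd1E (h1 x)|have [] := has_pd2E (h2 x)].
have -> : pd1 v = d1 by apply/funext => x; have [] := has_pd1E (h1 x).
by have -> : pd2 v = d2 by apply/funext => x; have [] := has_pd2E (h2 x).
Qed.

Lemma CkW k v : Ck k.+1 v -> Ck k v.
Proof.
elim: k v => [|k IH] v [cv [dv [c1 c2]]]; first by split.
exact: (conj cv (conj dv (conj (IH _ c1) (IH _ c2)))).
Qed.

Lemma CkD k v w : Ck k v -> Ck k w -> Ck k (fun x => v x + w x).
Proof.
elim: k v w => [|k IH] v w cv cw; have cv0 := Ck_continuous cv;
  have cw0 := Ck_continuous cw.
  by split; [move=> x; exact: (cvgD (cv0 x) (cw0 x))|].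
apply: (@CkS _ _ (fun x => pd1 v x + pd1 w x) (fun x => pd2 v x + pd2 w x)).
- by move=> x; exact: (cvgD (cv0 x) (cw0 x)).
- by move=> x; exact: (is_deriveD (Ck_has_pd1 x cv) (Ck_has_pd1 x cw)).
- by move=> x; exact: (is_deriveD (Ck_has_pd2 x cv) (Ck_has_pd2 x cw)).
- by apply: IH; [case: cv => _ [_ []]|case: cw => _ [_ []]].
- by apply: IH; [case: cv => _ [_ []]|case: cw => _ [_ []]].
Qed.

Lemma has_pd1M v w x (a b : R) : has_pd1 v x a -> has_pd1 w x b ->
  has_pd1 (fun x => v x * w x) x (a * w x + v x * b).
Proof. by case: x => x1 x2 ha hb; exact: is_derive1M. Qed.

Lemma has_pd2M v w x (a b : R) : has_pd2 v x a -> has_pd2 w x b ->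
  has_pd2 (fun x => v x * w x) x (a * w x + v x * b).
Proof. by case: x => x1 x2 ha hb; exact: is_derive1M. Qed.

Lemma CkM k v w : Ck k v -> Ck k w -> Ck k (fun x => v x * w x).
Proof.
elim: k v w => [|k IH] v w cv cw; have cv0 := Ck_continuous cv;
  have cw0 := Ck_continuous cw.
  by split; [move=> x; exact: (cvgM (cv0 x) (cw0 x))|].
have cv1 := CkW cv; have cw1 := CkW cw.
apply: (@CkS _ _ (fun x => pd1 v x * w x + v x * pd1 w x)
                 (fun x => pd2 v x * w x + v x * pd2 w x)).
- by move=> x; exact: (cvgM (cv0 x) (cw0 x)).
- by move=> x; exact: (has_pd1M (Ck_has_pd1 x cv) (Ck_has_pd1 x cw)).
- by move=> x; exact: (has_pd2M (Ck_has_pd2 x cv) (Ck_has_pd2 x cw)).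
- by case: cv => _ [_ [? ?]]; case: cw => _ [_ [? ?]]; apply: CkD; exact: IH.
- by case: cv => _ [_ [? ?]]; case: cw => _ [_ [? ?]]; apply: CkD; exact: IH.
Qed.

Lemma smooth_class (S : set (plane R -> R)) :
  (forall v, S v -> continuous v /\ exists d1 d2, [/\ S d1, S d2,
     forall x, has_pd1 v x (d1 x) & forall x, has_pd2 v x (d2 x)]) ->
  S `<=` @smooth R.
Proof.
move=> hS v Sv k; elim: k v Sv => [|k IH] v Sv.
  by have [cv _] := hS _ Sv; split.
have [cv [d1 [d2 [S1 S2 h1 h2]]]] := hS _ Sv.
by apply: CkS cv h1 h2 _ _; exact: IH.
Qed.

Lemma smooth_cst (c : R) : smooth (fun _ : plane R => c).
Proof.
apply: (smooth_class (S := [set v | exists c, v = fun=> c])); last by exists c.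
move=> _ [a ->]; split; first by move=> x; exact: cvg_cst.
exists (fun=> 0), (fun=> 0); split; try by exists 0.
  by move=> x; exact: is_derive_cst.
by move=> x; exact: is_derive_cst.
Qed.

Lemma smoothD v w : smooth v -> smooth w -> smooth (fun x => v x + w x).
Proof. by move=> sv sw k; exact: CkD. Qed.

Lemma smoothM v w : smooth v -> smooth w -> smooth (fun x => v x * w x).
Proof. by move=> sv sw k; exact: CkM. Qed.

Lemma smoothZ (c : R) v : smooth v -> smooth (fun x => c * v x).
Proof. by move=> sv; apply: smoothM => //; exact: smooth_cst. Qed.

Lemma smooth_pd1 v : smooth v -> smooth (pd1 v).
Proof. by move=> sv k; have [_ [_ []]] := sv k.+1. Qed.

Lemma smooth_pd2 v : smooth v -> smooth (pd2 v).
Proof. by move=> sv k; have [_ [_ []]] := sv k.+1. Qed.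

Lemma smooth_continuous v : smooth v -> continuous v.
Proof. by move=> sv; exact: Ck_continuous (sv 0%N). Qed.

Lemma smooth_tensor (h1 h2 : R -> R) : smooth1 h1 -> smooth1 h2 ->
  smooth (fun x : plane R => h1 x.1 * h2 x.2).
Proof.
move=> s1 s2; apply: (smooth_class (S := [set v | exists h1 h2 : R -> R,
  [/\ smooth1 h1, smooth1 h2 & v = fun x => h1 x.1 * h2 x.2]])); last first.
  by exists h1, h2.
move=> _ [g1 [g2 [t1 t2 ->]]]; split.
  move=> x; apply: cvgM.
    by apply: (@continuous_comp _ _ _ (fun x : plane R => x.1 : R) g1);
      [exact: continuous_fst_plane|exact: smooth1_continuous].
  by apply: (@continuous_comp _ _ _ (fun x : plane R => x.2 : R) g2);
      [exact: continuous_snd_plane|exact: smooth1_continuous].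
exists (fun x => g1^`()%classic x.1 * g2 x.2), (fun x => g1 x.1 * g2^`()%classic x.2).
split.
- by exists g1^`()%classic, g2; split => //; exact: smooth1_derive.
- by exists g1, g2^`()%classic; split => //; exact: smooth1_derive.
- move=> x; apply: (eq_is_derive1 (is_derive1M
    (smooth1_is_derive x.1 t1) (is_derive_cst (g2 x.2) (x.1 : R) 1))).
  by rewrite mulr0 addr0.
- move=> x; apply: (eq_is_derive1 (is_derive1M
    (is_derive_cst (g1 x.1) (x.2 : R) 1) (smooth1_is_derive x.2 t2))).
  by rewrite mul0r add0r.
Qed.

Definition csupp D v := exists K, [/\ compact K, K `<=` D &
  forall x, ~ K x -> v x = 0].

Lemma hausdorff_plane : hausdorff_space (plane R).
Proof. exact: norm_hausdorff. Qed.

Lemma compact_cbox (p q : plane R) : compact (cbox p q).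
Proof. by rewrite cbox_setX; apply: compact_setX; exact: segment_compact. Qed.

Lemma csuppD D v w : csupp D v -> csupp D w -> csupp D (fun x => v x + w x).
Proof.
move=> [K [cK KD K0]] [L [cL LD L0]]; exists (K `|` L); split.
- exact: compactU.
- by move=> x [/KD|/LD].
- by move=> x /not_orP[/K0 -> /L0 ->]; rewrite addr0.
Qed.

Lemma csuppMl D v w : csupp D v -> csupp D (fun x => w x * v x).
Proof.
move=> [K [cK KD K0]]; exists K; split => // x /K0 ->; exact: mulr0.
Qed.

Lemma test_fun_lin D (c : R) v w : test_fun D v -> test_fun D w ->
  test_fun D (fun x => c * v x + w x).
Proof.
move=> [sv Sv] [sw Sw]; split; last by apply: csuppD => //; exact: csuppMl.
by apply: smoothD => //; exact: smoothZ.
Qed.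

Lemma test_funM D v w : smooth v -> test_fun D w ->
  test_fun D (fun x => v x * w x).
Proof.
by move=> sv [sw Sw]; split; [exact: smoothM|exact: csuppMl].
Qed.

Lemma csupp_pd D v : csupp D v -> csupp D (pd1 v) /\ csupp D (pd2 v).
Proof.
move=> [K [cK KD K0]].
have oK : open (~` K) by apply: closed_openC; exact: compact_closed hausdorff_plane cK.
have h1 x : ~ K x -> has_pd1 v x 0.
  move=> nKx; have [e e0 he] := (open_planeP _).1 oK x nKx.
  apply: (@near_eq_is_derive _ _ _ (fun=> 0)).
  near=> t; rewrite K0 //; apply: he => /=; last by rewrite subrr normr0.
  by near: t; exact: nbhsx_ballx.
have h2 x : ~ K x -> has_pd2 v x 0.
  move=> nKx; have [e e0 he] := (open_planeP _).1 oK x nKx.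
  apply: (@near_eq_is_derive _ _ _ (fun=> 0)).
  near=> t; rewrite K0 //; apply: he => /=; first by rewrite subrr normr0.
  by near: t; exact: nbhsx_ballx.
split; exists K; split; [exact: cK|exact: KD| |exact: cK|exact: KD| ].
  by move=> x /h1 /has_pd1E[].
by move=> x /h2 /has_pd2E[].
Unshelve. all: by end_near. Qed.

Lemma test_fun_pd D v : test_fun D v -> test_fun D (pd1 v) /\ test_fun D (pd2 v).
Proof.
move=> [sv Sv]; have [S1 S2] := csupp_pd Sv.
by split; split => //; [exact: smooth_pd1|exact: smooth_pd2].
Qed.

Lemma test_funS D E v : D `<=` E -> test_fun D v -> test_fun E v.
Proof.
move=> DE [sv [K [cK KD K0]]]; split => //; exists K; split => //.
exact: subset_trans KD DE.
Qed.

Lemma compact_sub_cbox K : compact K ->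
  exists2 M : R, 0 < M & K `<=` cbox (- M, - M) (M, M).
Proof.
move=> /compact_bounded [M [_ hM]]; exists (`|M| + 1).
  by have := normr_ge0 M; lra.
move=> x Kx; have /= := hM (`|M| + 1) ltac:(have := ler_norm M; lra) x Kx.
by rewrite prod_normE ge_max !ler_norml /cbox /= => /andP[].
Qed.

Lemma csupp_bounded D v : continuous v -> csupp D v ->
  exists2 M : R, 0 <= M & forall x, `|v x| <= M.
Proof.
move=> cv [K [cK KD K0]].
have /compact_bounded [M [_ hM]] : compact (v @` K).
  by apply: continuous_compact => //; exact: continuous_subspaceT.
exists (`|M| + 1); first by have := normr_ge0 M; lra.
move=> x; have [Kx|nKx] := pselect (K x); last first.
  by rewrite K0 // normr0; have := normr_ge0 M; lra.
by apply: hM; [have := ler_norm M; lra|exists x].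
Qed.

Lemma measurable_compact_plane K : compact K -> measurable K.
Proof.
by move=> cK; apply: measurable_closed_plane; exact: compact_closed hausdorff_plane cK.
Qed.

Lemma mu2_bounded_lt (D : set (plane R)) (p q : plane R) :
  measurable D -> D `<=` cbox p q -> (mu2 R D < +oo)%E.
Proof.
move=> mD Dpq; pose q' : plane R := (Num.max p.1 q.1, Num.max p.2 q.2).
apply: (@le_lt_trans _ _ (mu2 R (cbox p q'))).
  apply: le_measure; rewrite ?inE; [exact: mD|exact: measurable_cbox|].
  move=> x /Dpq [/andP[a b] /andP[c d]].
  by split; rewrite ?a ?c /= le_max ?b ?d orbT.
by rewrite mu2_cboxE ?ltry //= le_max lexx.
Qed.

Lemma mu2_compact_lt K : compact K -> (mu2 R K < +oo)%E.
Proof.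
move=> cK; have [M _ KM] := compact_sub_cbox cK.
by apply: mu2_bounded_lt KM; exact: measurable_compact_plane.
Qed.

Lemma integ_csupp D v : measurable D -> continuous v -> csupp D v ->
  integ D v /\ integ setT v.
Proof.
move=> mD cv sv; have [M M0 vM] := csupp_bounded cv sv.
have [K [cK KD K0]] := sv; have mK := measurable_compact_plane cK.
have mv := measurable_fun_continuous_plane cv.
have iK : integ K v.
  apply: (@integ_bounded _ _ _ M) => //; first exact: mu2_compact_lt.
  exact: measurable_funS mv.
by split; apply: (integ_restrict mK _ _ _ iK) => //; move=> x _ /K0.
Qed.

Lemma int2_csupp D v : measurable D -> csupp D v -> int2 D v = int2 setT v.
Proof.
move=> mD [K [cK KD K0]]; have mK := measurable_compact_plane cK.
rewrite (int2_restrict mK mD KD); last by move=> x _ /K0.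
by rewrite (int2_restrict mK measurableT) // => x _ /K0.
Qed.

Lemma integral_derive1_eq0 (g : R -> R) (M : R) : (forall t, derivable g t 1) ->
  continuous g^`()%classic -> (forall t, M < `|t| -> g t = 0) ->
  (\int[@lebesgue_measure R]_(t in setT) (g^`()%classic t)%:E = 0)%E.
Proof.
move=> dg cg g0; pose N := `|M| + 1.
have N0 : M < N by rewrite /N; have := ler_norm M; lra.
have N1 : 0 < N by rewrite /N; have := normr_ge0 M; lra.
have g'0 t : M < `|t| -> g^`()%classic t = 0.
  move=> Mt; suff d : is_derive t 1 g 0 by have [] := is_derive1_derivable d.
  apply: (@near_eq_is_derive _ _ _ (fun=> 0)).
  near=> s; rewrite g0 //; near: s.
  by apply: (cvgr_gt `|t|) => //; exact: (@norm_continuous R R t).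
have : (\int[@lebesgue_measure R]_(t in `[(- N)%R, N]) (g^`()%classic t)%:E =
       (g N)%:E - (g (- N)%R)%:E)%E.
  apply: continuous_FTC2.
  - lra.
  - exact: continuous_subspaceT.
  - have cg0 := derivable_continuous1 dg; split => //.
      by apply: cvg_at_right_filter; exact: cg0.
    by apply: cvg_at_left_filter; exact: cg0.
  - by [].
rewrite !g0 ?normrN ?gtr0_norm // subee // => <-.
rewrite [in RHS]integral_mkcond; apply: eq_integral => t _.
rewrite patchE; case: ifPn => // /negP; rewrite inE /= in_itv /= => nt.
rewrite g'0 //; apply: (lt_le_trans N0).
by rewrite leNgt ltr_norml; apply/negP => /andP[a b]; apply: nt; rewrite !ltW.
Unshelve. all: by end_near. Qed.

Lemma int2_pd_eq0 D v : measurable D -> Ck 1 v -> csupp D v ->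
  int2 D (pd1 v) = 0 /\ int2 D (pd2 v) = 0.
Proof.
move=> mD cv sv; have [s1 s2] := csupp_pd sv.
have [K [cK KD K0]] := sv; have [M M0 KM] := compact_sub_cbox cK.
have [_ [dv [[c1 _] [c2 _]]]] := cv.
rewrite !int2_csupp //.
have [_ i1] := integ_csupp mD c1 s1; have [_ i2] := integ_csupp mD c2 s2.
rewrite /int2 /Rintegral; split.
  rewrite -(integral21_prod_meas1 i1) (eq_integral (cst 0%E)).
    by rewrite integral0.
  move=> y _; rewrite /fubini_G /=.
  apply: (@integral_derive1_eq0 (fun t => v (t, y)) M).
  - by move=> t; exact: (dv (t, y)).1.
  - move=> t; apply: (@continuous_comp _ _ _ (fun t : R => (t, y) : plane R) (pd1 v)).
      by apply: cvg_plane => /=; [exact: cvg_id|exact: cvg_cst].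
    exact: c1.
  - move=> t Mt; apply: K0 => /KM -[/= h _].
    by move: Mt; rewrite ltNge ler_norml h.
rewrite -(integral12_prod_meas1 i2) (eq_integral (cst 0%E)).
  by rewrite integral0.
move=> y _; rewrite /fubini_F /=.
apply: (@integral_derive1_eq0 (fun t => v (y, t)) M).
- by move=> t; exact: (dv (y, t)).2.
- move=> t; apply: (@continuous_comp _ _ _ (fun t : R => (y, t) : plane R) (pd2 v)).
    by apply: cvg_plane => /=; [exact: cvg_cst|exact: cvg_id].
  exact: c2.
- move=> t Mt; apply: K0 => /KM -[_ /= h].
  by move: Mt; rewrite ltNge ler_norml h.
Qed.

Lemma int2_by_parts D v w : measurable D -> Ck 1 v -> Ck 1 w -> csupp D w ->
  int2 D (fun x => v x * pd1 w x) = - int2 D (fun x => pd1 v x * w x) /\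
  int2 D (fun x => v x * pd2 w x) = - int2 D (fun x => pd2 v x * w x).
Proof.
move=> mD cv cw sw.
have svw : csupp D (fun x => v x * w x) by exact: csuppMl.
have [E1 E2] := int2_pd_eq0 mD (CkM cv cw) svw.
have [s1 s2] := csupp_pd sw.
have [cv0 [dv [[cv1 _] [cv2 _]]]] := cv.
have [cw0 [dw [[cw1 _] [cw2 _]]]] := cw.
have cM (a b : plane R -> R) : continuous a -> continuous b ->
    continuous (fun x => a x * b x).
  by move=> ca cb x; exact: (cvgM (ca x) (cb x)).
have iM (a b : plane R -> R) : continuous a -> continuous b -> csupp D b ->
    integ D (fun x => a x * b x).
  by move=> ca cb sb; exact: (integ_csupp mD (cM _ _ ca cb) (csuppMl a sb)).1.
split; apply/eqP; rewrite -addr_eq0 addrC -int2D ?mD //.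
- rewrite -E1; apply/eqP; apply: eq_int2 => x _.
  by have [_ ->] := has_pd1E (has_pd1M (Ck_has_pd1 x cv) (Ck_has_pd1 x cw)).
- exact: iM.
- exact: iM.
- rewrite -E2; apply/eqP; apply: eq_int2 => x _.
  by have [_ ->] := has_pd2E (has_pd2M (Ck_has_pd2 x cv) (Ck_has_pd2 x cw)).
- exact: iM.
- exact: iM.
Qed.

End CkPlane.
Section FundamentalLemma.
Context {R : realType}.
Implicit Types (v h : plane R -> R) (D : set (plane R)).

Lemma setI_obox (p q p' q' : plane R) : obox p q `&` obox p' q' =
  obox (Num.max p.1 p'.1, Num.max p.2 p'.2) (Num.min q.1 q'.1, Num.min q.2 q'.2).
Proof.
apply/seteqP; split => x; rewrite /obox /= !gt_max !lt_min.
  by move=> [[/andP[-> ->] /andP[-> ->]] [/andP[-> ->] /andP[-> ->]]].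
by move=> [/andP[/andP[-> ->] /andP[-> ->]] /andP[/andP[-> ->] /andP[-> ->]]].
Qed.

Lemma measurable_plane_obox :
  @measurable _ (plane R : measurableType _) =
  <<s [set A | exists p q : plane R, A = obox p q] >>.
Proof.
set G := [set A | _].
rewrite eqEsubset; split; last first.
  apply: smallest_sub; first exact: sigma_algebra_measurable.
  by move=> _ [p [q ->]]; exact: measurable_obox.
rewrite measurable_prod_measurableType; apply: smallest_sub.
  exact: smallest_sigma_algebra.
pose T := g_sigma_algebraType G.
have m1 : measurable_fun setT (fst : T -> R).
  apply: (measurability _ (RGenOpens.measurableE R)) => _ [_ [a [b ->] <-]].
  rewrite setTI (_ : _ @^-1` _ =
    \bigcup_n obox (a, - n%:R) (b, n%:R)); last first.
    apply/seteqP; split => [[x y]|[x y] [n _ [/= h _]]] /=; rewrite in_itv //=.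
    move=> h; exists (Num.bound `|y|) => //; split=> //=.
    by rewrite -ltr_norml; exact: archi_boundP.
  apply: bigcupT_measurable => n; apply: sub_sigma_algebra.
  by exists (a, - n%:R), (b, n%:R).
have m2 : measurable_fun setT (snd : T -> R).
  apply: (measurability _ (RGenOpens.measurableE R)) => _ [_ [a [b ->] <-]].
  rewrite setTI (_ : _ @^-1` _ =
    \bigcup_n obox (- n%:R, a) (n%:R, b)); last first.
    apply/seteqP; split => [[x y]|[x y] [n _ [/= _ h]]] /=; rewrite in_itv //=.
    move=> h; exists (Num.bound `|x|) => //; split=> //=.
    by rewrite -ltr_norml; exact: archi_boundP.
  apply: bigcupT_measurable => n; apply: sub_sigma_algebra.
  by exists (- n%:R, a), (n%:R, b).
move=> _ [A mA [B mB <-]].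
have -> : A `*` B = (fst @^-1` A) `&` (snd @^-1` B) by [].
have h1 := m1 measurableT A mA; have h2 := m2 measurableT B mB.
rewrite !setTI in h1 h2.
exact: (@measurableI _ T _ _ h1 h2).
Qed.

Definition tbump (c : R) (p q : plane R) : plane R -> R :=
  fun x => bumpf c p.1 q.1 x.1 * bumpf c p.2 q.2 x.2.

Lemma test_fun_tbump D c p q : 0 < c -> cbox p q `<=` D ->
  test_fun D (tbump c p q).
Proof.
move=> c0 pqD; split.
  by apply: smooth_tensor; exact: smooth1_bumpf.
exists (cbox p q); split => //; first exact: compact_cbox.
move=> x nx; rewrite /tbump.
case: (boolP (p.1 < x.1 < q.1)) => h1; last by rewrite bumpf_out // mul0r.
case: (boolP (p.2 < x.2 < q.2)) => h2; last by rewrite [X in _ * X]bumpf_out // mulr0.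
by case: nx; apply: obox_sub_cbox.
Qed.

Lemma int2_obox_eq0 D h p q : measurable D -> integ D h ->
  (forall phi, test_fun D phi -> int2 D (fun x => h x * phi x) = 0) ->
  cbox p q `<=` D -> int2 (obox p q) h = 0.
Proof.
move=> mD ih h0 pqD; have mh := integ_measurable ih.
have oD : obox p q `<=` D by apply: subset_trans pqD; exact: obox_sub_cbox.
pose F n x := h x * tbump n.+1%:R^-1 p q x.
have c0 n : 0 < n.+1%:R^-1 :> R by rewrite invr_gt0.
have tf n := test_fun_tbump (c0 n) pqD.
have [] := @int2_dct _ D F (fun x => h x * \1_(obox p q) x) (fun x => `|h x|) mD.
- move=> n; apply: measurable_funM => //.
  apply: (measurable_funS measurableT) => //.
  by apply: measurable_fun_continuous_plane; exact: smooth_continuous (tf n).1.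
- apply: measurable_funM => //; apply: (measurable_funS measurableT) => //.
  by apply: measurable_indic; exact: measurable_obox.
- apply: aeW => x Dx; rewrite /F; apply: cvgM; first exact: cvg_cst.
  have H := cvgM (@bumpf_cvg R p.1 q.1 x.1) (@bumpf_cvg R p.2 q.2 x.2).
  rewrite indicE (_ : (x \in obox p q)%:R =
    (p.1 < x.1 < q.1)%R%:R * (p.2 < x.2 < q.2)%R%:R); first exact: H.
  rewrite -natrM mulnb; congr (nat_of_bool _)%:R.
  by apply/idP/andP => [/set_mem|? ]; [|apply/mem_set].
- exact: integ_norm.
- move=> n x _; rewrite /F normrM -[leRHS]mulr1 ler_wpM2l //.
  rewrite ger0_norm; first by rewrite /tbump mulr_ile1 // ?bumpf_ge0 ?bumpf_le1.
  by rewrite /tbump mulr_ge0 // bumpf_ge0.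
move=> i1 lim.
have E n : int2 D (F n) = 0 by apply: h0; exact: tf.
have : int2 D (fun x => h x * \1_(obox p q) x) = 0.
  apply: (cvg_unique _ lim).
    exact: norm_hausdorff.
  rewrite (_ : (fun n => int2 D (F n)) = fun=> 0); first exact: cvg_cst.
  by apply/funext => n; exact: E.
rewrite (int2_restrict (measurable_obox p q) mD oD); last first.
  by move=> x _ nx; rewrite indicE memNset // mulr0.
move=> E1; rewrite -[RHS]E1; apply: eq_int2 => x ox.
by rewrite indicE mem_set // mulr1.
Qed.

Lemma ae_eq0_obox h p q : integ (obox p q) h ->
  (forall p' q', cbox p' q' `<=` cbox p q -> int2 (obox p' q') h = 0) ->
  ae_eq (mu2 R) (obox p q) h (cst 0).
Proof.
move=> ih h0; pose B := obox p q; have mB : measurable B by exact: measurable_obox.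
pose P (E : set (plane R)) := int2 (B `&` E) h = 0.
have iS E : measurable E -> integ (B `&` E) h.
  move=> mE; apply: (integS _ mB _ ih) => //; exact: measurableI.
have key E : measurable E -> P E.
  move=> mE; have := mE; rewrite measurable_plane_obox.
  apply: (dynkin_induction (P := P) measurable_plane_obox).
  - by move=> _ _ [a [b ->]] [c [d ->]]; rewrite setI_obox; eexists; eexists.
  - by rewrite /P setIT; exact: h0.
  - move=> _ [a [b ->]]; rewrite /P /B setI_obox; apply: h0.
    move=> x [/andP[h1 h2] /andP[h3 h4]].
    by move: h1 h2 h3 h4; rewrite /= !ge_max !le_min => /andP[? _] /andP[? _]
      /andP[? _] /andP[? _]; split; apply/andP.
  - move=> S mS PS; rewrite /P.
    have : int2 B h = int2 (B `&` S) h + int2 (B `&` ~` S) h.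
      rewrite /int2 -Rintegral_setU.
      + by rewrite -setIUr setUv setIT.
      + exact: measurableI.
      + by apply: measurableI => //; exact: measurableC.
      + by rewrite -setIUr setUv setIT.
      + by apply/disj_setPS => x [[_ Sx] [_ nSx]].
    by rewrite PS add0r => E1; rewrite -E1; exact: h0.
  - move=> F mF tF PF; rewrite /P /int2 /Rintegral setI_bigcupr integral_bigcup.
    + rewrite (eq_eseriesr (g := fun=> 0%E)); first by rewrite eseries0.
      move=> n _; have := PF n; rewrite /P /int2 /Rintegral => E0.
      rewrite -[LHS]fineK ?E0 //; apply: integrable_fin_num.
        exact: measurableI.
      exact: (iS _ (mF n)).
    + exact: trivIset_setIl.
    + by move=> n; exact: measurableI.
    + by rewrite -setI_bigcupr; apply: iS; exact: bigcupT_measurable.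
have H : ae_eq (mu2 R) B (EFin \o h) (cst 0%E).
  apply: integral_ae_eq => //.
  move=> E EB mE; have := key E mE; rewrite /P setIidr // /int2 /Rintegral => E0.
  rewrite integral0 -[LHS]fineK ?E0 //; apply: integrable_fin_num => //.
  exact: (integS mE mB EB ih).
by apply: filterS H => x hx /hx /= -[->].
Qed.

Lemma fundamental_lemma D h : open D -> integ D h ->
  (forall phi, test_fun D phi -> int2 D (fun x => h x * phi x) = 0) ->
  ae_eq (mu2 R) D h (cst 0).
Proof.
move=> oD ih h0; have mD := measurable_open_plane oD.
pose Q : Type := rat * rat * rat * rat.
have ae s : crbox s `<=` D -> ae_eq (mu2 R) (rbox s) h (cst 0).
  move=> sD; have bD : rbox s `<=` D.
    by apply: subset_trans sD; exact: obox_sub_cbox.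
  apply: ae_eq0_obox.
    by apply: (integS _ mD bD ih); exact: measurable_obox.
  move=> p q pq; apply: (int2_obox_eq0 mD ih h0).
  exact: subset_trans pq sD.
pose S (s : Q) := [set x | crbox s `<=` D /\ rbox s x /\ h x <> 0].
have : (mu2 R).-negligible
    (\bigcup_n [set x | exists s : Q, @unpickle Q n = Some s /\ S s x]).
  apply: negligible_bigcup => n; case: (@unpickle Q n) => [s|]; last first.
    by apply: (negligibleS _ (negligible_set0 _)) => x [s []].
  have [sD|nsD] := pselect (crbox s `<=` D); last first.
    by apply: (negligibleS _ (negligible_set0 _)) => x [_ [[<-] []]].
  apply: negligibleS (ae s sD) => x [_ [[<-] [_ [sx hx]]]] /=.
  by move=> h1; exact: hx (h1 sx).
apply: negligibleS => x /= /not_implyP[Dx hx].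
move: (Dx); rewrite {1}(open_bigcup_rbox oD) => -[s _].
case: asboolP => [sD sx|_ []]; exists (@pickle Q s); first exact: I.
exists s; split; [exact: (@pickleK Q)|exact: (conj sD (conj sx hx))].
Qed.

End FundamentalLemma.
Section WeakGradient.
Context {R : realType}.
Implicit Types (v w : plane R -> R) (D E : set (plane R)).
Implicit Types g h : plane R -> plane R.

Definition dom D := open D /\ (mu2 R D < +oo)%E.

Lemma dom_measurable D : dom D -> measurable D.
Proof. by move=> [oD _]; exact: measurable_open_plane. Qed.

Lemma is_wgrad_L2v D v g : is_wgrad D v g -> L2v D g.
Proof. by case. Qed.

Lemma csupp_L2 D E v : measurable D -> continuous v -> csupp E v -> L2 D v.
Proof.
move=> mD cv sv; apply/(L2P _ mD); split.
  apply: (measurable_funS measurableT) => //.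
  exact: measurable_fun_continuous_plane.
have sT : csupp setT (fun x => v x * v x).
  have [K [cK _ K0]] := csuppMl v sv.
  by exists K; split; [exact: cK|exact: subsetT|exact: K0].
have cvv : continuous (fun x => v x * v x).
  by move=> x; exact: (cvgM (cv x) (cv x)).
have [_ i] := integ_csupp measurableT cvv sT.
by apply: (integS mD measurableT _ i).
Qed.

Lemma test_fun_L2 D E phi : measurable D -> test_fun E phi -> L2 D phi.
Proof. by move=> mD [/smooth_continuous c s]; exact: csupp_L2 c s. Qed.

Lemma is_wgrad_eq D v w g : (forall x, D x -> v x = w x) -> is_wgrad D v g ->
  is_wgrad D w g.
Proof.
move=> vw [L1 L2_ H]; split; [exact: L1|exact: L2_|].
move=> phi /H[<- <-]; split; apply: eq_int2 => x /vw -> //.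
Qed.

Lemma is_wgradS D E v g : measurable D -> measurable E -> D `<=` E ->
  is_wgrad E v g -> is_wgrad D v g.
Proof.
move=> mD mE DE [L1 L2_ H].
split; [exact: L2S L1|exact: L2S L2_|move=> phi tphi].
have [h1 h2] := H _ (test_funS DE tphi).
have [[_ sphi1] [_ sphi2]] := test_fun_pd tphi.
have tr (a b : plane R -> R) : csupp D b ->
    int2 D (fun x => a x * b x) = int2 E (fun x => a x * b x).
  move=> [K [cK KD K0]]; have mK := measurable_compact_plane cK.
  have z x : ~ K x -> a x * b x = 0 by move=> /K0 ->; exact: mulr0.
  rewrite (int2_restrict mK mD KD); last by move=> x _ /z.
  by rewrite (int2_restrict mK mE (subset_trans KD DE)) // => x _ /z.
by rewrite !tr ?h1 ?h2 //; case: tphi.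
Qed.

Lemma is_wgrad_smooth D v : measurable D -> smooth v -> L2 D (pd1 v) ->
  L2 D (pd2 v) -> is_wgrad D v (cgrad v).
Proof.
move=> mD sv L1 L2_; split; [exact: L1|exact: L2_|move=> phi [sphi cphi]].
exact: int2_by_parts (sv 1%N) (sphi 1%N) cphi.
Qed.

Lemma is_wgrad_test_fun D E v : measurable D -> test_fun E v ->
  is_wgrad D v (cgrad v).
Proof.
move=> mD tv; have [t1 t2] := test_fun_pd tv.
by apply: is_wgrad_smooth; [exact: mD|exact: tv.1|exact: test_fun_L2 t1|
  exact: test_fun_L2 t2].
Qed.

Lemma is_wgrad_lin D c v w g h : measurable D -> L2 D v -> L2 D w ->
  is_wgrad D v g -> is_wgrad D w h ->
  is_wgrad D (fun x => c * v x + w x) (vlin c g h).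
Proof.
move=> mD Lv Lw wv ww; have [g1 g2 Hv] := wv; have [h1 h2 Hw] := ww.
have [l1 l2] := L2v_lin c mD (is_wgrad_L2v wv) (is_wgrad_L2v ww).
split; [exact: l1|exact: l2|move=> phi tphi].
have [t1 t2] := test_fun_pd tphi.
have L := test_fun_L2 mD tphi; have L1 := test_fun_L2 mD t1.
have L2_ := test_fun_L2 mD t2.
have key (a b d : plane R -> R) : L2 D a -> L2 D b -> L2 D d ->
    int2 D (fun x => (c * a x + b x) * d x) =
    c * int2 D (fun x => a x * d x) + int2 D (fun x => b x * d x).
  move=> La Lb Ld.
  rewrite -int2Z //; last exact: L2_mul.
  rewrite -int2D //; [|apply: integZ => //; exact: L2_mul|exact: L2_mul].
  by apply: eq_int2 => x _; ring.
have [e1 e2] := Hv _ tphi; have [f1 f2] := Hw _ tphi.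
by rewrite /vlin /= !key // e1 e2 f1 f2; split; ring.
Qed.

Lemma is_wgrad_unique D v g h : dom D -> is_wgrad D v g -> is_wgrad D v h ->
  ae_eq (mu2 R) D (fun x => (g x).1 : R) (fun x => (h x).1) /\
  ae_eq (mu2 R) D (fun x => (g x).2 : R) (fun x => (h x).2).
Proof.
move=> dD [g1 g2 Hg] [h1 h2 Hh].
have mD := dom_measurable dD; case: (dD) => oD Doo.
have key (a b : plane R -> R) : L2 D a -> L2 D b ->
    (forall phi, test_fun D phi ->
      int2 D (fun x => a x * phi x) = int2 D (fun x => b x * phi x)) ->
    ae_eq (mu2 R) D a b.
  move=> La Lb H.
  have : ae_eq (mu2 R) D (fun x => a x - b x) (cst 0).
    apply: fundamental_lemma => //.
      by apply: L2_integ => //; exact: L2B.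
    move=> phi tphi; have L := test_fun_L2 mD tphi.
    transitivity (int2 D (fun x => a x * phi x) - int2 D (fun x => b x * phi x)).
      rewrite -int2B //; [|exact: L2_mul|exact: L2_mul].
      by apply: eq_int2 => x _; rewrite mulrBl.
    by rewrite H // subrr.
  by apply: filterS => x hx /hx /= /eqP; rewrite subr_eq0 => /eqP.
by split; apply: key => // phi tphi; have [a1 a2] := Hg _ tphi;
  have [b1 b2] := Hh _ tphi; apply: oppr_inj; rewrite -?a1 -?b1 -?a2 -?b2.
Qed.

Lemma is_wgrad_wgrad D v g : is_wgrad D v g -> is_wgrad D v (wgrad D v).
Proof. by move=> hg; exact: (@xgetI _ _ [set g | is_wgrad D v g] g hg). Qed.

Lemma int2_dot_wgrad D v w g h : dom D -> is_wgrad D v g -> is_wgrad D w h ->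
  int2 D (fun x => dot (wgrad D v x) (wgrad D w x)) =
  int2 D (fun x => dot (g x) (h x)).
Proof.
move=> dD hv hw; have mD := dom_measurable dD.
have hv' := is_wgrad_wgrad hv; have hw' := is_wgrad_wgrad hw.
have [v1 v2] := is_wgrad_unique dD hv' hv.
have [w1 w2] := is_wgrad_unique dD hw' hw.
have mdot a b : L2v D a -> L2v D b -> measurable_fun D (fun x => dot (a x) (b x)).
  by move=> La Lb; apply: integ_measurable; exact: L2v_dot.
apply: (int2_ae_eq mD (mdot _ _ (is_wgrad_L2v hv') (is_wgrad_L2v hw'))
  (mdot _ _ (is_wgrad_L2v hv) (is_wgrad_L2v hw))).
apply: filterS2 (filterI v1 v2) (filterI w1 w2) => x [p1 p2] [p3 p4] Dx.
by rewrite /dot (p1 Dx) (p2 Dx) (p3 Dx) (p4 Dx).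
Qed.

Lemma gradnormE D v g : dom D -> is_wgrad D v g -> gradnorm D v = vnorm D g.
Proof. by move=> dD hv; rewrite /gradnorm (int2_dot_wgrad dD hv hv). Qed.

Lemma gradnorm_ge0 D v : 0 <= gradnorm D v. Proof. exact: sqrtr_ge0. Qed.

Lemma is_wgrad_cst D (c : R) : measurable D -> is_wgrad D (fun=> c) (fun=> (0, 0)).
Proof.
move=> mD; split; [exact: L2_0|exact: L2_0|move=> phi [sphi cphi]].
have [z1 z2] := csupp_pd cphi.
have E0 : int2 D (fun x => 0 * phi x) = 0.
  by rewrite -[RHS](int2_0 D); apply: eq_int2 => x _; rewrite mul0r.
have [e1 e2] := int2_pd_eq0 mD (sphi 1%N) cphi.
rewrite /= E0 oppr0; split.
  rewrite int2Z ?e1 ?mulr0 //.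
  exact: (integ_csupp mD (smooth_continuous (smooth_pd1 sphi)) z1).1.
rewrite int2Z ?e2 ?mulr0 //.
exact: (integ_csupp mD (smooth_continuous (smooth_pd2 sphi)) z2).1.
Qed.

Lemma is_wgradZ D c v g : measurable D -> L2 D v -> is_wgrad D v g ->
  is_wgrad D (fun x => c * v x) (fun x => (c * (g x).1, c * (g x).2)).
Proof.
move=> mD Lv hv.
have := is_wgrad_lin c mD Lv (L2_0 D) hv (is_wgrad_cst 0 mD).
rewrite (_ : vlin _ _ _ = fun x => (c * (g x).1, c * (g x).2)).
  by apply: is_wgrad_eq => x _; rewrite addr0.
by apply/funext => x; rewrite /vlin /= !addr0.
Qed.

Lemma gradnormZ D c v : dom D -> H1 D v ->
  gradnorm D (fun x => c * v x) = `|c| * gradnorm D v.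
Proof.
move=> dD [Lv [g hg]]; have mD := dom_measurable dD.
rewrite (gradnormE dD (is_wgradZ c mD Lv hg)) (gradnormE dD hg) /vnorm.
rewrite -sqrtr_sqr -sqrtrM ?sqr_ge0 // -int2Z; last 2 first.
- exact: mD.
- by apply: L2v_dot => //; exact: is_wgrad_L2v hg.
by congr Num.sqrt; apply: eq_int2 => x _; rewrite /dot /=; ring.
Qed.

Lemma H1_lin D c v w : measurable D -> H1 D v -> H1 D w ->
  H1 D (fun x => c * v x + w x).
Proof.
move=> mD [Lv [g hg]] [Lw [h hh]]; split.
  by apply: L2D => //; exact: L2Z.
by exists (vlin c g h); exact: is_wgrad_lin.
Qed.

Lemma eq_H1 D v w : (forall x, D x -> v x = w x) -> H1 D v -> H1 D w.
Proof.
move=> vw [[mv voo] [g hg]]; split; last by exists g; exact: is_wgrad_eq hg.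
split.
  by apply: eq_measurable_fun mv => x /set_mem /vw.
rewrite (eq_integral (fun x => (v x ^+ 2)%:E)) // => x /set_mem /vw -> //.
Qed.

Lemma H1norm_sqr D v : H1norm D v ^+ 2 =
  int2 D (fun x => v x ^+ 2) + gradnorm D v ^+ 2.
Proof.
rewrite sqr_sqrtr ?addr_ge0 ?sqr_ge0 // /l2norm sqr_sqrtr //.
by apply: int2_ge0 => x _; exact: sqr_ge0.
Qed.

Lemma H1norm_ge0 D v : 0 <= H1norm D v. Proof. exact: sqrtr_ge0. Qed.

Lemma gradnorm_sqr D v g : dom D -> is_wgrad D v g ->
  gradnorm D v ^+ 2 = int2 D (fun x => dot (g x) (g x)).
Proof. by move=> dD hv; rewrite (gradnormE dD hv) vnorm_sqr. Qed.

(* Over abstract reals, as comparing norms of functions up to conversion is very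
   slow. *)
Let le_quadratic (A B C A' B' C' c : R) : A = A' -> B = B' -> C = C' ->
  A' <= 2 * (c ^+ 2 * B' + C') -> A <= 2 * (c ^+ 2 * B + C).
Proof. by move=> -> -> ->. Qed.

Let le_quadraticD (a b d a' b' d' c : R) : a <= 2 * (c ^+ 2 * b + d) ->
  a' <= 2 * (c ^+ 2 * b' + d') ->
  a + a' <= 2 * (c ^+ 2 * (b + b') + (d + d')).
Proof. by move=> h1 h2; lra. Qed.

Let lt_quadratic (X Y A B c eps : R) : 0 < eps -> Y = X -> 0 <= Y ->
  X ^+ 2 <= 2 * (c ^+ 2 * A ^+ 2 + B ^+ 2) -> 0 <= A -> 0 <= B ->
  A < eps / (2 * (`|c| + 1)) -> B < eps / (2 * (`|c| + 1)) -> Y < eps.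
Proof.
move=> eps0 YX Y0 H A0 B0; rewrite -{}YX in H.
have c0 := normr_ge0 c; set d := eps / _ => Ad Bd.
have d0 : 0 < d by rewrite divr_gt0 // mulr_gt0 //; lra.
rewrite -(@ltr_pXn2r _ 2) ?nnegrE ?(ltW eps0) //; apply: le_lt_trans H _.
have E0 : eps = d * (2 * (`|c| + 1)) by rewrite divfK // gt_eqF // mulr_gt0 //; lra.
have c2 : c ^+ 2 = `|c| ^+ 2 by rewrite real_normK ?num_real.
have f2 : A ^+ 2 < d ^+ 2 by rewrite ltr_pXn2r ?nnegrE ?(ltW d0).
have k2 : B ^+ 2 < d ^+ 2 by rewrite ltr_pXn2r ?nnegrE ?(ltW d0).
rewrite E0 c2; move: f2 k2.
move: (A ^+ 2) (B ^+ 2) => a b ha hb.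
have : `|c| ^+ 2 * a <= `|c| ^+ 2 * d ^+ 2 by rewrite ler_wpM2l ?sqr_ge0 // ltW.
have : 0 <= `|c| * d ^+ 2 by rewrite mulr_ge0 ?sqr_ge0.
have : 0 <= `|c| ^+ 2 * d ^+ 2 by rewrite mulr_ge0 ?sqr_ge0.
have -> : (d * (2 * (`|c| + 1))) ^+ 2 =
    4 * (`|c| ^+ 2 * d ^+ 2) + 8 * (`|c| * d ^+ 2) + 4 * d ^+ 2 by ring.
have : 0 < d ^+ 2 by rewrite exprn_gt0.
by move: (`|c| ^+ 2 * a) (`|c| ^+ 2 * d ^+ 2) (`|c| * d ^+ 2) (d ^+ 2) hb => *; lra.
Qed.

Lemma H1norm_lin D c v w : dom D -> H1 D v -> H1 D w ->
  H1norm D (fun x => c * v x + w x) ^+ 2 <=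
  2 * (c ^+ 2 * H1norm D v ^+ 2 + H1norm D w ^+ 2).
Proof.
move=> dD [Lv [g hg]] [Lw [h hh]]; have mD := dom_measurable dD.
have hl := is_wgrad_lin c mD Lv Lw hg hh.
have N2 u k : is_wgrad D u k -> H1norm D u ^+ 2 =
    int2 D (fun x => u x ^+ 2) + int2 D (fun x => dot (k x) (k x)).
  by move=> hu; rewrite H1norm_sqr (gradnorm_sqr dD hu).
have key (a b d : plane R -> R) : integ D a -> integ D b -> integ D d ->
    (forall x, a x <= 2 * (c ^+ 2 * b x + d x)) ->
    int2 D a <= 2 * (c ^+ 2 * int2 D b + int2 D d).
  move=> ia ib id H; rewrite -int2Z // -int2D //; last exact: integZ.
  rewrite -int2Z //; last by apply: integD => //; exact: integZ.
  apply: le_int2 => //.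
  by apply: integZ => //; apply: integD => //; exact: integZ.
have p (s t : R) : (c * s + t) ^+ 2 <= 2 * (c ^+ 2 * s ^+ 2 + t ^+ 2).
  by have := sqr_ge0 (c * s - t); nra.
have Lvg := is_wgrad_L2v hg; have Lvh := is_wgrad_L2v hh.
apply: (le_quadratic (N2 _ _ hl) (N2 _ _ hg) (N2 _ _ hh)).
apply: le_quadraticD.
  apply: (key _ _ _ _ (L2_sqr mD Lv) (L2_sqr mD Lw) _).
    by apply: L2_sqr => //; apply: L2D => //; exact: L2Z.
  by move=> x; exact: p.
apply: (key _ _ _ _ (L2v_dot mD Lvg Lvg) (L2v_dot mD Lvh Lvh) _).
  by apply: L2v_dot => //; exact: L2v_lin.
move=> x; rewrite /dot /vlin /=.
by have := p (g x).1 (h x).1; have := p (g x).2 (h x).2; nra.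
Qed.

Lemma test_fun_H1 D E v : measurable D -> test_fun E v -> H1 D v.
Proof.
move=> mD tv; split; first exact: test_fun_L2 tv.
by exists (cgrad v); exact: is_wgrad_test_fun tv.
Qed.

Lemma H10_lin D c v w : dom D -> H10 D v -> H10 D w ->
  H10 D (fun x => c * v x + w x).
Proof.
move=> dD [hv av] [hw aw]; have mD := dom_measurable dD.
split; first exact: H1_lin.
move=> eps eps0; pose d := eps / (2 * (`|c| + 1)).
have d0 : 0 < d by rewrite divr_gt0 // mulr_gt0 //; have := normr_ge0 c; lra.
have [f tf hf] := av d d0; have [k tk hk] := aw d d0.
exists (fun x => c * f x + k x); first exact: test_fun_lin.
have hB (a b : plane R -> R) : H1 D a -> test_fun D b -> H1 D (fun x => a x - b x).
  move=> ha tb; have := H1_lin (-1) mD (test_fun_H1 mD tb) ha.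
  by apply: eq_H1 => x _; ring.
apply: (lt_quadratic eps0 _ (H1norm_ge0 _ _)
  (H1norm_lin c dD (hB _ _ hv tf) (hB _ _ hw tk))
  (H1norm_ge0 _ _) (H1norm_ge0 _ _) hf hk).
by congr (H1norm D _); apply/funext => x; ring.
Qed.

End WeakGradient.
Section Kernel.
Context {R : realType}.
Implicit Types (h : R -> R).

Definition csupp1 h := exists M : R, forall t, M < `|t| -> h t = 0.

Lemma derive1_out h (M : R) : (forall t, M < `|t| -> h t = 0) ->
  forall t, M < `|t| -> h^`()%classic t = 0.
Proof.
move=> hM t Mt.
suff d : is_derive t 1 h 0 by have [] := is_derive1_derivable d.
apply: (@near_eq_is_derive _ _ _ (fun=> 0)).
near=> s; rewrite hM //; near: s.
by apply: (cvgr_gt `|t|) => //; exact: (@norm_continuous R R t).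
Unshelve. all: by end_near. Qed.

Lemma csupp1_derive h : csupp1 h -> csupp1 h^`()%classic.
Proof. by move=> [M hM]; exists M; exact: derive1_out. Qed.

Lemma csupp1_bounded h : continuous h -> csupp1 h ->
  exists2 K : R, 0 <= K & forall t, `|h t| <= K.
Proof.
move=> ch [M hM]; pose N := `|M|.
have /compact_bounded [K [_ hK]] : compact (h @` `[- N, N]).
  by apply: continuous_compact; [exact: continuous_subspaceT|exact: segment_compact].
exists (`|K| + 1); first by have := normr_ge0 K; lra.
move=> t; case: (leP `|t| N) => tN.
  apply: hK; first by have := ler_norm K; lra.
  by exists t => //=; rewrite in_itv /= -ler_norml.
rewrite hM ?normr0; first by have := normr_ge0 K; lra.
by apply: le_lt_trans tN; exact: ler_norm.
Qed.

Lemma smooth1_lipschitz h : smooth1 h -> csupp1 h ->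
  exists2 L : R, 0 <= L & forall s t, `|h s - h t| <= L * `|s - t|.
Proof.
move=> sh ch.
have [L L0 hL] := csupp1_bounded (smooth1_continuous (smooth1_derive sh))
  (csupp1_derive ch).
exists L => // s t; wlog st : s t / s <= t.
  move=> H; case: (leP s t) => [|/ltW] st; first exact: H.
  by rewrite distrC [`|s - t|]distrC; exact: H.
rewrite distrC [`|s - t|]distrC.
have [c _ ->] := MVT_segment st (fun u _ => smooth1_is_derive u sh)
  (continuous_subspaceT (smooth1_continuous sh)).
by rewrite normrM ler_wpM2r.
Qed.

Let b : R -> R := bumpf 1 (-1) 1.

Let b_smooth : smooth1 b. Proof. exact: smooth1_bumpf. Qed.

Let b_out t : 1 <= `|t| -> b t = 0.
Proof. by move=> h; rewrite /b bumpf_out // -ltr_norml -leNgt. Qed.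

Lemma csupp1_integrable h : continuous h -> csupp1 h ->
  (@lebesgue_measure R).-integrable setT (EFin \o h).
Proof.
move=> ch [M hM]; pose N := `|M| + 1.
have i1 : (@lebesgue_measure R).-integrable `[- N, N] (EFin \o h).
  apply: continuous_compact_integrable; first exact: segment_compact.
  exact: continuous_subspaceT.
have mI : measurable (`[- N, N]%classic : set (measurableTypeR R)).
  exact: measurable_itv.
have := (@integrable_mkcond _ (measurableTypeR R) R (@lebesgue_measure R) _
  (EFin \o h) mI).1 i1.
apply: eq_integrable => // s _; rewrite patchE; case: ifPn => //= /negP ns.
rewrite hM // ltNge; apply/negP => sM; apply: ns; rewrite inE /= in_itv /=.
by rewrite -ler_norml (le_trans sM) // (le_trans (ler_norm _)) // lerDl.
Qed.

Lemma csupp1_primitive h : continuous h -> csupp1 h ->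
  exists B : R -> R, forall t : R, is_derive t 1 B (h t).
Proof.
move=> ch sh.
exists (fun t => \int[@lebesgue_measure R]_(s in `]-oo, t]) h s) => t.
have iI : (@lebesgue_measure R).-integrable `]-oo, t + 1] (EFin \o h).
  exact: (integrableS measurableT _ (@subsetT _ _) (csupp1_integrable ch sh)).
have tt : t < t + 1 by rewrite ltrDl.
have [|d1 d2] := continuous_FTC1 tt iI _ (ch t).
  by rewrite /= ltNyr.
by rewrite -d2; exact: derivable_is_derive1.
Qed.

Lemma kernel_exists : exists2 K : R, 0 <= K & forall r : R, 0 < r ->
  exists k : R -> R, [/\ smooth1 k, forall t, r <= `|t| -> k t = 0,
    forall t, `|k t| <= K / r, forall t, `|k^`()%classic t| <= K / r ^+ 2 &
    forall x, (\int[@lebesgue_measure R]_(y in setT) (k (x - y))%:E = 1)%E].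
Proof.
have cb : csupp1 b by exists 1 => t /ltW; exact: b_out.
have [B hB] := csupp1_primitive (smooth1_continuous b_smooth) cb.
have [K1 K10 hK1] := csupp1_bounded (smooth1_continuous b_smooth) cb.
have [K2 K20 hK2] := csupp1_bounded (smooth1_continuous (smooth1_derive b_smooth))
  (csupp1_derive cb).
have J0 : 0 < B 1 - B (-1).
  have cB : continuous B.
    apply: derivable_continuous1 => t.
    exact: (is_derive1_derivable (hB t)).1.
  have m1 : -1 < 1 :> R by lra.
  have [c hc ->] := MVT m1 (fun x _ => hB x) (continuous_subspaceT cB).
  rewrite in_itv /= in hc; apply: mulr_gt0; [exact: bumpf_gt0|lra].
set J := B 1 - B (-1) in J0.
exists ((K1 + K2) / J); first by apply: divr_ge0; [exact: addr_ge0|exact: ltW].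
move=> r r0; pose k t := (r * J)^-1 * b (0 + r^-1 * t).
have rJ : 0 < r * J by exact: mulr_gt0.
have sk : smooth1 k.
  by move=> n; apply: Ck1M; [exact: Ck1_cst|exact: Ck1_comp_affine].
have k0 t : r <= `|t| -> k t = 0.
  move=> rt; rewrite /k b_out ?mulr0 // add0r normrM normfV (gtr0_norm r0).
  by rewrite ler_pdivlMl // mulr1.
exists k; split => //.
- move=> t; have -> : (K1 + K2) / J / r = (r * J)^-1 * (K1 + K2).
    by field; rewrite !gt_eqF.
  rewrite /k normrM normfV (gtr0_norm rJ) ler_wpM2l ?invr_ge0 ?(ltW rJ) //.
  by apply: le_trans (hK1 _) _; rewrite lerDl.
- move=> t; have -> : (K1 + K2) / J / r ^+ 2 = (r * J)^-1 * ((K1 + K2) * r^-1).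
    by field; rewrite !gt_eqF.
  have H := is_derive1_comp_affine (a := 0) (b := r^-1) (t := t)
    (smooth1_is_derive _ b_smooth).
  have [_ ->] := is_derive1_derivable
    (is_derive1M (is_derive_cst (r * J)^-1 t 1) H).
  rewrite mul0r add0r !normrM !normfV (gtr0_norm rJ) (gtr0_norm r0).
  rewrite ler_wpM2l ?invr_ge0 ?(ltW rJ) // ler_wpM2r ?invr_ge0 ?(ltW r0) //.
  by apply: le_trans (hK2 _) _; rewrite lerDr.
- move=> x.
  pose g (y : R) : R := - (J^-1 * B (x / r + - r^-1 * y)).
  have dg (y : R) : is_derive y 1 g (k (x - y)).
    have H := is_derive1_comp_affine (a := x / r) (b := - r^-1) (t := y) (hB _).
    have H2 := is_derive1M (is_derive_cst J^-1 y 1) H.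
    apply: (eq_is_derive1 (is_deriveN H2)).
    rewrite /k (_ : 0 + r^-1 * (x - y) = x / r + - r^-1 * y); last by ring.
    by rewrite invfM /=; ring.
  have : (\int[@lebesgue_measure R]_(y in `[(x - r)%R, (x + r)%R]) (k (x - y))%:E =
       (g (x + r)%R)%:E - (g (x - r)%R)%:E)%E.
    have cg : continuous g.
      apply: derivable_continuous1 => y.
      by have [] := is_derive1_derivable (dg y).
    apply: continuous_FTC2.
    + lra.
    + apply: continuous_subspaceT.
      rewrite (_ : (fun y => k (x - y)) = (fun y => k (x + -1 * y))); last first.
        by apply/funext => z; rewrite mulN1r.
      exact: (Ck1_comp_affine x (-1) (sk 0%N)).
    + split; first by move=> y _; have [] := is_derive1_derivable (dg y).
        by apply: cvg_at_right_filter; exact: cg.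
      by apply: cvg_at_left_filter; exact: cg.
    + by move=> y _; have [] := is_derive1_derivable (dg y).
  have -> : ((g (x + r)%R)%:E - (g (x - r)%R)%:E)%E = 1%E.
    rewrite -EFinB; congr EFin; rewrite /g.
    have -> : x / r + - r^-1 * (x + r) = -1 by field; rewrite gt_eqF.
    have -> : x / r + - r^-1 * (x - r) = 1 by field; rewrite gt_eqF.
    transitivity (J^-1 * (B 1 - B (-1))); first by ring.
    by rewrite mulVf // gt_eqF.
  move=> <-; rewrite [in RHS]integral_mkcond; apply: eq_integral => y _.
  rewrite patchE; case: ifPn => // /negP; rewrite inE /= in_itv /= => ny.
  rewrite k0 // leNgt ltr_norml; apply/negP => /andP[h1 h2].
  by apply: ny; apply/andP; split; lra.
Qed.

End Kernel.
Section Mollification.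
Context {R : realType}.
Implicit Types (h : R -> R) (w : plane R -> R) (D : set (plane R)).

Definition cnv D w h1 h2 (x : plane R) : R :=
  int2 D (fun y => w y * (h1 (x.1 - y.1) * h2 (x.2 - y.2))).

Section Cnv.
Variables (D : set (plane R)) (w : plane R -> R) (Mw : R).
Hypothesis mD : measurable D.
Hypothesis Doo : (mu2 R D < +oo)%E.
Hypothesis mw : measurable_fun D w.
Hypothesis wM : forall x, D x -> `|w x| <= Mw.

Let measurable_shift h (a : R) (i : plane R -> R) : continuous h ->
  continuous i -> measurable_fun D (fun y => h (a - i y)).
Proof.
move=> ch ci; apply: (measurable_funS measurableT) => //.
apply: measurable_fun_continuous_plane => y.
apply: (@continuous_comp _ _ _ (fun y => a - i y) h); last exact: ch.
by apply: cvgB; [exact: cvg_cst|exact: ci].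
Qed.

Let measurable_integrand h1 h2 (x : plane R) : continuous h1 -> continuous h2 ->
  measurable_fun D (fun y => w y * (h1 (x.1 - y.1) * h2 (x.2 - y.2))).
Proof.
move=> c1 c2; apply: measurable_funM => //; apply: measurable_funM.
  by apply: measurable_shift => //; exact: continuous_fst_plane.
by apply: measurable_shift => //; exact: continuous_snd_plane.
Qed.

Let Mw0 : Mw <= `|Mw|. Proof. exact: ler_norm. Qed.

Let bound_integrand h1 h2 (K1 K2 : R) : 0 <= K1 -> 0 <= K2 ->
  (forall t, `|h1 t| <= K1) -> (forall t, `|h2 t| <= K2) ->
  forall (x y : plane R), D y ->
  `|w y * (h1 (x.1 - y.1) * h2 (x.2 - y.2))| <= `|Mw| * (K1 * K2).
Proof.
move=> K10 K20 hK1 hK2 x y Dy; rewrite !normrM; apply: ler_pM => //.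
- exact: le_trans (wM Dy) Mw0.
- exact: ler_pM.
Qed.

Let integ_integrand h1 h2 (x : plane R) : continuous h1 -> csupp1 h1 ->
  continuous h2 -> csupp1 h2 ->
  integ D (fun y => w y * (h1 (x.1 - y.1) * h2 (x.2 - y.2))).
Proof.
move=> c1 s1 c2 s2; have [K1 K10 hK1] := csupp1_bounded c1 s1.
have [K2 K20 hK2] := csupp1_bounded c2 s2.
apply: (integ_bounded mD Doo (measurable_integrand x c1 c2)
  (bound_integrand K10 K20 hK1 hK2 x)).
Qed.

Lemma continuous_cnv h1 h2 : smooth1 h1 -> csupp1 h1 -> smooth1 h2 ->
  csupp1 h2 -> continuous (cnv D w h1 h2).
Proof.
move=> sm1 s1 sm2 s2.
have c1 := smooth1_continuous sm1; have c2 := smooth1_continuous sm2.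
have [K1 K10 hK1] := csupp1_bounded c1 s1.
have [K2 K20 hK2] := csupp1_bounded c2 s2.
have [L1 L10 hL1] := smooth1_lipschitz sm1 s1.
have [L2 L20 hL2] := smooth1_lipschitz sm2 s2.
pose N := `|Mw| * (L1 * K2 + K1 * L2) * fine (mu2 R D).
have mu0 : 0 <= fine (mu2 R D) by exact: fine_ge0.
have N0 : 0 <= N by rewrite !mulr_ge0 // addr_ge0 // mulr_ge0.
have key (x z : plane R) (e : R) : `|x.1 - z.1| < e -> `|x.2 - z.2| < e ->
    `|cnv D w h1 h2 x - cnv D w h1 h2 z| <= N * e.
  move=> e1 e2; have e0 : 0 < e by exact: le_lt_trans e1.
  rewrite /cnv -int2B //; try exact: integ_integrand.
  have -> : N * e = `|Mw| * (L1 * K2 + K1 * L2) * e * fine (mu2 R D).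
    by rewrite /N; ring.
  apply: le_norm_int2_cst => //.
    by apply: measurable_funB; exact: measurable_integrand.
  move=> y Dy; rewrite -mulrBr normrM -mulrA.
  apply: ler_pM => //; first exact: le_trans (wM Dy) Mw0.
  have -> : h1 (x.1 - y.1) * h2 (x.2 - y.2) - h1 (z.1 - y.1) * h2 (z.2 - y.2) =
     (h1 (x.1 - y.1) - h1 (z.1 - y.1)) * h2 (x.2 - y.2) +
     h1 (z.1 - y.1) * (h2 (x.2 - y.2) - h2 (z.2 - y.2)) by ring.
  apply: le_trans (ler_normD _ _) _; rewrite [leRHS]mulrDl !normrM; apply: lerD.
    rewrite mulrAC; apply: ler_pM => //; apply: le_trans (hL1 _ _) _.
    rewrite ler_wpM2l // (_ : _ - _ = x.1 - z.1) ?ltW //; ring.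
  rewrite -mulrA; apply: ler_pM => //; apply: le_trans (hL2 _ _) _.
  rewrite ler_wpM2l // (_ : _ - _ = x.2 - z.2) ?ltW //; ring.
move=> x; apply/cvgrPdist_lt => e e0.
have N1 : 0 < N + 1 by lra.
apply/nbhs_planeP; exists (e / (N + 1)); first exact: divr_gt0.
move=> z h1' h2'; apply: le_lt_trans (key _ _ _ h1' h2') _.
rewrite mulrA ltr_pdivrMr // mulrC ltr_pM2l //; lra.
Qed.

Lemma has_pd1_cnv h1 h2 x : smooth1 h1 -> csupp1 h1 -> smooth1 h2 ->
  csupp1 h2 -> has_pd1 (cnv D w h1 h2) x (cnv D w h1^`()%classic h2 x).
Proof.
move=> sm1 s1 sm2 s2.
have c1 := smooth1_continuous sm1; have c2 := smooth1_continuous sm2.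
have c1' := smooth1_continuous (smooth1_derive sm1).
have s1' := csupp1_derive s1.
have [K1 K10 hK1] := csupp1_bounded c1' s1'.
have [K2 K20 hK2] := csupp1_bounded c2 s2.
pose f (t : R) (y : plane R) := w y * (h1 (t - y.1) * h2 (x.2 - y.2)).
have df (t : R) y : is_derive t 1 (f ^~ y)
    (w y * (h1^`()%classic (t - y.1) * h2 (x.2 - y.2))).
  have H0 : is_derive t 1 (fun t : R => h1 (- y.1 + 1 * t))
      (h1^`()%classic (- y.1 + 1 * t) * 1).
    by apply: is_derive1_comp_affine; exact: smooth1_is_derive.
  have E : (fun t => h1 (- y.1 + 1 * t)) = (fun t => h1 (t - y.1)).
    by apply/funext => s; rewrite mul1r addrC.
  rewrite E mul1r mulr1 addrC in H0.
  have H1 := is_derive1M H0 (is_derive_cst (h2 (x.2 - y.2)) t 1).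
  apply: (eq_is_derive1 (is_derive1M (is_derive_cst (w y) t 1) H1)).
  by rewrite /=; ring.
have E1 t y : partial1of2 f t y =
    w y * (h1^`()%classic (t - y.1) * h2 (x.2 - y.2)).
  by rewrite /partial1of2; have [_ ->] := is_derive1_derivable (df t y).
have Ia : `](x.1 - 1)%R, (x.1 + 1)%R[%classic (x.1 : R).
  by rewrite /= in_itv /=; lra.
have intf t : `](x.1 - 1)%R, (x.1 + 1)%R[%classic t ->
    (mu2 R).-integrable D (EFin \o f t).
  by move=> _; exact: (integ_integrand (t, x.2) c1 s1 c2 s2).
have der t y : `](x.1 - 1)%R, (x.1 + 1)%R[%classic t -> D y ->
    derivable (f ^~ y) t 1.
  by move=> _ _; have [] := is_derive1_derivable (df t y).
pose G (y : plane R) : R := `|Mw| * (K1 * K2).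
have G0 y : 0 <= G y by rewrite !mulr_ge0.
have iG : integ D G.
  apply: (integ_bounded mD Doo (M := `|Mw| * (K1 * K2))).
    exact: measurable_cst.
  by move=> y _; rewrite ger0_norm.
have GB t y : `](x.1 - 1)%R, (x.1 + 1)%R[%classic t -> D y ->
    `|partial1of2 f t y| <= G y.
  by move=> _ Dy; rewrite E1; exact: (bound_integrand K10 K20 hK1 hK2 (t, x.2) Dy).
have dF := derivable_under_integral mD Ia intf der G0 iG GB.
have EF := differentiation_under_integral mD Ia intf der G0 iG GB.
apply: (eq_is_derive1 (derivable_is_derive1 dF)).
by rewrite EF; apply: eq_int2 => y _; rewrite E1.
Qed.

Lemma has_pd2_cnv h1 h2 x : smooth1 h1 -> csupp1 h1 -> smooth1 h2 ->
  csupp1 h2 -> has_pd2 (cnv D w h1 h2) x (cnv D w h1 h2^`()%classic x).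
Proof.
move=> sm1 s1 sm2 s2.
have c1 := smooth1_continuous sm1; have c2 := smooth1_continuous sm2.
have c2' := smooth1_continuous (smooth1_derive sm2).
have s2' := csupp1_derive s2.
have [K1 K10 hK1] := csupp1_bounded c1 s1.
have [K2 K20 hK2] := csupp1_bounded c2' s2'.
pose f (t : R) (y : plane R) := w y * (h1 (x.1 - y.1) * h2 (t - y.2)).
have df (t : R) y : is_derive t 1 (f ^~ y)
    (w y * (h1 (x.1 - y.1) * h2^`()%classic (t - y.2))).
  have H0 : is_derive t 1 (fun t : R => h2 (- y.2 + 1 * t))
      (h2^`()%classic (- y.2 + 1 * t) * 1).
    by apply: is_derive1_comp_affine; exact: smooth1_is_derive.
  have E : (fun t => h2 (- y.2 + 1 * t)) = (fun t => h2 (t - y.2)).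
    by apply/funext => s; rewrite mul1r addrC.
  rewrite E mul1r mulr1 addrC in H0.
  have H1 := is_derive1M (is_derive_cst (h1 (x.1 - y.1)) t 1) H0.
  apply: (eq_is_derive1 (is_derive1M (is_derive_cst (w y) t 1) H1)).
  by rewrite /=; ring.
have E1 t y : partial1of2 f t y =
    w y * (h1 (x.1 - y.1) * h2^`()%classic (t - y.2)).
  by rewrite /partial1of2; have [_ ->] := is_derive1_derivable (df t y).
have Ia : `](x.2 - 1)%R, (x.2 + 1)%R[%classic (x.2 : R).
  by rewrite /= in_itv /=; lra.
have intf t : `](x.2 - 1)%R, (x.2 + 1)%R[%classic t ->
    (mu2 R).-integrable D (EFin \o f t).
  by move=> _; exact: (integ_integrand (x.1, t) c1 s1 c2 s2).
have der t y : `](x.2 - 1)%R, (x.2 + 1)%R[%classic t -> D y ->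
    derivable (f ^~ y) t 1.
  by move=> _ _; have [] := is_derive1_derivable (df t y).
pose G (y : plane R) : R := `|Mw| * (K1 * K2).
have G0 y : 0 <= G y by rewrite !mulr_ge0.
have iG : integ D G.
  apply: (integ_bounded mD Doo (M := `|Mw| * (K1 * K2))).
    exact: measurable_cst.
  by move=> y _; rewrite ger0_norm.
have GB t y : `](x.2 - 1)%R, (x.2 + 1)%R[%classic t -> D y ->
    `|partial1of2 f t y| <= G y.
  by move=> _ Dy; rewrite E1; exact: (bound_integrand K10 K20 hK1 hK2 (x.1, t) Dy).
have dF := derivable_under_integral mD Ia intf der G0 iG GB.
have EF := differentiation_under_integral mD Ia intf der G0 iG GB.
apply: (eq_is_derive1 (derivable_is_derive1 dF)).
by rewrite EF; apply: eq_int2 => y _; rewrite E1.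
Qed.

Lemma smooth_cnv h1 h2 : smooth1 h1 -> csupp1 h1 -> smooth1 h2 ->
  csupp1 h2 -> smooth (cnv D w h1 h2).
Proof.
move=> sm1 s1 sm2 s2; apply: (smooth_class (S := [set v | exists k1 k2,
  [/\ smooth1 k1, csupp1 k1, smooth1 k2, csupp1 k2 & v = cnv D w k1 k2]])); last first.
  by exists h1, h2; split.
move=> _ [k1 [k2 [t1 u1 t2 u2 ->]]]; split; first exact: continuous_cnv.
exists (cnv D w k1^`()%classic k2), (cnv D w k1 k2^`()%classic); split.
- exists k1^`()%classic, k2; split=> //;
    [exact: smooth1_derive|exact: csupp1_derive].
- exists k1, k2^`()%classic; split=> //;
    [exact: smooth1_derive|exact: csupp1_derive].
- by move=> x; exact: has_pd1_cnv.
- by move=> x; exact: has_pd2_cnv.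
Qed.

End Cnv.

End Mollification.
Section Mollifier.
Context {R : realType}.
Implicit Types (w : plane R -> R) (D : set (plane R)) (x y : plane R).

Definition box x (r : R) : set (plane R) :=
  cbox (x.1 - r, x.2 - r) (x.1 + r, x.2 + r).

Lemma boxP x r y : box x r y <-> `|x.1 - y.1| <= r /\ `|x.2 - y.2| <= r.
Proof.
rewrite /box /cbox /= !ler_norml; split => -[/andP[h1 h2] /andP[h3 h4]];
  by split; lra.
Qed.

Lemma box_center x r : 0 <= r -> box x r x.
Proof. by move=> r0; apply/boxP; rewrite !subrr normr0. Qed.

Lemma smooth_affine (a b c : R) :
  smooth (fun x : plane R => a + b * x.1 + c * x.2).
Proof.
apply: (smooth_class (S := [set v | exists a b c : R,
  v = fun x : plane R => a + b * x.1 + c * x.2])); last by exists a, b, c.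
move=> _ [a' [b' [c' ->]]]; split.
  move=> x; apply: cvgD; first (apply: cvgD; first exact: cvg_cst).
    by apply: cvgM; [exact: cvg_cst|exact: continuous_fst_plane].
  by apply: cvgM; [exact: cvg_cst|exact: continuous_snd_plane].
exists (fun=> b'), (fun=> c'); split.
- by exists b', 0, 0; apply/funext => x; rewrite !mul0r !addr0.
- by exists c', 0, 0; apply/funext => x; rewrite !mul0r !addr0.
- move=> x; have H := is_derive1_affine (a' + c' * x.2) b' (x.1 : R).
  rewrite /has_pd1 (_ : (fun t : R => _) = (fun t => a' + c' * x.2 + b' * t)) //.
  by apply/funext => t /=; rewrite addrAC.
- by move=> x; exact: (is_derive1_affine (a' + b' * x.1) c' (x.2 : R)).
Qed.

Lemma pd_affine (a b c : R) x :
  pd1 (fun x : plane R => a + b * x.1 + c * x.2) x = b /\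
  pd2 (fun x : plane R => a + b * x.1 + c * x.2) x = c.
Proof.
have H1 := is_derive1_affine (a + c * x.2) b (x.1 : R).
have H2 := is_derive1_affine (a + b * x.1) c (x.2 : R).
split; last exact: (is_derive1_derivable H2).2.
rewrite /pd1 (_ : (fun t : R => _) = (fun t => a + c * x.2 + b * t)).
  exact: (is_derive1_derivable H1).2.
by apply/funext => t /=; rewrite addrAC.
Qed.

Section Local.
Variables (k : R -> R) (r K : R).
Hypotheses (r0 : 0 < r) (K0 : 0 <= K).
Hypothesis sk : smooth1 k.
Hypothesis kout : forall t, r <= `|t| -> k t = 0.
Hypothesis kK : forall t, `|k t| <= K / r.
Hypothesis kK' : forall t, `|k^`()%classic t| <= K / r ^+ 2.
Hypothesis k1 : forall x : R,
  (\int[@lebesgue_measure R]_(y in setT) (k (x - y))%:E = 1)%E.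

Let ck : csupp1 k. Proof. by exists r => t /ltW; exact: kout. Qed.

Let kout' t : r < `|t| -> k^`()%classic t = 0.
Proof. by apply: derive1_out => s /ltW; exact: kout. Qed.

Let kap x y := k (x.1 - y.1) * k (x.2 - y.2).

Let smooth_shift (a : R) : smooth1 (fun t => k (a - t)).
Proof.
rewrite (_ : (fun t => k (a - t)) = (fun t => k (a + -1 * t))).
  by move=> n; exact: Ck1_comp_affine.
by apply/funext => t; rewrite mulN1r.
Qed.

Let is_derive_shift (a t : R) :
  is_derive t 1 (fun t => k (a - t)) (- k^`()%classic (a - t)).
Proof.
have H := is_derive1_comp_affine (a := a) (b := -1) (t := t)
  (smooth1_is_derive _ sk).
rewrite (_ : (fun t => k (a - t)) = (fun t => k (a + -1 * t))).
  by apply: (eq_is_derive1 H); rewrite !mulN1r mulrN1.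
by apply/funext => s; rewrite mulN1r.
Qed.

Let smooth_kap x : smooth (kap x).
Proof. exact: (smooth_tensor (smooth_shift x.1) (smooth_shift x.2)). Qed.

Let pd_kap x y : pd1 (kap x) y = - (k^`()%classic (x.1 - y.1) * k (x.2 - y.2)) /\
  pd2 (kap x) y = - (k (x.1 - y.1) * k^`()%classic (x.2 - y.2)).
Proof.
have H1 : has_pd1 (kap x) y (- (k^`()%classic (x.1 - y.1) * k (x.2 - y.2))).
  apply: (eq_is_derive1 (is_derive1M (is_derive_shift x.1 y.1)
    (is_derive_cst (k (x.2 - y.2)) (y.1 : R) 1))).
  by rewrite mulr0 addr0 mulNr.
have H2 : has_pd2 (kap x) y (- (k (x.1 - y.1) * k^`()%classic (x.2 - y.2))).
  apply: (eq_is_derive1 (is_derive1M (is_derive_cst (k (x.1 - y.1)) (y.2 : R) 1)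
    (is_derive_shift x.2 y.2))).
  by rewrite mul0r add0r mulrN.
by split; [have [] := has_pd1E H1|have [] := has_pd2E H2].
Qed.

Let out_box x y : ~ box x r y -> r < `|x.1 - y.1| \/ r < `|x.2 - y.2|.
Proof.
move=> nb; case: (leP `|x.1 - y.1| r) => h1; last by left.
by case: (leP `|x.2 - y.2| r) => h2; [case: nb; exact/boxP|right].
Qed.

Let kap_out x y : ~ box x r y -> [/\ kap x y = 0,
  k^`()%classic (x.1 - y.1) * k (x.2 - y.2) = 0 &
  k (x.1 - y.1) * k^`()%classic (x.2 - y.2) = 0].
Proof.
move=> /out_box[h|h]; rewrite /kap.
  by rewrite (kout (ltW h)) (kout' h) !mul0r.
by rewrite (kout (ltW h)) (kout' h) !mulr0.
Qed.

Let csupp_kap D x : box x r `<=` D -> csupp D (kap x).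
Proof.
by move=> bD; exists (box x r); split; [exact: compact_cbox|exact: bD|
  move=> y /kap_out[]].
Qed.

Let int2_kap D x : measurable D -> box x r `<=` D -> int2 D (kap x) = 1.
Proof.
move=> mD bD; rewrite (int2_csupp mD (csupp_kap bD)).
have [_ i] := integ_csupp mD (smooth_continuous (smooth_kap x)) (csupp_kap bD).
rewrite /int2 /Rintegral -(integral21_prod_meas1 i).
suff -> : (\int[@lebesgue_measure R]_y fubini_G (@lebesgue_measure R)
   (EFin \o kap x) y = 1)%E by [].
rewrite -(k1 x.2); apply: eq_integral => t _; rewrite /fubini_G /kap /=.
transitivity (\int[@lebesgue_measure R]_s
  ((k (x.2 - t))%:E * (k (x.1 - s))%:E))%E.
  by apply: eq_integral => s _; rewrite -EFinM mulrC.
rewrite integralZl ?k1 ?mule1 //.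
apply: csupp1_integrable; first exact: smooth1_continuous (smooth_shift x.1).
exists (`|x.1| + r) => s hs; apply: kout; rewrite distrC.
have := ler_normD (s - x.1) x.1; rewrite subrK; lra.
Qed.

Let int2_affine_dkap D x (a b c : R) : measurable D -> box x r `<=` D ->
  int2 D (fun y => (a + b * y.1 + c * y.2) *
    (k^`()%classic (x.1 - y.1) * k (x.2 - y.2))) = b /\
  int2 D (fun y => (a + b * y.1 + c * y.2) *
    (k (x.1 - y.1) * k^`()%classic (x.2 - y.2))) = c.
Proof.
move=> mD bD; have sa := smooth_affine a b c.
have [h1 h2] := int2_by_parts mD (sa 1%N) (smooth_kap x 1%N) (csupp_kap bD).
have ik := (integ_csupp mD (smooth_continuous (smooth_kap x)) (csupp_kap bD)).1.
have [s1 s2] := csupp_pd (csupp_kap bD).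
have cM (u v : plane R -> R) : smooth u -> smooth v -> csupp D v ->
    integ D (fun x => u x * v x).
  move=> su sv cv; apply: (integ_csupp mD _ (csuppMl u cv)).1.
  exact: smooth_continuous (smoothM su sv).
have i1 := cM _ _ sa (smooth_pd1 (smooth_kap x)) s1.
have i2 := cM _ _ sa (smooth_pd2 (smooth_kap x)) s2.
have e1 : int2 D (fun y => pd1 (fun x => a + b * x.1 + c * x.2) y * kap x y) = b.
  rewrite -[RHS]mulr1 -(int2_kap mD bD) -int2Z //.
  by apply: eq_int2 => y _; have [-> _] := pd_affine a b c y.
have e2 : int2 D (fun y => pd2 (fun x => a + b * x.1 + c * x.2) y * kap x y) = c.
  rewrite -[RHS]mulr1 -(int2_kap mD bD) -int2Z //.
  by apply: eq_int2 => y _; have [_ ->] := pd_affine a b c y.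
split.
  rewrite -[RHS]e1 -[RHS]opprK -h1 -int2N //; apply: eq_int2 => y _.
  by have [-> _] := pd_kap x y; rewrite mulrN opprK.
rewrite -[RHS]e2 -[RHS]opprK -h2 -int2N //; apply: eq_int2 => y _.
by have [_ ->] := pd_kap x y; rewrite mulrN opprK.
Qed.

Lemma cnv_eq0 (D : set (plane R)) (w : plane R -> R) x :
  (forall y, D y -> box x r y -> w y = 0) -> cnv D w k k x = 0.
Proof.
move=> w0; rewrite /cnv -[RHS](int2_0 D); apply: eq_int2 => y Dy.
have [/(w0 _ Dy) ->|/kap_out[h _ _]] := pselect (box x r y); first exact: mul0r.
by rewrite -[k _ * k _]/(kap x y) h mulr0.
Qed.

Variables (D : set (plane R)) (w : plane R -> R) (Mw : R).
Hypothesis mD : measurable D.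
Hypothesis Doo : (mu2 R D < +oo)%E.
Hypothesis mw : measurable_fun D w.
Hypothesis wM : forall x, D x -> `|w x| <= Mw.
Variable x : plane R.
Hypothesis bD : box x r `<=` D.

Let mb : measurable (box x r). Proof. exact: measurable_cbox. Qed.

Let mu_boxE : mu2 R (box x r) = (4 * r ^+ 2)%:E.
Proof.
have h1 : x.1 - r <= x.1 + r by apply: lerD => //; have := r0; lra.
have h2 : x.2 - r <= x.2 + r by apply: lerD => //; have := r0; lra.
by rewrite /box (@mu2_cboxE R (x.1 - r, x.2 - r) (x.1 + r, x.2 + r) h1 h2) /=;
  congr EFin; ring.
Qed.

Let mu_box : fine (mu2 R (box x r)) = 4 * r ^+ 2.
Proof. by rewrite mu_boxE. Qed.

Let mu_box_lt : (mu2 R (box x r) < +oo)%E.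
Proof. by rewrite mu_boxE ltry. Qed.

(* All three estimates have the form [|int w q - w(x) int q| <= B], with [q] the
   kernel or one of its derivatives. *)
Let estimate (q : plane R -> R) (L B : R) : continuous q -> csupp D q ->
  (forall y, ~ box x r y -> q y = 0) -> 0 <= L ->
  (forall y, box x r y -> `|w y - w x| <= L) -> 0 <= B ->
  (forall y, `|q y| <= B) ->
  `|int2 D (fun y => w y * q y) - w x * int2 D q| <= L * B * (4 * r ^+ 2).
Proof.
move=> cq sq q0 L0 hL B0 qB.
have [iq _] := integ_csupp mD cq sq.
have mq := integ_measurable iq.
have iwq : integ D (fun y => w y * q y).
  apply: (@integ_bounded _ _ _ (Mw * B)) => //; first exact: measurable_funM.
  by move=> y Dy; rewrite normrM; apply: ler_pM => //; exact: wM.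
rewrite -int2Z // -int2B //; last exact: integZ.
rewrite (int2_restrict mb mD bD); last first.
  by move=> y _ /q0 ->; rewrite !mulr0 subrr.
rewrite -mu_box; apply: le_norm_int2_cst => //.
  apply: (measurable_funS mD bD); apply: measurable_funB.
    exact: measurable_funM.
  by apply: measurable_funM.
by move=> y by_; rewrite -mulrBl normrM; apply: ler_pM => //; exact: hL.
Qed.

Lemma cnv_local :
  (forall L, (forall y, box x r y -> `|w y - w x| <= L) ->
    [/\ `|cnv D w k k x - w x| <= 4 * K ^+ 2 * L,
        `|pd1 (cnv D w k k) x| <= 4 * K ^+ 2 * L / r &
        `|pd2 (cnv D w k k) x| <= 4 * K ^+ 2 * L / r]) /\
  (forall a b c, (forall y, box x r y -> w y = a + b * y.1 + c * y.2) ->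
    pd1 (cnv D w k k) x = b /\ pd2 (cnv D w k k) x = c).
Proof.
have [_ E1] := has_pd1E (has_pd1_cnv mD Doo mw wM x sk ck sk ck).
have [_ E2] := has_pd2E (has_pd2_cnv mD Doo mw wM x sk ck sk ck).
have ck1 := smooth1_continuous sk.
have ck2 := smooth1_continuous (smooth1_derive sk).
have sd := smooth1_derive sk.
have ctens (h1 h2 : R -> R) : continuous h1 -> continuous h2 ->
    continuous (fun y : plane R => h1 (x.1 - y.1) * h2 (x.2 - y.2)).
  move=> c1 c2 y; apply: cvgM.
    apply: (@continuous_comp _ _ _ (fun y : plane R => (x.1 - y.1 : R)) h1); last exact: c1.
    by apply: cvgB; [exact: cvg_cst|exact: continuous_fst_plane].
  apply: (@continuous_comp _ _ _ (fun y : plane R => (x.2 - y.2 : R)) h2); last exact: c2.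
  by apply: cvgB; [exact: cvg_cst|exact: continuous_snd_plane].
have cs (q : plane R -> R) : (forall y, ~ box x r y -> q y = 0) -> csupp D q.
  by move=> q0; exists (box x r); split; [exact: compact_cbox|exact: bD|exact: q0].
have Kr : 0 <= K / r by rewrite divr_ge0 // ltW.
have Kr2 : 0 <= K / r ^+ 2 by rewrite divr_ge0 // sqr_ge0.
have q0 y : ~ box x r y -> kap x y = 0 by move=> /kap_out[].
have q1 y : ~ box x r y -> k^`()%classic (x.1 - y.1) * k (x.2 - y.2) = 0.
  by move=> /kap_out[].
have q2 y : ~ box x r y -> k (x.1 - y.1) * k^`()%classic (x.2 - y.2) = 0.
  by move=> /kap_out[].
split.
  move=> L hL; have L0 : 0 <= L.
    apply: le_trans (hL x (box_center x (ltW r0))); exact: normr_ge0.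
  have [z1 z2] := int2_affine_dkap 1 0 0 mD bD.
  have z1' : int2 D (fun y => k^`()%classic (x.1 - y.1) * k (x.2 - y.2)) = 0.
    by rewrite -[RHS]z1; apply: eq_int2 => y _; rewrite !mul0r !addr0 mul1r.
  have z2' : int2 D (fun y => k (x.1 - y.1) * k^`()%classic (x.2 - y.2)) = 0.
    by rewrite -[RHS]z2; apply: eq_int2 => y _; rewrite !mul0r !addr0 mul1r.
  have e0 := estimate (ctens _ _ ck1 ck1) (cs _ q0) q0 L0 hL (mulr_ge0 Kr Kr).
  have e1 := estimate (ctens _ _ ck2 ck1) (cs _ q1) q1 L0 hL (mulr_ge0 Kr2 Kr).
  have e2 := estimate (ctens _ _ ck1 ck2) (cs _ q2) q2 L0 hL (mulr_ge0 Kr Kr2).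
  rewrite z1' mulr0 subr0 in e1; rewrite z2' mulr0 subr0 in e2.
  have k1' := int2_kap mD bD; rewrite /kap in k1'.
  rewrite k1' mulr1 in e0.
  have p (a b c d : R) : `|a| <= c -> `|b| <= d -> `|a * b| <= c * d.
    by move=> h1 h2; rewrite normrM; apply: ler_pM.
  split.
  - apply: le_trans (e0 _) _; first by move=> y; exact: p.
    by rewrite le_eqVlt; apply/orP; left; apply/eqP; field; rewrite gt_eqF.
  - rewrite E1; apply: le_trans (e1 _) _; first by move=> y; exact: p.
    by rewrite le_eqVlt; apply/orP; left; apply/eqP; field; rewrite gt_eqF.
  - rewrite E2; apply: le_trans (e2 _) _; first by move=> y; exact: p.
    by rewrite le_eqVlt; apply/orP; left; apply/eqP; field; rewrite gt_eqF.
move=> a b c hw; have [z1 z2] := int2_affine_dkap a b c mD bD.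
rewrite E1 E2; split.
  rewrite -[RHS]z1; apply: eq_int2 => y Dy.
  have [/hw -> //|/q1 ->] := pselect (box x r y); by rewrite !mulr0.
rewrite -[RHS]z2; apply: eq_int2 => y Dy.
have [/hw -> //|/q2 ->] := pselect (box x r y); by rewrite !mulr0.
Qed.

End Local.

Lemma mollify : exists2 C : R, 0 <= C & forall D w (Mw r : R), measurable D ->
  (mu2 R D < +oo)%E -> measurable_fun D w -> (forall x, D x -> `|w x| <= Mw) ->
  0 < r -> exists W, [/\ smooth W,
  forall x, (forall y, D y -> box x r y -> w y = 0) -> W x = 0 &
  forall x, box x r `<=` D ->
  (forall L, (forall y, box x r y -> `|w y - w x| <= L) ->
    [/\ `|W x - w x| <= C * L, `|pd1 W x| <= C * L / r &
        `|pd2 W x| <= C * L / r]) /\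
  (forall a b c, (forall y, box x r y -> w y = a + b * y.1 + c * y.2) ->
    pd1 W x = b /\ pd2 W x = c)].
Proof.
have [K K0 hK] := @kernel_exists R; exists (4 * K ^+ 2).
  by rewrite mulr_ge0 ?sqr_ge0.
move=> D w Mw r mD Doo mw wM r0; have [k [sk k0 kK kK' k1]] := hK r r0.
exists (cnv D w k k); split.
  have ck : csupp1 k by exists r => t /ltW; exact: k0.
  exact: (smooth_cnv mD Doo mw wM).
  by move=> x; exact: cnv_eq0.
by move=> x bD; exact: (cnv_local r0 K0 sk k0 kK kK' k1 mD Doo mw wM).
Qed.

End Mollifier.
Section Affine.
Context {R : realType}.
Implicit Types (c : R * R * R) (x y : plane R).

Definition aff c x : R := c.1.1 + c.1.2 * x.1 + c.2 * x.2.

Lemma aff_sum (I : finType) (P : pred I) (k : I -> R) (c : I -> R * R * R) x :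
  \sum_(i | P i) k i * aff (c i) x =
  aff (\sum_(i | P i) k i * (c i).1.1, \sum_(i | P i) k i * (c i).1.2,
       \sum_(i | P i) k i * (c i).2) x.
Proof.
rewrite /aff /= !mulr_suml -!big_split /=.
by apply: eq_bigr => i _; ring.
Qed.

Lemma aff_convex (I : finType) (lam : I -> R) (p : I -> plane R) c x :
  \sum_i lam i = 1 -> x.1 = \sum_i lam i * (p i).1 ->
  x.2 = \sum_i lam i * (p i).2 -> aff c x = \sum_i lam i * aff c (p i).
Proof.
move=> l1 e1 e2; rewrite /aff e1 e2.
under [RHS]eq_bigr do rewrite !mulrDr.
rewrite !big_split /= -mulr_suml l1 mul1r !mulr_sumr.
by congr (_ + _ + _); apply: eq_bigr => i _; ring.
Qed.

Lemma aff_eq0 c (D : set (plane R)) : open D -> D !=set0 ->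
  (forall x, D x -> aff c x = 0) -> c = (0, 0, 0).
Proof.
move=> /open_planeP oD [x Dx] c0; have [e e0 he] := oD x Dx.
have h0 := c0 x Dx.
have D1 : D (x.1 + e / 2, x.2).
  by apply: he => /=; [rewrite opprD addNKr normrN gtr0_norm; lra|
    rewrite subrr normr0].
have D2 : D (x.1, x.2 + e / 2).
  by apply: he => /=; [rewrite subrr normr0|
    rewrite opprD addNKr normrN gtr0_norm; lra].
have h1 := c0 _ D1; have h2 := c0 _ D2.
move: h0 h1 h2; rewrite /aff /=; case: c {c0} => [[a b] d] /= h0 h1 h2.
have e2 : e / 2 != 0 by rewrite gt_eqF //; lra.
have b0 : b * (e / 2) = 0 by rewrite -[RHS](subrr 0) -{1}h1 -h0; ring.
have d0 : d * (e / 2) = 0 by rewrite -[RHS](subrr 0) -{1}h2 -h0; ring.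
move/eqP: b0; rewrite mulf_eq0 (negbTE e2) orbF => /eqP b0.
move/eqP: d0; rewrite mulf_eq0 (negbTE e2) orbF => /eqP d0.
by move: h0; rewrite b0 d0 !mul0r !addr0 => ->.
Qed.

Lemma continuous_aff c : continuous (aff c).
Proof. exact: (smooth_continuous (smooth_affine c.1.1 c.1.2 c.2)). Qed.

Lemma measurable_line c : measurable [set x | aff c x = 0].
Proof.
have -> : [set x | aff c x = 0] = aff c @^-1` [set 0] by [].
apply: measurable_closed_plane; apply: preimage_closed; last exact: closed_eq.
by move=> x _; exact: continuous_aff.
Qed.

Lemma negligible_line c : c.1.2 != 0 \/ c.2 != 0 ->
  (mu2 R).-negligible [set x | aff c x = 0].
Proof.
move=> c0; apply/negligibleP; first exact: measurable_line.
pose A := [set x | aff c x = 0]; have mA : measurable A := measurable_line c.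
have mi : measurable_fun setT (EFin \o (\1_A : plane R -> R)).
  by apply/measurable_EFinP; exact: measurable_indic.
have i0 (y : plane R) : (0 <= (EFin \o (\1_A : plane R -> R)) y)%E by rewrite /= lee_fin.
transitivity (\int[mu2 R]_y (EFin \o (\1_A : plane R -> R)) y)%E.
  by rewrite integral_indic ?setIT.
have null (p : R) : (@lebesgue_measure R) [set p] = 0%E by exact: lebesgue_measure_set1.
case: c0 => c0.
  rewrite (fubini_tonelli2 _ mi i0) -[RHS](integral0 (@lebesgue_measure R) setT).
  apply: eq_integral => y _; rewrite /fubini_G /=.
  pose p := - (c.1.1 + c.2 * y) / c.1.2.
  transitivity (\int[@lebesgue_measure R]_s (\1_[set p] s)%:E)%E.
    apply: eq_integral => s _; rewrite !indicE; congr (_%:R)%:E; congr nat_of_bool.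
    apply/idP/idP; rewrite !inE /A /aff /=.
      by move=> h; rewrite /p; apply: (mulIf c0); rewrite mulfVK //; lra.
    by move=> ->; rewrite /p mulrCA mulfV // mulr1; ring.
  by rewrite integral_indic ?setIT //; exact: null.
rewrite (fubini_tonelli1 _ mi i0) -[RHS](integral0 (@lebesgue_measure R) setT).
apply: eq_integral => y _; rewrite /fubini_F /=.
pose p := - (c.1.1 + c.1.2 * y) / c.2.
transitivity (\int[@lebesgue_measure R]_s (\1_[set p] s)%:E)%E.
  apply: eq_integral => s _; rewrite !indicE; congr (_%:R)%:E; congr nat_of_bool.
  apply/idP/idP; rewrite !inE /A /aff /=.
    by move=> h; rewrite /p; apply: (mulIf c0); rewrite mulfVK //; lra.
  by move=> ->; rewrite /p mulrCA mulfV // mulr1; ring.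
by rewrite integral_indic ?setIT //; exact: null.
Qed.

Lemma lipschitz_closed_cover (g : R -> R) (K : R) (s : seq (set R)) (a b : R) :
  a <= b -> (forall C, C \in s -> closed C) ->
  (forall C u v, C \in s -> C u -> C v -> `|g u - g v| <= K * `|u - v|) ->
  (forall t, a <= t <= b -> exists2 C, C \in s & C t) ->
  `|g b - g a| <= K * (b - a).
Proof.
move: {2}(size s) (leqnn (size s)) => n.
elim: n s a => [|n IH] s a.
  rewrite leqn0 => /nilP -> ab _ _ /(_ a); rewrite lexx ab => /(_ isT)[C].
  by rewrite inE.
move=> sn ab cl lip cov.
have [C Cs Ca] := cov a ltac:(by rewrite lexx).
pose S := [set t | C t /\ a <= t <= b].
have S0 : S a by split; rewrite ?lexx.
have hS : has_sup S.
  by split; [exists a|exists b => t [_ /andP[]]].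
pose t1 := sup S.
have at1 : a <= t1 by apply: ub_le_sup => //; case: hS.
have t1b : t1 <= b by apply: ge_sup; [exists a|move=> t [_ /andP[]]].
have Ct1 : C t1.
  apply: (cl C Cs); apply: (closureS (A := S)); first by move=> t [].
  by apply: closure_sup; [exists a|case: hS].
have L1 := lip _ _ _ Cs Ct1 Ca; rewrite [`|t1 - a|]ger0_norm ?subr_ge0 // in L1.
have cov2 t : t1 < t <= b -> exists2 C', C' \in rem C s & C' t.
  move=> /andP[h1 h2]; have [C' C's C't] := cov t ltac:(lra).
  exists C' => //; have := C's; rewrite (perm_mem (perm_to_rem Cs)) inE.
  case/orP => // /eqP E; have := h1; rewrite ltNge => /negP[].
  apply: ub_le_sup; first by case: hS.
  by split; [rewrite -E|lra].
have rs C' : C' \in rem C s -> C' \in s by exact: mem_rem.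
have [t1b'|bt1] := ltP t1 b; last first.
  by have -> : b = t1 by apply/eqP; rewrite eq_le bt1 t1b.
have L2 : `|g b - g t1| <= K * (b - t1).
  apply: (IH (rem C s)) => //.
  - by rewrite size_rem //; case: (size s) sn.
  - by move=> C' /rs; exact: cl.
  - by move=> C' u v /rs; exact: lip.
  move=> t /andP[]; rewrite le_eqVlt => /predU1P[<- _|h1 h2]; last first.
    by apply: cov2; rewrite h1.
  apply: contrapT => /forall2NP nC.
  have : \forall t \near t1, forall C', C' \in rem C s -> ~ C' t.
    have clr C' : C' \in rem C s -> closed C' by move=> /rs; exact: cl.
    elim: (rem C s) clr nC {cov2 rs} => [|C' r IHr] cl' nC.
      by near=> t2 => C'; rewrite inE.
    have h1 : \forall t \near t1, ~ C' t.
      apply: (closed_openC (cl' C' (mem_head _ _))).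
      by case: (nC C') => //; rewrite mem_head.
    have h2 : \forall t \near t1, forall C', C' \in r -> ~ C' t.
      apply: IHr => C''; first by move=> hC''; apply: cl'; rewrite inE hC'' orbT.
      case: (nC C'') => h; last by right.
      by left => hC''; apply: h; rewrite inE hC'' orbT.
    near=> t2 => C''; rewrite inE => /predU1P[->|].
      by near: t2.
    by move: C''; near: t2.
  move=> /nbhs_ballP[e /= e0 he].
  pose t2 := t1 + Num.min (e / 2) (b - t1).
  have m0 : 0 < Num.min (e / 2) (b - t1) by rewrite lt_min; lra.
  have m1 : Num.min (e / 2) (b - t1) <= e / 2 by rewrite ge_min lexx.
  have m2 : Num.min (e / 2) (b - t1) <= b - t1 by rewrite ge_min lexx orbT.
  have [C' C'r C't] := cov2 t2 ltac:(rewrite /t2; lra).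
  apply: (he t2 _ C' C'r C't).
  rewrite -ball_normE /= /t2 opprD addNKr normrN gtr0_norm //; lra.
have := ler_normD (g b - g t1) (g t1 - g a).
rewrite subrKA; nra.
Unshelve. all: by end_near. Qed.

End Affine.
Section MeshGeometry.
Context {R : realType}.
Variables (Omega : set (plane R)) (m : mesh R) (psi : vtx m -> plane R -> R).
Hypothesis hOmega : polygon Omega.
Hypothesis hm : conforming Omega m.
Hypothesis hpsi : forall a, is_hat Omega a (psi a).
Implicit Types (T : {set vtx m}) (a b : vtx m) (x y : plane R).

Lemma open_Omega : open Omega. Proof. by case: hOmega. Qed.

Lemma Omega_cbox : exists2 N : R, 0 < N & Omega `<=` cbox (- N, - N) (N, N).
Proof.
case: hOmega => _ _ _ [M [_ hM]] _; exists (`|M| + 1).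
  by have := normr_ge0 M; lra.
move=> x Ox; have /= := hM (`|M| + 1) ltac:(have := ler_norm M; lra) x Ox.
by rewrite prod_normE ge_max !ler_norml /cbox /= => /andP[].
Qed.

Lemma dom_Omega : dom Omega.
Proof.
split; first exact: open_Omega.
have [N _ h] := Omega_cbox.
exact: mu2_bounded_lt (measurable_open_plane open_Omega) h.
Qed.

Lemma dom_sub (D : set (plane R)) : open D -> D `<=` Omega -> dom D.
Proof.
move=> oD DO; split => //; have [N _ h] := Omega_cbox.
exact: mu2_bounded_lt (measurable_open_plane oD) (subset_trans DO h).
Qed.

Lemma closure_OmegaE : closure Omega = [set x | exists2 T, T \in tris m & hull T x].
Proof. by case: hm. Qed.

Lemma OmegaE : Omega = (closure Omega)°.
Proof. by case: hOmega => _ _ _ _ []. Qed.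

Lemma hull_closure T x : T \in tris m -> hull T x -> closure Omega x.
Proof. by move=> TT Tx; rewrite closure_OmegaE; exists T. Qed.

Lemma Omega_hull x : Omega x -> exists2 T, T \in tris m & hull T x.
Proof. by move=> /subset_closure; rewrite closure_OmegaE. Qed.

Lemma psi_poly T a : T \in tris m -> exists c, forall x, hull T x ->
  psi a x = aff c x.
Proof.
move=> TT; case: (hpsi a) => _ /(_ T TT) [P [c Pc] vP] _ _.
exists (c 0%N 0%N, c 1%N 0%N, c 0%N 1%N) => x /vP ->; rewrite Pc.
rewrite !big_ord_recl big_ord0 /= !big_mkcond /= !big_ord_recl !big_ord0 /=.
rewrite [X in _ + (X + 0)]big_mkcond /= !big_ord_recl !big_ord0 /=.
by rewrite /aff /= /fintype.bump /= !addn0 !expr0 !expr1; ring.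
Qed.

Definition cf T a : R * R * R :=
  xget (0, 0, 0) [set c | forall x, hull T x -> psi a x = aff c x].

Lemma psi_aff T a x : T \in tris m -> hull T x -> psi a x = aff (cf T a) x.
Proof.
move=> TT; have [c hc] := psi_poly a TT.
exact: (@xgetI _ _ [set c | forall x, hull T x -> psi a x = aff c x] c hc).
Qed.

Lemma psi_pos a b : psi a (pos b) = (b == a)%:R.
Proof. by case: (hpsi a). Qed.

Lemma hull_pos T a : a \in T -> hull T (pos a).
Proof.
move=> aT; exists (fun b => (b == a)%:R); split.
- by move=> b; exact: ler0n.
- by move=> b nb; case: eqP => // E; rewrite E aT in nb.
- by rewrite (bigD1 a) //= eqxx big1 ?addr0 // => b /negbTE ->.
- rewrite (bigD1 a) //= eqxx mul1r big1 ?addr0 // => b /negbTE ->.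
  by rewrite mul0r.
- rewrite (bigD1 a) //= eqxx mul1r big1 ?addr0 // => b /negbTE ->.
  by rewrite mul0r.
Qed.

Lemma aff_pos T a b : T \in tris m -> b \in T ->
  aff (cf T a) (pos b) = (b == a)%:R.
Proof. by move=> TT bT; rewrite -psi_aff ?psi_pos //; exact: hull_pos. Qed.

Lemma psi_lam T (lam : vtx m -> R) x a : T \in tris m ->
  (forall b, 0 <= lam b) -> (forall b, b \notin T -> lam b = 0) ->
  \sum_b lam b = 1 -> x.1 = \sum_b lam b * (pos b).1 ->
  x.2 = \sum_b lam b * (pos b).2 -> psi a x = lam a.
Proof.
move=> TT l0 lT l1 e1 e2; have Tx : hull T x by exists lam.
rewrite (psi_aff a TT Tx) (aff_convex (cf T a) l1 e1 e2).
transitivity (\sum_b lam b * (b == a)%:R).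
  apply: eq_bigr => b _; case: (boolP (b \in T)) => bT.
    by rewrite aff_pos.
  by rewrite lT // !mul0r.
rewrite (bigD1 a) //= eqxx mulr1 big1 ?addr0 // => b /negbTE ->.
by rewrite mulr0.
Qed.

Lemma hull_lam T x : T \in tris m -> hull T x ->
  [/\ forall a, 0 <= psi a x, forall a, a \notin T -> psi a x = 0,
      \sum_a psi a x = 1, x.1 = \sum_a psi a x * (pos a).1 &
      x.2 = \sum_a psi a x * (pos a).2].
Proof.
move=> TT [lam [l0 lT l1 e1 e2]].
have E a : psi a x = lam a by exact: (psi_lam a TT l0 lT l1 e1 e2).
split.
- by move=> a; rewrite E.
- by move=> a aT; rewrite E lT.
- by rewrite -l1; apply: eq_bigr.
- by rewrite e1; apply: eq_bigr => a _; rewrite E.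
- by rewrite e2; apply: eq_bigr => a _; rewrite E.
Qed.

Lemma psi_ge0 a x : 0 <= psi a x.
Proof.
have [/[dup] cx|ncx] := pselect (closure Omega x); last first.
  by case: (hpsi a) => _ _ _ ->.
rewrite {1}closure_OmegaE => -[T TT Tx].
by have [] := hull_lam TT Tx.
Qed.

Lemma psi_le1 a x : psi a x <= 1.
Proof.
have [/[dup] cx|ncx] := pselect (closure Omega x); last first.
  by case: (hpsi a) => _ _ _ ->.
rewrite {1}closure_OmegaE => -[T TT Tx].
have [p0 _ <- _ _] := hull_lam TT Tx.
by rewrite (bigD1 a) //= lerDl sumr_ge0.
Qed.

Lemma sum_psi x : Omega x -> \sum_a psi a x = 1.
Proof. by move=> /Omega_hull[T TT Tx]; have [] := hull_lam TT Tx. Qed.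

Lemma otri_neq0 T : T \in tris m -> otri T !=set0.
Proof. by move=> TT; case: hm => _ /(_ T TT) []. Qed.

Lemma card_tri T : T \in tris m -> #|T| = 3%N.
Proof. by move=> TT; case: hm => _ /(_ T TT) []. Qed.

Lemma open_otri T : open (otri T). Proof. exact: open_interior. Qed.

Lemma otri_hull T x : otri T x -> hull T x. Proof. exact: interior_subset. Qed.

Lemma aff_barycentric T x : T \in tris m ->
  [/\ \sum_(b in T) aff (cf T b) x = 1,
      x.1 = \sum_(b in T) aff (cf T b) x * (pos b).1 &
      x.2 = \sum_(b in T) aff (cf T b) x * (pos b).2].
Proof.
move=> TT.
have key (k : vtx m -> R) (d : R * R * R) :
    (forall y, hull T y -> \sum_b psi b y * k b = aff d y) ->
    \sum_(b in T) aff (cf T b) x * k b = aff d x.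
  move=> h; pose e := (\sum_(b in T) k b * (cf T b).1.1 - d.1.1,
    \sum_(b in T) k b * (cf T b).1.2 - d.1.2, \sum_(b in T) k b * (cf T b).2 - d.2).
  have E y : aff e y = \sum_(b in T) aff (cf T b) y * k b - aff d y.
    under eq_bigr do rewrite mulrC.
    by rewrite aff_sum /aff /=; ring.
  have e0 : e = (0, 0, 0).
    apply: (aff_eq0 (open_otri (T := T)) (otri_neq0 TT)) => y /otri_hull Ty.
    rewrite E -h //; apply/eqP; rewrite subr_eq0; apply/eqP.
    rewrite [RHS](bigID (mem T)) /= [X in _ + X]big1 ?addr0.
      by apply: eq_bigr => b _; rewrite (psi_aff b TT Ty).
    by move=> b bT; have [_ z _ _ _] := hull_lam TT Ty; rewrite z // mul0r.
  have := E x; rewrite e0 {1}/aff /= !mul0r !addr0 => /esym/eqP.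
  by rewrite subr_eq0 => /eqP.
split.
- rewrite -[LHS]/(\sum_(b in T) aff (cf T b) x).
  under eq_bigr do rewrite -[aff _ _]mulr1.
  rewrite (key (fun=> 1) (1, 0, 0)); first by rewrite /aff /=; ring.
  move=> y Ty; have [_ _ s1 _ _] := hull_lam TT Ty.
  by rewrite -mulr_suml s1 /aff /=; ring.
- rewrite (key (fun b => (pos b).1) (0, 1, 0)); first by rewrite /aff /=; ring.
  move=> y Ty; have [_ _ _ <- _] := hull_lam TT Ty.
  by rewrite /aff /=; ring.
- rewrite (key (fun b => (pos b).2) (0, 0, 1)); first by rewrite /aff /=; ring.
  move=> y Ty; have [_ _ _ _ <-] := hull_lam TT Ty.
  by rewrite /aff /=; ring.
Qed.

Lemma hullP T x : T \in tris m ->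
  hull T x <-> forall b, b \in T -> 0 <= aff (cf T b) x.
Proof.
move=> TT; split => [Tx b bT|h].
  by rewrite -psi_aff //; exact: psi_ge0.
have [s1 e1 e2] := aff_barycentric x TT.
exists (fun b => if b \in T then aff (cf T b) x else 0); split.
- by move=> b; case: ifP => // /h.
- by move=> b /negbTE ->.
- by rewrite -big_mkcond.
- rewrite e1 [LHS]big_mkcond; apply: eq_bigr => b _.
  by case: ifP => // _; rewrite mul0r.
- rewrite e2 [LHS]big_mkcond; apply: eq_bigr => b _.
  by case: ifP => // _; rewrite mul0r.
Qed.

Lemma hullE T : T \in tris m ->
  hull T = \bigcap_(b in [set b | b \in T]) [set x | 0 <= aff (cf T b) x].
Proof.
by move=> TT; apply/seteqP; split => x; rewrite hullP.
Qed.

Lemma closed_hull T : T \in tris m -> closed (hull T).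
Proof.
move=> TT; rewrite (hullE TT); apply: closed_bigI => b _.
have -> : [set x | 0 <= aff (cf T b) x] = aff (cf T b) @^-1` [set t | 0 <= t] by [].
apply: preimage_closed; last exact: closed_ge.
by move=> x _; exact: continuous_aff.
Qed.

Lemma otri_pos T x : T \in tris m -> (forall b, b \in T -> 0 < aff (cf T b) x) ->
  otri T x.
Proof.
move=> TT h.
have : \forall y \near x, forall b, 0 <= (if b \in T then aff (cf T b) y else 0).
  apply: (@filter_forall _ _ (fun b y => 0 <= (if b \in T then aff (cf T b) y
    else 0)) (nbhs x) _) => b; case: (boolP (b \in T)) => bT; last by near=> y.
  near=> y; apply: ltW; near: y; apply: (cvgr_gt (aff (cf T b) x)).
    exact: continuous_aff.
  exact: h.
rewrite /otri /interior /=; apply: filterS => y hy.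
by apply/(hullP _ TT) => b bT; have := hy b; rewrite bT.
Unshelve. all: by end_near. Qed.

Definition skeleton : set (plane R) :=
  [set x | exists T a, [/\ T \in tris m, a \in T & aff (cf T a) x = 0]].

Lemma negligible_skeleton : (mu2 R).-negligible skeleton.
Proof.
pose F (p : {set vtx m} * vtx m) := [set x | (p.1 \in tris m) && (p.2 \in p.1) /\
  aff (cf p.1 p.2) x = 0].
have nF p : (mu2 R).-negligible (F p).
  case: (boolP ((p.1 \in tris m) && (p.2 \in p.1))) => h; last first.
    by apply: (negligibleS _ (negligible_set0 _)) => x [/(negP h)].
  move/andP: (h) => [TT aT].
  apply: (negligibleS (A := [set x | aff (cf p.1 p.2) x = 0])); first by move=> x [].
  apply: negligible_line.
  have [b [bT ba]] : exists b, b \in p.1 /\ b != p.2.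
    have : (0 < #|p.1 :\ p.2|)%N.
      by have := cardsD1 p.2 p.1; rewrite aT (card_tri TT); case: #|p.1 :\ p.2|.
    by case/card_gt0P => b; rewrite !inE => /andP[? ?]; exists b.
  have h1 := aff_pos p.2 TT aT; have h2 := aff_pos p.2 TT bT.
  rewrite eqxx in h1; rewrite (negbTE ba) in h2.
  case: (eqVneq (cf p.1 p.2).1.2 0) => [z1|]; last by left.
  case: (eqVneq (cf p.1 p.2).2 0) => [z2|]; last by right.
  move: h1 h2; rewrite /aff z1 z2 !mul0r !addr0 => ->.
  by move/eqP; rewrite oner_eq0.
have : (mu2 R).-negligible (\big[setU/set0]_(p <- enum ({: {set vtx m} * vtx m})) F p).
  elim: (enum _) => [|p s IH]; first by rewrite big_nil; exact: negligible_set0.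
  by rewrite big_cons; apply: negligibleU.
apply: negligibleS => x [T [a [TT aT h]]].
rewrite -bigcup_seq; exists (T, a) => /=; first by rewrite mem_enum inE.
by rewrite /F /= TT aT.
Qed.

Lemma hull_otri T x : T \in tris m -> hull T x -> ~ skeleton x -> otri T x.
Proof.
move=> TT Tx nx; apply: otri_pos => // b bT; rewrite lt_neqAle.
rewrite (hullP x TT).1 // andbT eq_sym; apply/eqP => h.
by apply: nx; exists T, b.
Qed.

Lemma hull_unique T1 T2 x : T1 \in tris m -> T2 \in tris m -> hull T1 x ->
  hull T2 x -> ~ skeleton x -> T1 = T2.
Proof.
move=> TT1 TT2 x1 x2 nx; apply/eqP; rewrite eqEcard (card_tri TT1) (card_tri TT2).
rewrite leqnn andbT; apply/fintype.subsetP => b b1; apply: contrapT => /negP b2.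
have [_ z _ _ _] := hull_lam TT2 x2.
apply: nx; exists T1, b; split => //.
by rewrite -psi_aff // z.
Qed.

Definition cfbound : R := \sum_(T : {set vtx m}) \sum_(a : vtx m)
  (`|(cf T a).1.2| + `|(cf T a).2|).

Lemma cfbound_ge0 : 0 <= cfbound.
Proof. by apply: sumr_ge0 => T _; apply: sumr_ge0 => a _; rewrite addr_ge0. Qed.

Lemma le_cfbound T a : `|(cf T a).1.2| + `|(cf T a).2| <= cfbound.
Proof.
rewrite /cfbound (bigD1 T) //= (bigD1 a) //= -addrA lerDl addr_ge0 //.
  by apply: sumr_ge0 => b _; rewrite addr_ge0.
by apply: sumr_ge0 => S _; apply: sumr_ge0 => b _; rewrite addr_ge0.
Qed.

Lemma aff_lip T a x y (r : R) : `|x.1 - y.1| <= r -> `|x.2 - y.2| <= r ->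
  `|aff (cf T a) x - aff (cf T a) y| <= cfbound * r.
Proof.
move=> h1 h2; have r0 : 0 <= r by exact: le_trans h1.
have -> : aff (cf T a) x - aff (cf T a) y =
   (cf T a).1.2 * (x.1 - y.1) + (cf T a).2 * (x.2 - y.2) by rewrite /aff; ring.
apply: le_trans (ler_normD _ _) _; rewrite !normrM.
apply: le_trans (_ : (`|(cf T a).1.2| + `|(cf T a).2|) * r <= _).
  by rewrite [leRHS]mulrDl lerD // ler_wpM2l.
by rewrite ler_wpM2r // le_cfbound.
Qed.

Lemma segpt_diff x y (s t : R) :
  (segpt x y s).1 - (segpt x y t).1 = (s - t) * (y.1 - x.1) /\
  (segpt x y s).2 - (segpt x y t).2 = (s - t) * (y.2 - x.2).
Proof. by rewrite /segpt /=; split; ring. Qed.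

Lemma segpt0 x y : segpt x y 0 = x.
Proof. by case: x y => [a b] [c d]; rewrite /segpt /= !mul0r !addr0. Qed.

Lemma segpt1 x y : segpt x y 1 = y.
Proof.
by case: x y => [a b] [c d]; rewrite /segpt /= !mul1r; congr (_, _); ring.
Qed.

Lemma continuous_segpt x y : continuous (segpt x y).
Proof.
move=> t; apply: cvg_plane => /=.
  apply: cvgD; first exact: cvg_cst.
  by apply: cvgM; [exact: cvg_id|exact: cvg_cst].
apply: cvgD; first exact: cvg_cst.
by apply: cvgM; [exact: cvg_id|exact: cvg_cst].
Qed.

(* [Z] is a closed set on which [psi a] vanishes: [set0], or, for an interior
   vertex, the set of all its zeros. *)
Lemma psi_lip_segment a x y (r : R) (Z : set (plane R)) : closed Z ->
  (forall z, Z z -> psi a z = 0) ->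
  (forall t, 0 <= t <= 1 -> closure Omega (segpt x y t) \/ Z (segpt x y t)) ->
  `|x.1 - y.1| <= r -> `|x.2 - y.2| <= r -> `|psi a x - psi a y| <= cfbound * r.
Proof.
move=> cZ Z0 hseg h1 h2; have r0 : 0 <= r by exact: le_trans h1.
have Kr : 0 <= cfbound * r by rewrite mulr_ge0 // cfbound_ge0.
pose s := (segpt x y @^-1` Z) ::
  [seq segpt x y @^-1` (hull T) | T <- enum (tris m)].
have := @lipschitz_closed_cover R (fun t => psi a (segpt x y t)) (cfbound * r) s
  0 1 ltac:(lra).
rewrite subr0 mulr1.
rewrite segpt0 segpt1.
rewrite distrC; apply.
- move=> C; rewrite inE => /predU1P[->|/mapP[T]].
    by apply: preimage_closed => // t _; exact: continuous_segpt.
  rewrite mem_enum => TT ->; apply: preimage_closed; last exact: closed_hull.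
  by move=> t _; exact: continuous_segpt.
- move=> C u v; rewrite inE => /predU1P[-> /Z0 -> /Z0 ->|/mapP[T]].
    by rewrite subrr normr0 mulr_ge0.
  rewrite mem_enum => TT -> Tu Tv.
  rewrite !(psi_aff a TT) // -mulrA; apply: aff_lip.
    have [-> _] := segpt_diff x y u v.
    by rewrite normrM mulrC distrC ler_wpM2r.
  have [_ ->] := segpt_diff x y u v.
  by rewrite normrM mulrC distrC ler_wpM2r.
- move=> t /hseg[|Zt]; last by exists (segpt x y @^-1` Z) => //; rewrite mem_head.
  rewrite closure_OmegaE => -[T TT Tt]; exists (segpt x y @^-1` hull T) => //.
  by rewrite inE; apply/orP; right; apply/mapP; exists T => //; rewrite mem_enum.
Qed.

Lemma segpt_box x y (r t : R) : 0 <= t <= 1 -> box x r y -> box x r (segpt x y t).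
Proof.
move=> /andP[t0 t1] /boxP[h1 h2]; apply/boxP; rewrite /segpt /=.
have r0 : 0 <= r by exact: le_trans h1.
have k (p q : R) : `|p - q| <= r -> `|p - (p + t * (q - p))| <= r.
  move=> h; have -> : p - (p + t * (q - p)) = t * (p - q) by ring.
  rewrite normrM ger0_norm //; apply: le_trans h.
  by rewrite ler_piMl.
by split; exact: k.
Qed.

Lemma psi_lip_box a x y (r : R) : box x r `<=` closure Omega -> box x r y ->
  `|psi a y - psi a x| <= cfbound * r.
Proof.
move=> bO bxy; have [h1 h2] := (boxP _ _ _).1 bxy.
rewrite distrC; apply: (psi_lip_segment closed0) => // t ht; left.
by apply: bO; exact: segpt_box.
Qed.

End MeshGeometry.
Section InteriorVertex.
Context {R : realType}.
Variables (Omega : set (plane R)) (m : mesh R) (psi : vtx m -> plane R -> R).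
Hypothesis hOmega : polygon Omega.
Hypothesis hm : conforming Omega m.
Hypothesis hpsi : forall a, is_hat Omega a (psi a).
Implicit Types (T : {set vtx m}) (a b : vtx m) (x y : plane R).

Lemma aff_segpt (c : R * R * R) x y (t : R) :
  aff c (segpt x y t) = (1 - t) * aff c x + t * aff c y.
Proof. by rewrite /aff /segpt /=; ring. Qed.

Lemma psi_notin T a x : T \in tris m -> hull T x -> a \notin T -> psi a x = 0.
Proof. by move=> TT Tx aT; have [_ z _ _ _] := hull_lam hpsi TT Tx; exact: z. Qed.

Lemma psi_gt0_hull a x : 0 < psi a x ->
  exists T, [/\ T \in tris m, a \in T & hull T x].
Proof.
move=> p0; have [/[dup] cx|ncx] := pselect (closure Omega x); last first.
  by case: (hpsi a) p0 => _ _ _ -> //; rewrite ltxx.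
rewrite {1}(closure_OmegaE hm) => -[T TT Tx]; exists T; split => //.
by apply: contraTT p0 => aT; rewrite (psi_notin TT Tx aT) ltxx.
Qed.

Lemma near_interior_vertex a : Omega (pos a) -> exists2 e : R, 0 < e &
  forall y, `|(pos a).1 - y.1| < e -> `|(pos a).2 - y.2| < e ->
    Omega y /\ forall T, T \in tris m -> hull T y -> a \in T.
Proof.
move=> Oa.
have h1 : \forall y \near pos a, Omega y.
  exact: (open_nbhs_nbhs (conj (open_Omega hOmega) Oa)).
have h2 : \forall y \near pos a, forall T, T \in tris m -> hull T y -> a \in T.
  apply: (@filter_forall _ _ (fun T y => T \in tris m -> hull T y -> a \in T)
    (nbhs (pos a)) _) => T.
  case: (boolP (a \in T)) => aT; first by near=> y.
  case: (boolP (T \in tris m)) => TT; last by near=> y.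
  have oT : open (~` hull T) by apply: closed_openC; exact: closed_hull hm hpsi _ TT.
  have nTa : (~` hull T) (pos a).
    move=> Ta; have := psi_notin TT Ta aT; rewrite (psi_pos hpsi) eqxx.
    by move/eqP; rewrite oner_eq0.
  have := open_nbhs_nbhs (conj oT nTa).
  by apply: filterS => y ny _ /ny.
have [e e0 he] := (nbhs_planeP _ _).1 (filterI h1 h2).
by exists e => // y y1 y2; exact: he.
Unshelve. all: by end_near. Qed.

(* The star of an interior vertex [a] is [{N <= 1}] for the gauge
   [N y = (1 - psi a (a + t (y - a))) / t], continuous near any given point when
   [t] is small; hence [{N < 1} = {psi a > 0}] lies in its interior. *)
Lemma psi_gt0_Omega a x : Omega (pos a) -> 0 < psi a x -> Omega x.
Proof.
move=> Oa p0; have [e e0 he] := near_interior_vertex Oa.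
pose p := pos a.
pose M := `|p.1 - x.1| + `|p.2 - x.2| + 1.
have M1 : 1 <= M by rewrite lerDr addr_ge0.
pose t := e / (e + M).
have t0 : 0 < t by rewrite divr_gt0 //; lra.
have t1 : t < 1 by rewrite ltr_pdivrMr; lra.
have tM : t * M < e.
  rewrite /t mulrAC ltr_pdivrMr; last lra.
  by rewrite ltr_pM2l //; lra.
have L0 := cfbound_ge0 psi.
pose eta := Num.min 1 (psi a x / (cfbound psi + 1)).
have q0 : 0 < psi a x / (cfbound psi + 1) by rewrite divr_gt0 //; lra.
have eta0 : 0 < eta by rewrite lt_min ltr01.
have eta1 : eta <= 1 by rewrite ge_min lexx.
have eta2 : cfbound psi * eta <= psi a x.
  apply: le_trans (_ : cfbound psi * (psi a x / (cfbound psi + 1)) <= _).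
    by rewrite ler_wpM2l // ge_min lexx orbT.
  by rewrite mulrCA; apply: ler_piMr; [exact: ltW|rewrite ler_pdivrMr; lra].
pose H y := segpt p y t.
have close y : `|x.1 - y.1| < eta -> `|x.2 - y.2| < eta ->
    `|p.1 - (H y).1| < e /\ `|p.2 - (H y).2| < e.
  move=> y1 y2; rewrite /H /segpt /=.
  have k (u v w : R) : `|v - w| < eta -> `|u - v| + 1 <= M ->
      `|u - (u + t * (w - u))| < e.
    move=> vw uM; have -> : u - (u + t * (w - u)) = t * (u - w) by ring.
    rewrite normrM gtr0_norm //; apply: le_lt_trans tM.
    rewrite ler_pM2l //; apply: le_trans uM.
    have := ler_normD (u - v) (v - w); rewrite subrKA; lra.
  have n1 := normr_ge0 (p.1 - x.1); have n2 := normr_ge0 (p.2 - x.2).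
  by split; [apply: (k _ x.1)|apply: (k _ x.2)] => //; rewrite /M; lra.
have pH y T : T \in tris m -> a \in T -> aff (cf psi T a) (H y) =
    1 - t + t * aff (cf psi T a) y.
  by move=> TT aT; rewrite aff_segpt (aff_pos hpsi) // eqxx mulr1.
have pHb y T b : T \in tris m -> a \in T -> b != a -> aff (cf psi T b) (H y) =
    t * aff (cf psi T b) y.
  move=> TT aT ba; rewrite aff_segpt (aff_pos hpsi) // eq_sym (negbTE ba).
  by rewrite mulr0 add0r.
have [T0 [TT0 aT0 T0x]] := psi_gt0_hull p0.
have HT0 : hull T0 (H x).
  apply/(hullP hm hpsi _ TT0) => b bT; have bx := (hullP hm hpsi x TT0).1 T0x b bT.
  have [->|ba] := eqVneq b a; last by rewrite pHb // mulr_ge0 // ltW.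
  rewrite pH // -(psi_aff hpsi a TT0 T0x).
  have : 0 <= t * psi a x by rewrite mulr_ge0 // ltW.
  lra.
have pHx : psi a (H x) = 1 - t + t * psi a x.
  by rewrite (psi_aff hpsi a TT0 HT0) pH // -(psi_aff hpsi a TT0 T0x).
rewrite (OmegaE hOmega); apply/nbhs_planeP; exists eta => // y y1 y2.
have [Hy1 Hy2] := close y y1 y2.
have [OHy allT] := he _ Hy1 Hy2.
have [T TT THy] := Omega_hull hm OHy; have aT := allT T TT THy.
have Hx : `|p.1 - (H x).1| < e /\ `|p.2 - (H x).2| < e.
  by apply: close; rewrite subrr normr0.
have lip : `|psi a (H x) - psi a (H y)| <= cfbound psi * (t * eta).
  apply: (psi_lip_segment hm hpsi closed0) => //.
  - move=> s /andP[s0 s1]; left; apply: subset_closure.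
    have k (u v w : R) : `|u - v| < e -> `|u - w| < e ->
        `|u - (v + s * (w - v))| < e.
      move=> uv uw.
      have -> : u - (v + s * (w - v)) = (1 - s) * (u - v) + s * (u - w) by ring.
      apply: le_lt_trans (ler_normD _ _) _; rewrite !normrM.
      rewrite (ger0_norm s0) ger0_norm ?subr_ge0 //.
      have [->|s0'] := eqVneq s 0; first by rewrite subr0 mul1r mul0r addr0.
      have : s * `|u - w| < s * e by rewrite ltr_pM2l // lt_neqAle eq_sym s0'.
      have : (1 - s) * `|u - v| <= (1 - s) * e by rewrite ler_wpM2l ?subr_ge0 // ltW.
      lra.
    by case: (he (segpt (H x) (H y) s)) => //; apply: k => //; case: Hx.
  - rewrite /H /segpt /= (_ : _ - _ = t * (x.1 - y.1)); last by ring.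
    by rewrite normrM gtr0_norm // ler_pM2l // ltW.
  - rewrite /H /segpt /= (_ : _ - _ = t * (x.2 - y.2)); last by ring.
    by rewrite normrM gtr0_norm // ler_pM2l // ltW.
have pHy : 1 - t <= psi a (H y).
  have : cfbound psi * (t * eta) <= t * psi a x.
    by rewrite mulrCA ler_pM2l.
  move: lip; rewrite pHx ler_norml => /andP[_]; lra.
apply: (hull_closure hm TT); apply/(hullP hm hpsi _ TT) => b bT.
rewrite -(pmulr_rge0 _ t0).
have [->|ba] := eqVneq b a.
  by move: pHy; rewrite (psi_aff hpsi a TT THy) pH //; lra.
by rewrite -pHb //; exact: (hullP hm hpsi _ TT).1.
Qed.

Lemma cbox_cover (D : set (plane R)) x : open D -> D x ->
  exists2 e : R, 0 < e & forall r, 0 < r -> r < e -> box x r `<=` D.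
Proof.
move=> /open_planeP oD Dx; have [e e0 he] := oD x Dx; exists e => // r r0 re.
by move=> y /boxP[h1 h2]; apply: he; [exact: le_lt_trans re|exact: le_lt_trans re].
Qed.

Lemma open_psi_gt0 a : Omega (pos a) -> open [set x | 0 < psi a x].
Proof.
move=> Oa; apply/open_planeP => x /= p0.
have [e e0 he] := cbox_cover (open_Omega hOmega) (psi_gt0_Omega Oa p0).
have L0 := cfbound_ge0 psi.
pose r := Num.min (e / 2) (psi a x / (cfbound psi + 2)).
have q0 : 0 < psi a x / (cfbound psi + 2) by rewrite divr_gt0 //; lra.
have r0 : 0 < r by rewrite lt_min q0 andbT; lra.
have re : r < e by rewrite gt_min; apply/orP; left; lra.
exists r => // y y1 y2.
have := psi_lip_box hm hpsi a (subset_trans (he r r0 re) (@subset_closure _ _))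
  ((boxP x r y).2 (conj (ltW y1) (ltW y2))).
have : cfbound psi * r <= cfbound psi * (psi a x / (cfbound psi + 2)).
  by rewrite ler_wpM2l // ge_min lexx orbT.
have : cfbound psi * (psi a x / (cfbound psi + 2)) < psi a x.
  by rewrite mulrCA gtr_pMr // ltr_pdivrMr; lra.
rewrite ler_norml => h1 h2 /andP[h3 _]; lra.
Qed.

Lemma psi_lip_plane a x y (r : R) : Omega (pos a) -> box x r y ->
  `|psi a y - psi a x| <= cfbound psi * r.
Proof.
move=> Oa /boxP[h1 h2]; rewrite distrC.
apply: (psi_lip_segment hm hpsi (Z := ~` [set x | 0 < psi a x])) => //.
- by apply: open_closedC; exact: open_psi_gt0.
- move=> z /negP; rewrite -leNgt => z0; apply/eqP; rewrite eq_le z0.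
  exact: psi_ge0 hm hpsi _ _.
- move=> t _; have [h|h] := pselect (0 < psi a (segpt x y t)); last by right.
  by left; apply: subset_closure; exact: psi_gt0_Omega h.
Qed.

Lemma continuous_psi a : Omega (pos a) -> continuous (psi a).
Proof.
move=> Oa x; apply/cvgrPdist_lt => e e0; have L0 := cfbound_ge0 psi.
apply/nbhs_planeP; exists (e / (cfbound psi + 1)); first by rewrite divr_gt0 //; lra.
move=> y y1 y2.
have := psi_lip_plane Oa ((boxP x (e / (cfbound psi + 1)) y).2
  (conj (ltW y1) (ltW y2))).
rewrite distrC => /le_lt_trans; apply.
rewrite mulrCA gtr_pMr // ltr_pdivrMr; lra.
Qed.

Lemma measurable_psi a : measurable_fun (closure Omega) (psi a).
Proof.
apply: measurable_fun_within_plane; last by case: (hpsi a).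
by apply: measurable_closed_plane; exact: closed_closure.
Qed.

Lemma measurable_psi_Omega a : measurable_fun Omega (psi a).
Proof.
apply: (measurable_funS _ (@subset_closure _ Omega)) (measurable_psi a).
by apply: measurable_closed_plane; exact: closed_closure.
Qed.

End InteriorVertex.
Section GradientOfHat.
Context {R : realType}.
Variables (Omega : set (plane R)) (m : mesh R) (psi : vtx m -> plane R -> R).
Hypothesis hOmega : polygon Omega.
Hypothesis hm : conforming Omega m.
Hypothesis hpsi : forall a, is_hat Omega a (psi a).
Implicit Types (T : {set vtx m}) (a b : vtx m) (x y : plane R).

Let oO := open_Omega hOmega.
Let dO : dom Omega := dom_Omega hOmega.
Let mO : measurable Omega := dom_measurable dO.

Definition pgrad a x : plane R :=
  (\sum_(T in tris m) \1_(otri T) x * (cf psi T a).1.2,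
   \sum_(T in tris m) \1_(otri T) x * (cf psi T a).2).

Lemma pgrad_otri T a x : T \in tris m -> otri T x -> ~ skeleton psi x ->
  pgrad a x = ((cf psi T a).1.2, (cf psi T a).2).
Proof.
move=> TT Tx nx.
have z T' : T' \in tris m -> T' != T -> \1_(otri T') x = 0 :> R.
  move=> TT' TT'T; rewrite indicE memNset // => T'x; case/eqP: TT'T.
  by apply: (hull_unique hm hpsi TT' TT _ _ nx); exact: otri_hull.
rewrite /pgrad; congr (_, _); rewrite (bigD1 T) //= indicE mem_set // mul1r;
  by rewrite big1 ?addr0 // => T' /andP[? ?]; rewrite z // mul0r.
Qed.

Let indic_le (A : set (plane R)) x (c : R) : `|\1_A x * c| <= `|c|.
Proof.
rewrite normrM indicE; case: (x \in A); last by rewrite normr0 mul0r.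
by rewrite normr1 mul1r.
Qed.

Lemma pgrad_bound a x :
  `|(pgrad a x).1| <= cfbound psi /\ `|(pgrad a x).2| <= cfbound psi.
Proof.
have key (k : {set vtx m} -> R) : (forall T, `|k T| <= \sum_(b : vtx m)
     (`|(cf psi T b).1.2| + `|(cf psi T b).2|)) ->
    `|\sum_(T in tris m) \1_(otri T) x * k T| <= cfbound psi.
  move=> hk; apply: le_trans (ler_norm_sum _ _ _) _.
  apply: le_trans (_ : \sum_(T in tris m) \sum_(b : vtx m)
    (`|(cf psi T b).1.2| + `|(cf psi T b).2|) <= _).
    by apply: ler_sum => T _; exact: le_trans (indic_le _ _ _) (hk T).
  rewrite /cfbound [leRHS](bigID (mem (tris m))) /= lerDl; apply: sumr_ge0 => T _.
  by apply: sumr_ge0 => b _; rewrite addr_ge0.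
have s0 T : 0 <= \sum_(b | b != a) (`|(cf psi T b).1.2| + `|(cf psi T b).2|).
  by apply: sumr_ge0 => b _; rewrite addr_ge0.
split; apply: key => T; rewrite (bigD1 a) //=; have := s0 T;
  have := normr_ge0 (cf psi T a).1.2; have := normr_ge0 (cf psi T a).2; lra.
Qed.

Lemma measurable_pgrad (D : set (plane R)) a : measurable D ->
  measurable_fun D (fun x => (pgrad a x).1) /\
  measurable_fun D (fun x => (pgrad a x).2).
Proof.
move=> mD; have key (k : {set vtx m} -> R) :
    measurable_fun D (fun x => \sum_(T in tris m) \1_(otri T) x * k T).
  under eq_fun do rewrite big_mkcond /=.
  apply: measurable_sum => T; case: (T \in tris m); last exact: measurable_cst.
  apply: measurable_funM => //; apply: (measurable_funS measurableT) => //.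
  by apply: measurable_indic; apply: measurable_open_plane; exact: open_otri.
by split; exact: key.
Qed.

Lemma cvg_eventually (u : nat -> R) (l : R) (N : nat) :
  (forall n, (N <= n)%N -> u n = l) -> u @ \oo --> l.
Proof.
move=> h; apply/cvgrPdist_lt => e e0; exists N => // n /= /h ->.
by rewrite subrr normr0.
Qed.

Lemma inv_lt_eventually (e : R) : 0 < e ->
  exists N, forall n, (N <= n)%N -> n.+1%:R^-1 < e.
Proof.
move=> e0; exists (Num.bound e^-1) => n Nn.
rewrite -[ltRHS]invrK ltf_pV2 ?posrE ?invr_gt0 //.
apply: lt_le_trans (archi_boundP _) _; first by rewrite invr_ge0 ltW.
by rewrite ler_nat (leq_trans Nn).
Qed.

Lemma compact_boxes K : compact K -> K `<=` Omega ->
  exists2 e : R, 0 < e & forall x, K x -> box x e `<=` Omega.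
Proof.
move=> /compact_near_coveringP cK KO.
have := cK nat \oo (fun n x => box x n.+1%:R^-1 `<=` Omega) _ _.
move=> /(_ _)[|n _ hn]; last first.
  by exists n.+1%:R^-1; [rewrite invr_gt0|move=> x Kx; exact: (hn n (leqnn n) x Kx)].
move=> x Kx; have [e e0 he] := (open_planeP _).1 oO x (KO x Kx).
have [N hN] := @inv_lt_eventually (e / 2) ltac:(lra).
exists ([set y | `|x.1 - y.1| < e / 2 /\ `|x.2 - y.2| < e / 2], [set n | (N <= n)%N]).
  split; last by exists N.
  by apply/nbhs_planeP; exists (e / 2) => //; lra.
move=> [y n] /= [[y1 y2] Nn] z /boxP[z1 z2]; have := hN n Nn => hn.
have k (u v w : R) : `|u - v| < e / 2 -> `|v - w| <= n.+1%:R^-1 -> `|u - w| < e.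
  move=> h1 h2; have h3 := le_lt_trans h2 hn.
  by have := ler_normD (u - v) (v - w); rewrite subrKA; lra.
by apply: he; [exact: k y1 z1|exact: k y2 z2].
Qed.

Lemma ae_otri : {ae mu2 R, forall x, Omega x -> ~ skeleton psi x /\
  exists2 T, T \in tris m & otri T x}.
Proof.
have := negligible_skeleton hm hpsi; apply: negligibleS => x /= /not_implyP[Ox].
apply: contra_notP => nx; split => //.
have [T TT Tx] := Omega_hull hm Ox; exists T => //.
exact: hull_otri hm hpsi _ _ TT Tx nx.
Qed.

Lemma psi_by_parts a (eta : plane R -> R) : Ck 1 eta -> csupp Omega eta ->
  int2 Omega (fun x => psi a x * pd1 eta x) =
    - int2 Omega (fun x => (pgrad a x).1 * eta x) /\
  int2 Omega (fun x => psi a x * pd2 eta x) =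
    - int2 Omega (fun x => (pgrad a x).2 * eta x).
Proof.
move=> ceta seta; have [C C0 hC] := @mollify R.
have [s1 s2] := csupp_pd seta.
have [K [cK KO K0]] := seta; have [e e0 he] := compact_boxes cK KO.
have L0 := cfbound_ge0 psi; set L := cfbound psi in L0.
pose r n := e * n.+1%:R^-1.
have r0 n : 0 < r n by rewrite mulr_gt0 // invr_gt0.
have re n : r n <= e by rewrite ger_pMr // invf_le1 // ler1n.
have psiM x : Omega x -> `|psi a x| <= 1.
  by move=> _; rewrite ger0_norm ?(psi_le1 hm hpsi) ?(psi_ge0 hm hpsi).
have mpsi : measurable_fun Omega (psi a) := measurable_psi_Omega hpsi a.
have /choice[W hW] : forall n, exists W, [/\ smooth W,
  forall x, (forall y, Omega y -> box x (r n) y -> psi a y = 0) -> W x = 0 &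
  forall x, box x (r n) `<=` Omega ->
  (forall L, (forall y, box x (r n) y -> `|psi a y - psi a x| <= L) ->
    [/\ `|W x - psi a x| <= C * L, `|pd1 W x| <= C * L / r n &
        `|pd2 W x| <= C * L / r n]) /\
  (forall p q s, (forall y, box x (r n) y -> psi a y = p + q * y.1 + s * y.2) ->
    pd1 W x = q /\ pd2 W x = s)].
  by move=> n; exact: (hC Omega (psi a) 1 (r n) mO dO.2 mpsi psiM (r0 n)).
have sW n : smooth (W n) by case: (hW n).
have boxO x n : K x -> box x (r n) `<=` Omega.
  move=> Kx y /boxP[h1 h2]; apply: (he x Kx); apply/boxP.
  by split; [exact: le_trans (re n)|exact: le_trans (re n)].
have est x n : K x -> [/\ `|W n x - psi a x| <= C * (L * r n),
    `|pd1 (W n) x| <= C * L & `|pd2 (W n) x| <= C * L].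
  move=> Kx; have [_ _ /(_ x (boxO x n Kx))[h _]] := hW n.
  have E : C * (L * r n) / r n = C * L by rewrite mulrA mulfK // gt_eqF.
  have [h1 h2 h3] := h (L * r n) (fun y => psi_lip_box hm hpsi a
    (subset_trans (boxO x n Kx) (@subset_closure _ Omega))).
  by rewrite E in h2 h3; split.
have cWpsi x : K x -> (fun n => W n x) @ \oo --> psi a x.
  move=> Kx; apply/cvgrPdist_le => d d0.
  have CLe : 0 <= C * L * e by rewrite !mulr_ge0 // ltW.
  have [N hN] := @inv_lt_eventually (d / (C * L * e + 1)) ltac:(rewrite divr_gt0 //; lra).
  exists N => // n /= Nn; rewrite distrC; have [h _ _] := est x n Kx.
  apply: le_trans h _; rewrite /r !mulrA.
  apply: le_trans (_ : C * L * e * (d / (C * L * e + 1)) <= _).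
    by rewrite ler_wpM2l // ltW // hN.
  by rewrite mulrCA; apply: ler_piMr; [exact: ltW|rewrite ler_pdivrMr; lra].
have cG x : Omega x -> ~ skeleton psi x -> (exists2 T, T \in tris m & otri T x) ->
    K x -> (fun n => pd1 (W n) x) @ \oo --> ((pgrad a x).1 : R) /\
    (fun n => pd2 (W n) x) @ \oo --> ((pgrad a x).2 : R).
  move=> Ox nx [T TT Tx] Kx.
  have [d d0 hd] := cbox_cover (open_otri (T := T)) Tx.
  have [N hN] := inv_lt_eventually (divr_gt0 d0 e0).
  have E n : (N <= n)%N -> pd1 (W n) x = (pgrad a x).1 /\ pd2 (W n) x = (pgrad a x).2.
    move=> Nn; have [_ _ /(_ x (boxO x n Kx))[_ h]] := hW n.
    rewrite (pgrad_otri a TT Tx nx) /=; apply: (h (cf psi T a).1.1) => y yb.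
    have Ty : otri T y.
      apply: (hd (r n) (r0 n) _ y yb).
      by rewrite /r mulrC -ltr_pdivlMr // hN.
    exact: (psi_aff hpsi a TT (otri_hull Ty)).
  by split; apply: (@cvg_eventually _ _ N) => n /E[].
have [ceta0 [deta [[ceta1 _] [ceta2 _]]]] := ceta.
have mc (v : plane R -> R) : continuous v -> measurable_fun Omega v.
  move=> cv; apply: (measurable_funS measurableT) => //.
  exact: measurable_fun_continuous_plane.
have [mG1 mG2] := measurable_pgrad a mO.
have key (q : plane R -> R) (F : nat -> plane R -> R) (G : plane R -> R) (B : R) :
    continuous q -> csupp Omega q -> (forall x, ~ K x -> q x = 0) ->
    (forall n, continuous (F n)) -> measurable_fun Omega G ->
    (forall n x, K x -> `|F n x| <= B) ->
    {ae mu2 R, forall x, Omega x -> K x -> (fun n => F n x) @ \oo --> G x} ->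
    (fun n => int2 Omega (fun x => F n x * q x)) @ \oo -->
      int2 Omega (fun x => G x * q x).
  move=> cq sq q0 cF mG FB FG.
  have [_ iq] := integ_csupp mO cq sq.
  have iqO := integS mO measurableT (@subsetT _ _) iq.
  have [] := @int2_dct _ Omega (fun n x => F n x * q x) (fun x => G x * q x)
    (fun x => `|B| * `|q x|) mO; last by [].
  - by move=> n; apply: measurable_funM; exact: mc.
  - by apply: measurable_funM => //; exact: mc.
  - apply: filterS FG => x h Ox; have [Kx|/q0 qx] := pselect (K x).
      by apply: cvgM; [exact: h|exact: cvg_cst].
    by rewrite qx mulr0; under eq_fun do rewrite mulr0; exact: cvg_cst.
  - by apply: integZ => //; exact: integ_norm.
  - move=> n x _; have [Kx|/q0 ->] := pselect (K x); last by rewrite mulr0 normr0 mulr0.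
    by rewrite normrM ler_wpM2r // (le_trans (FB _ _ Kx)) // ler_norm.
have pdK x : ~ K x -> pd1 eta x = 0 /\ pd2 eta x = 0.
  move=> nK.
  have cs : csupp K eta by exists K; split; [exact: cK|by []|exact: K0].
  have [[K1 [_ KK1 z1]] [K2 [_ KK2 z2]]] := csupp_pd cs.
  by split; [apply: z1 => /KK1|apply: z2 => /KK2].
have WB n x : K x -> `|W n x| <= 1 + C * (L * e).
  move=> Kx; have [h _ _] := est x n Kx.
  have := ler_normD (psi a x) (W n x - psi a x); rewrite addrC subrK.
  have := psiM x (KO x Kx).
  have : C * (L * r n) <= C * (L * e) by rewrite !ler_wpM2l.
  lra.
have parts n := int2_by_parts mO (sW n 1%N) ceta seta.
have cvW1 : (fun n => int2 Omega (fun x => W n x * pd1 eta x)) @ \oo -->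
    int2 Omega (fun x => psi a x * pd1 eta x).
  apply: (key _ _ _ _ ceta1 s1 (fun x nK => (pdK x nK).1)) => //.
  - by move=> n; exact: smooth_continuous (sW n).
  - exact: WB.
  - by apply: aeW => x _; exact: cWpsi.
have cvW2 : (fun n => int2 Omega (fun x => W n x * pd2 eta x)) @ \oo -->
    int2 Omega (fun x => psi a x * pd2 eta x).
  apply: (key _ _ _ _ ceta2 s2 (fun x nK => (pdK x nK).2)) => //.
  - by move=> n; exact: smooth_continuous (sW n).
  - exact: WB.
  - by apply: aeW => x _; exact: cWpsi.
have cvG1 : (fun n => int2 Omega (fun x => pd1 (W n) x * eta x)) @ \oo -->
    int2 Omega (fun x => (pgrad a x).1 * eta x).
  apply: (key eta _ _ (C * L) ceta0 seta K0) => //.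
  - by move=> n; exact: smooth_continuous (smooth_pd1 (sW n)).
  - by move=> n x Kx; have [] := est x n Kx.
  - apply: filterS ae_otri => x h Ox Kx; have [nx hT] := h Ox.
    by have [] := cG x Ox nx hT Kx.
have cvG2 : (fun n => int2 Omega (fun x => pd2 (W n) x * eta x)) @ \oo -->
    int2 Omega (fun x => (pgrad a x).2 * eta x).
  apply: (key eta _ _ (C * L) ceta0 seta K0) => //.
  - by move=> n; exact: smooth_continuous (smooth_pd2 (sW n)).
  - by move=> n x Kx; have [] := est x n Kx.
  - apply: filterS ae_otri => x h Ox Kx; have [nx hT] := h Ox.
    by have [] := cG x Ox nx hT Kx.
split.
  have E : (fun n => int2 Omega (fun x => W n x * pd1 eta x)) =
      (fun n => - int2 Omega (fun x => pd1 (W n) x * eta x)).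
    by apply/funext => n; have [] := parts n.
  rewrite E in cvW1; exact: (cvg_unique (@norm_hausdorff _ _) cvW1 (cvgN cvG1)).
have E : (fun n => int2 Omega (fun x => W n x * pd2 eta x)) =
    (fun n => - int2 Omega (fun x => pd2 (W n) x * eta x)).
  by apply/funext => n; have [] := parts n.
rewrite E in cvW2; exact: (cvg_unique (@norm_hausdorff _ _) cvW2 (cvgN cvG2)).
Qed.

End GradientOfHat.
Section HatSobolev.
Context {R : realType}.
Variables (Omega : set (plane R)) (m : mesh R) (psi : vtx m -> plane R -> R).
Hypothesis hOmega : polygon Omega.
Hypothesis hm : conforming Omega m.
Hypothesis hpsi : forall a, is_hat Omega a (psi a).
Implicit Types (T : {set vtx m}) (a b : vtx m) (x y : plane R).

Let oO := open_Omega hOmega.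
Let dO : dom Omega := dom_Omega hOmega.
Let mO : measurable Omega := dom_measurable dO.

Lemma psi_norm_le1 a x : `|psi a x| <= 1.
Proof. by rewrite ger0_norm ?(psi_le1 hm hpsi) ?(psi_ge0 hm hpsi). Qed.

Lemma L2_psi a : L2 Omega (psi a).
Proof.
apply: (L2_bounded mO dO.2 (measurable_psi_Omega hpsi a) (M := 1)) => x _.
exact: psi_norm_le1.
Qed.

Lemma L2v_pgrad a : L2v Omega (pgrad psi a).
Proof.
have [m1 m2] := measurable_pgrad psi a mO.
split; apply: (L2_bounded mO dO.2 (M := cfbound psi)) => // x _;
  by have [] := pgrad_bound psi a x.
Qed.

Lemma is_wgrad_psi a : is_wgrad Omega (psi a) (pgrad psi a).
Proof.
have [L1 L2_] := L2v_pgrad a; split; [exact: L1|exact: L2_|].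
move=> phi [sphi cphi].
exact: (psi_by_parts hOmega hm hpsi a (sphi 1%N) cphi).
Qed.

Lemma H1_psi a : H1 Omega (psi a).
Proof. by split; [exact: L2_psi|exists (pgrad psi a); exact: is_wgrad_psi]. Qed.

Let product_rule_balance (A P Q X Y Z : R) : A = Z + X -> Q = Y + Z -> P = Y ->
  A = - P -> X = - Q.
Proof. by lra. Qed.

Lemma H1_psiM a (phi : plane R -> R) : test_fun Omega phi ->
  H1 Omega (fun x => psi a x * phi x).
Proof.
move=> tphi; have [sphi cphi] := tphi; have [t1 t2] := test_fun_pd tphi.
have mpsi := measurable_psi_Omega hpsi a.
have Lpsi (v : plane R -> R) : L2 Omega v -> L2 Omega (fun x => psi a x * v x).
  by apply: (L2_mul_bounded mO mpsi (M := 1)) => x _; exact: psi_norm_le1.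
have [mG1 mG2] := measurable_pgrad psi a mO.
have LG (G : plane R -> R) : measurable_fun Omega G ->
    (forall x, `|G x| <= cfbound psi) -> L2 Omega (fun x => G x * phi x).
  move=> mG GB; apply: (L2_mul_bounded mO mG (M := cfbound psi)) => [x _|].
    exact: GB.
  exact: test_fun_L2 mO tphi.
have Lphi1 := test_fun_L2 mO t1; have Lphi2 := test_fun_L2 mO t2.
have LG1 := LG _ mG1 (fun x => (pgrad_bound psi a x).1).
have LG2 := LG _ mG2 (fun x => (pgrad_bound psi a x).2).
split; first by apply: Lpsi; exact: test_fun_L2 mO tphi.
exists (fun x => ((pgrad psi a x).1 * phi x + psi a x * pd1 phi x,
                  (pgrad psi a x).2 * phi x + psi a x * pd2 phi x)).
split; [by apply: L2D => //; exact: Lpsi|by apply: L2D => //; exact: Lpsi|].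
move=> chi tchi; have [schi cchi] := tchi; have [u1 u2] := test_fun_pd tchi.
have Lchi := test_fun_L2 mO tchi.
have cM : Ck 1 (fun x => phi x * chi x) by exact: CkM (sphi 1%N) (schi 1%N).
have sM : csupp Omega (fun x => phi x * chi x) by exact: csuppMl.
have [e1 e2] := psi_by_parts hOmega hm hpsi a cM sM.
have d1 x := (has_pd1E (has_pd1M (Ck_has_pd1 x (sphi 1%N)) (Ck_has_pd1 x (schi 1%N)))).2.
have d2 x := (has_pd2E (has_pd2M (Ck_has_pd2 x (sphi 1%N)) (Ck_has_pd2 x (schi 1%N)))).2.
have key (G dphi dchi dpc : plane R -> R) : L2 Omega (fun x => G x * phi x) ->
    L2 Omega dphi -> L2 Omega dchi ->
    (forall x, dpc x = dphi x * chi x + phi x * dchi x) ->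
    int2 Omega (fun x => psi a x * dpc x) =
      - int2 Omega (fun x => G x * (phi x * chi x)) ->
    int2 Omega (fun x => psi a x * phi x * dchi x) =
      - int2 Omega (fun x => (G x * phi x + psi a x * dphi x) * chi x).
  move=> LGp Ldphi Ldchi E H.
  have i1 := L2_mul mO (Lpsi _ (test_fun_L2 mO tphi)) Ldchi.
  have i2 := L2_mul mO (Lpsi _ Ldphi) Lchi.
  have i3 := L2_mul mO LGp Lchi.
  have E1 : int2 Omega (fun x => psi a x * dpc x) =
      int2 Omega (fun x => psi a x * dphi x * chi x) +
      int2 Omega (fun x => psi a x * phi x * dchi x).
    by rewrite -int2D //; apply: eq_int2 => x _; rewrite E; ring.
  have E2 : int2 Omega (fun x => (G x * phi x + psi a x * dphi x) * chi x) =
      int2 Omega (fun x => G x * phi x * chi x) +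
      int2 Omega (fun x => psi a x * dphi x * chi x).
    by rewrite -int2D //; apply: eq_int2 => x _; ring.
  have E3 : int2 Omega (fun x => G x * (phi x * chi x)) =
      int2 Omega (fun x => G x * phi x * chi x).
    by apply: eq_int2 => x _; ring.
  exact: product_rule_balance E1 E2 E3 H.
have L1 := test_fun_L2 mO u1; have L2_ := test_fun_L2 mO u2.
split; first exact: (key (fun x => (pgrad psi a x).1) _ _ _ LG1 Lphi1 L1 d1 e1).
exact: (key (fun x => (pgrad psi a x).2) _ _ _ LG2 Lphi2 L2_ d2 e2).
Qed.

Let max_lip (p q s c : R) : `|p - q| <= c ->
  `|Num.max (p - s) 0 - Num.max (q - s) 0| <= c.
Proof.
rewrite !ler_norml => /andP[h1 h2].
by case: (lerP (p - s) 0) => h3; case: (lerP (q - s) 0) => h4; apply/andP;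
  split; lra.
Qed.

Let max_close (p s : R) : 0 <= p -> 0 < s -> `|Num.max (p - s) 0 - p| <= s.
Proof.
move=> p0 s0; rewrite ler_norml.
by case: (lerP (p - s) 0) => h; apply/andP; split; lra.
Qed.

(* [psi a] is approximated by mollifications of [max (psi a - delta) 0], whose
   supports are compact in [Omega]. *)
Lemma H10_psi a : Omega (pos a) -> H10 Omega (psi a).
Proof.
move=> Oa; split; first exact: H1_psi.
have [C C0 hC] := @mollify R; have L0 := cfbound_ge0 psi; set L := cfbound psi in L0.
have [N N0 hN] := Omega_cbox hOmega.
pose D := cbox (- (N + 1), - (N + 1)) (N + 1, N + 1) : set (plane R).
have mD : measurable D by exact: measurable_cbox.
have Doo : (mu2 R D < +oo)%E by apply: mu2_compact_lt; exact: compact_cbox.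
pose d n : R := n.+1%:R^-1.
have d0 n : 0 < d n by rewrite invr_gt0.
have d1 n : d n <= 1 by rewrite invf_le1 // ler1n.
pose r n := d n / (2 * (L + 1)).
have r0 n : 0 < r n by rewrite divr_gt0 // mulr_gt0 //; lra.
have Lr n : L * r n <= d n / 2.
  have L1 : L + 1 != 0 by rewrite gt_eqF //; lra.
  have -> : L * r n = d n / 2 * (L / (L + 1)) by rewrite /r; field.
  apply: ler_piMr; first by rewrite divr_ge0 // ltW.
  by rewrite ler_pdivrMr; lra.
have rd n : r n <= d n.
  by rewrite /r ler_pdivrMr ?mulr_gt0 //; [have := d0 n; nra|lra].
pose w n x := Num.max (psi a x - d n) 0.
have w0 n x : 0 <= w n x by rewrite le_max lexx orbT.
have wM n x : D x -> `|w n x| <= 1.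
  move=> _; rewrite ger0_norm // ge_max ler01 andbT.
  have := psi_le1 hm hpsi a x; have := d0 n; lra.
have cpsi := continuous_psi hOmega hm hpsi Oa.
have mw n : measurable_fun D (w n).
  apply: measurable_maxr; last exact: measurable_cst.
  apply: measurable_funB; last exact: measurable_cst.
  apply: (measurable_funS measurableT) => //.
  exact: measurable_fun_continuous_plane.
have lip n x y : box x (r n) y -> `|psi a y - psi a x| <= L * r n.
  by move=> b; exact: (psi_lip_plane hOmega hm hpsi Oa b).
have wlip n x y : box x (r n) y -> `|w n y - w n x| <= L * r n.
  by move=> /lip; exact: max_lip.
have /choice[W hW] : forall n, exists W, [/\ smooth W,
  forall x, (forall y, D y -> box x (r n) y -> w n y = 0) -> W x = 0 &
  forall x, box x (r n) `<=` D ->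
  (forall L, (forall y, box x (r n) y -> `|w n y - w n x| <= L) ->
    [/\ `|W x - w n x| <= C * L, `|pd1 W x| <= C * L / r n &
        `|pd2 W x| <= C * L / r n]) /\
  (forall p q s, (forall y, box x (r n) y -> w n y = p + q * y.1 + s * y.2) ->
    pd1 W x = q /\ pd2 W x = s)].
  by move=> n; exact: (hC D (w n) 1 (r n) mD Doo (mw n) (wM n) (r0 n)).
have sW n : smooth (W n) by case: (hW n).
have boxD x n : Omega x -> box x (r n) `<=` D.
  move=> /hN[/andP[x1 x2] /andP[x3 x4]] y /boxP[]; rewrite !ler_norml /=.
  move=> /andP[y1 y2] /andP[y3 y4]; have := rd n; have := d1 n => q1 q2.
  move: x1 x2 x3 x4 => /= x1 x2 x3 x4.
  by split; apply/andP; split; rewrite /=; lra.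
have tW n : test_fun Omega (W n).
  split; first exact: sW.
  pose K := [set x | d n / 2 <= psi a x].
  have KO : K `<=` Omega.
    move=> x Kx; apply: (psi_gt0_Omega hOmega hm hpsi Oa).
    by apply: lt_le_trans Kx; rewrite divr_gt0.
  exists K; split => //.
    apply: (@subclosed_compact _ K (cbox (- N, - N) (N, N))).
    - have -> : K = psi a @^-1` [set t | d n / 2 <= t] by [].
      by apply: preimage_closed; [move=> x _; exact: cpsi|exact: closed_ge].
    - exact: compact_cbox.
    - exact: subset_trans KO hN.
  move=> x /negP; rewrite -ltNge => px; have [_ z _] := hW n; apply: z => y _ b.
  have := lip n x y b; rewrite ler_norml => /andP[_ h].
  by apply/eqP; rewrite eq_le w0 andbT ge_max lexx andbT; have := Lr n; lra.
have est x n : Omega x -> [/\ `|W n x - psi a x| <= (C + 1) * d n,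
    `|pd1 (W n) x| <= C * L & `|pd2 (W n) x| <= C * L].
  move=> Ox; have [_ _ /(_ x (boxD x n Ox))[h _]] := hW n.
  have [h1 h2 h3] := h (L * r n) (fun y => wlip n x y).
  have E : C * (L * r n) / r n = C * L by rewrite mulrA mulfK // gt_eqF.
  rewrite E in h2 h3; split => //.
  have CL : C * (L * r n) <= C * d n.
    by rewrite ler_wpM2l //; have := Lr n; have := d0 n; lra.
  have wp : `|w n x - psi a x| <= d n.
    exact: max_close (psi_ge0 hm hpsi a x) (d0 n).
  have := ler_normD (W n x - w n x) (w n x - psi a x); rewrite subrKA; lra.
have exact_ x : Omega x -> ~ skeleton psi x ->
    (exists2 T, T \in tris m & otri T x) -> exists M, forall n, (M <= n)%N ->
    pd1 (W n) x = (pgrad psi a x).1 /\ pd2 (W n) x = (pgrad psi a x).2.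
  move=> Ox nx [T TT Tx]; have [e e0 he] := cbox_cover (open_otri (T := T)) Tx.
  rewrite (pgrad_otri hm hpsi a TT Tx nx) /=.
  have boxT n : d n < e -> box x (r n) `<=` otri T.
    by move=> de; apply: he => //; exact: le_lt_trans (rd n) de.
  case: (boolP (a \in T)) => aT.
    have p0 : 0 < psi a x.
      rewrite lt_neqAle (psi_ge0 hm hpsi) andbT eq_sym; apply/eqP => z.
      by apply: nx; exists T, a; rewrite -(psi_aff hpsi a TT (otri_hull Tx)).
    have [M hM] := @inv_lt_eventually R (Num.min e (psi a x / 2))
      ltac:(by rewrite lt_min e0 divr_gt0).
    exists M => n /hM; rewrite lt_min => /andP[de dp].
    have [_ _ /(_ x (boxD x n Ox))[_ h]] := hW n.
    apply: (h ((cf psi T a).1.1 - d n)) => y yb.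
    have Ty := otri_hull (boxT n de y yb).
    have py : d n < psi a y.
      have := lip n x y yb; rewrite ler_norml => /andP[h3 _].
      have := Lr n; have := d0 n; rewrite -/(d n) in dp; lra.
    rewrite /w max_l; last by rewrite subr_ge0 ltW.
    by rewrite (psi_aff hpsi a TT Ty) /aff; ring.
  have c0 : cf psi T a = (0, 0, 0).
    apply: (aff_eq0 (open_otri (T := T)) (otri_neq0 hm TT)) => y /otri_hull Ty.
    by rewrite -(psi_aff hpsi a TT Ty) (psi_notin hpsi TT Ty aT).
  have [M hM] := inv_lt_eventually e0; exists M => n /hM de; rewrite c0 /=.
  have [_ _ /(_ x (boxD x n Ox))[_ h]] := hW n.
  apply: (h 0) => y yb; have Ty := otri_hull (boxT n de y yb).
  rewrite /w (psi_notin hpsi TT Ty aT) sub0r max_r ?oppr_le0 ?(ltW (d0 n)) //.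
  by rewrite !mul0r !addr0.
have Lpsi := L2_psi a; have [LG1 LG2] := L2v_pgrad a.
have [mG1 mG2] := measurable_pgrad psi a mO.
pose F n x := (psi a x - W n x) ^+ 2 +
  ((pgrad psi a x).1 - pd1 (W n) x) ^+ 2 + ((pgrad psi a x).2 - pd2 (W n) x) ^+ 2.
have HF n : H1norm Omega (fun x => psi a x - W n x) ^+ 2 = int2 Omega (F n).
  have [t1 t2] := test_fun_pd (tW n).
  have LW := test_fun_L2 mO (tW n).
  have LW1 := test_fun_L2 mO t1; have LW2 := test_fun_L2 mO t2.
  have hg := is_wgrad_lin (-1) mO LW Lpsi (is_wgrad_test_fun mO (tW n))
    (is_wgrad_psi a).
  have eqf x : Omega x -> -1 * W n x + psi a x = psi a x - W n x.
    by move=> _; ring.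
  have hg2 := is_wgrad_eq eqf hg.
  have Lv : L2v Omega (vlin (-1) (cgrad (W n)) (pgrad psi a)).
    apply: (L2v_lin (-1) mO _ (L2v_pgrad a)).
    exact: is_wgrad_L2v (is_wgrad_test_fun mO (tW n)).
  have E1 := H1norm_sqr Omega (fun x => psi a x - W n x).
  have E2 := gradnorm_sqr dO hg2.
  have E3 := int2D mO (L2_sqr mO (L2B mO Lpsi LW)) (L2v_dot mO Lv Lv).
  have E4 := congr1 (fun t => int2 Omega (fun x => (psi a x - W n x) ^+ 2) + t) E2.
  have E5 := etrans E1 E4.
  have E6 := etrans E5 (esym E3).
  have E7 : int2 Omega (fun x => (psi a x - W n x) ^+ 2 +
     dot (vlin (-1) (cgrad (W n)) (pgrad psi a) x)
         (vlin (-1) (cgrad (W n)) (pgrad psi a) x)) = int2 Omega (F n).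
    by apply: eq_int2 => x _; rewrite /F /dot /vlin /cgrad /=; ring.
  exact: etrans E6 E7.
have mc (v : plane R -> R) : continuous v -> measurable_fun Omega v.
  move=> cv; apply: (measurable_funS measurableT) => //.
  exact: measurable_fun_continuous_plane.
pose B : R := (C + 1) ^+ 2 + 2 * (L + C * L) ^+ 2.
have lim : (fun n => int2 Omega (F n)) @ \oo --> int2 Omega (fun=> 0).
  have [] := @int2_dct _ Omega F (fun=> 0) (fun=> B) mO; last by [].
  - move=> n; have mpsi := measurable_psi_Omega hpsi a.
    have c1 := mc _ (smooth_continuous (smooth_pd1 (sW n))).
    have c2 := mc _ (smooth_continuous (smooth_pd2 (sW n))).
    have c3 := mc _ (smooth_continuous (sW n)).
    by apply: measurable_funD; first apply: measurable_funD;
      apply: measurable_funX; exact: measurable_funB.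
  - exact: measurable_cst.
  - apply: filterS (ae_otri hm hpsi) => x h Ox; have [nx hT] := h Ox.
    have [M hM] := exact_ x Ox nx hT.
    apply/cvgrPdist_lt => e e0.
    have [M' hM'] := @inv_lt_eventually R (Num.min 1 (e / ((C + 1) ^+ 2 + 1)))
      ltac:(rewrite lt_min ltr01 divr_gt0 //; have := sqr_ge0 (C + 1); lra).
    exists (maxn M M') => // n /=; rewrite geq_max => /andP[nM /hM'].
    rewrite lt_min -/(d n) => /andP[h1 h2].
    rewrite sub0r normrN /F; have [-> ->] := hM n nM.
    rewrite !subrr expr0n /= !addr0 normrX.
    have [h3 _ _] := est x n Ox; rewrite distrC in h3.
    have d2 : d n ^+ 2 <= d n.
      by rewrite expr2 ler_piMl // ltW.
    have h4 : `|psi a x - W n x| ^+ 2 <= (C + 1) ^+ 2 * d n.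
      apply: le_trans (_ : ((C + 1) * d n) ^+ 2 <= _).
        rewrite lerXn2r ?nnegrE // mulr_ge0 //; [lra|exact: ltW].
      by rewrite exprMn ler_wpM2l // sqr_ge0.
    apply: le_lt_trans h4 _; have c2 := sqr_ge0 (C + 1).
    apply: le_lt_trans (_ : (C + 1) ^+ 2 * (e / ((C + 1) ^+ 2 + 1)) < _).
      by rewrite ler_wpM2l // ltW.
    by rewrite mulrCA gtr_pMr // ltr_pdivrMr; lra.
  - by apply: (integ_bounded mO dO.2 (M := `|B|)); first exact: measurable_cst.
  - move=> n x Ox; have [h1 h2 h3] := est x n Ox.
    have [g1 g2] := pgrad_bound psi a x.
    have sq (u v c : R) : `|u| <= L -> `|v| <= C * L -> (u - v) ^+ 2 <= (L + C * L) ^+ 2.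
      move=> hu hv; rewrite -(real_normK (num_real (u - v))).
      have CL : 0 <= C * L by rewrite mulr_ge0.
      rewrite lerXn2r ?nnegrE //; first by rewrite addr_ge0.
      by have := ler_normB u v; lra.
    have s1 := sq _ _ 0 g1 h2; have s2 := sq _ _ 0 g2 h3.
    have s0 : (psi a x - W n x) ^+ 2 <= (C + 1) ^+ 2.
      rewrite -sqrrN opprB -(real_normK (num_real _)).
      rewrite lerXn2r ?nnegrE //; first by lra.
      apply: le_trans h1 _; rewrite ler_piMr //; lra.
    rewrite ger0_norm; first by rewrite /F /B; lra.
    by rewrite /F !addr_ge0 ?sqr_ge0.
rewrite int2_0 in lim.
move=> eps eps0.
have e2 : 0 < eps ^+ 2 by rewrite exprn_gt0.
have [M _ hM] := (cvgrPdist_lt _ _).1 lim _ e2.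
exists (W M); first exact: tW.
rewrite -(@ltr_pXn2r _ 2) ?nnegrE ?H1norm_ge0 ?(ltW eps0) // HF.
apply: le_lt_trans (hM M (leqnn M)); rewrite sub0r normrN; exact: ler_norm.
Qed.

End HatSobolev.
Section Stars.
Context {R : realType}.
Variables (Omega : set (plane R)) (m : mesh R) (psi : vtx m -> plane R -> R).
Hypothesis hOmega : polygon Omega.
Hypothesis hm : conforming Omega m.
Hypothesis hpsi : forall a, is_hat Omega a (psi a).
Implicit Types (T : {set vtx m}) (a b : vtx m) (x y : plane R).

Let dO : dom Omega := dom_Omega hOmega.
Let mO : measurable Omega := dom_measurable dO.

Lemma le_int2_ae (D : set (plane R)) (v w : plane R -> R) : measurable D ->
  integ D v -> integ D w -> {ae mu2 R, forall x, D x -> v x <= w x} ->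
  int2 D v <= int2 D w.
Proof.
move=> mD iv iw vw; have mv := integ_measurable iv; have mw := integ_measurable iw.
pose u x := Num.min (v x) (w x).
have mu : measurable_fun D u by exact: measurable_minr.
have vu : ae_eq (mu2 R) D v u.
  by apply: filterS vw => x h Dx; rewrite /u min_l // h.
rewrite (int2_ae_eq mD mv mu vu); apply: le_int2 => //.
  exact: integ_ae_eq vu iv.
by move=> x _; rewrite /u ge_min lexx orbT.
Qed.

Lemma star_sub a : star a `<=` Omega.
Proof.
rewrite (OmegaE hOmega); apply: interiorS => x [T [TT _ Tx]].
exact: hull_closure hm _ _ TT Tx.
Qed.

Lemma dom_star a : dom (star a).
Proof. by apply: (dom_sub hOmega); [exact: open_interior|exact: star_sub]. Qed.

Lemma otri_sub T : T \in tris m -> otri T `<=` Omega.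
Proof.
move=> TT; rewrite (OmegaE hOmega); apply: interiorS => x Tx.
exact: hull_closure hm _ _ TT Tx.
Qed.

Lemma dom_otri T : T \in tris m -> dom (otri T).
Proof. by move=> TT; apply: (dom_sub hOmega); [exact: open_otri|exact: otri_sub]. Qed.

Lemma sum_star_indic x : Omega x -> ~ skeleton psi x ->
  \sum_(a : vtx m) \1_(star a) x <= 3 :> R.
Proof.
move=> Ox nx; have [T TT Tx] := Omega_hull hm Ox.
apply: le_trans (_ : \sum_(a : vtx m) (a \in T)%:R <= _).
  apply: ler_sum => a _; rewrite indicE.
  case: (boolP (x \in star a)) => //= /set_mem /interior_subset[T' [TT' aT' T'x]].
  by rewrite -(hull_unique hm hpsi TT' TT T'x Tx nx) aT'.
rewrite (_ : \sum_a _ = #|T|%:R); first by rewrite (card_tri hm TT).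
rewrite -sum1_card natr_sum [RHS]big_mkcond /=; apply: eq_bigr => a _.
by case: (a \in T).
Qed.

Lemma sum_int2_star (F : plane R -> R) : integ Omega F -> (forall x, 0 <= F x) ->
  \sum_(a : vtx m) int2 (star a) F <= 3 * int2 Omega F.
Proof.
move=> iF F0.
have ms a : measurable (star a) := dom_measurable (dom_star a).
have iF1 a : integ Omega (fun x => \1_(star a) x * F x).
  apply: (@integ_le _ _ _ F) => //.
    apply: measurable_funM; last exact: integ_measurable.
    by apply: (measurable_funS measurableT) => //; exact: measurable_indic.
  move=> x _; rewrite indicE normrM (ger0_norm (F0 x)).
  by case: (x \in star a); rewrite ?normr1 ?normr0 ?mul1r ?mul0r.
have E a : int2 (star a) F = int2 Omega (fun x => \1_(star a) x * F x).
  rewrite (int2_restrict (ms a) mO (@star_sub a)); last first.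
    by move=> x _ nx; rewrite indicE memNset // mul0r.
  by apply: eq_int2 => x sx; rewrite indicE mem_set // mul1r.
rewrite (eq_bigr _ (fun a _ => E a)) -int2_sum // -int2Z //.
apply: le_int2_ae => //; [exact: integ_sum|exact: integZ|].
apply: filterS (ae_otri hm hpsi) => x h Ox; have [nx _] := h Ox.
by rewrite -mulr_suml ler_wpM2r // sum_star_indic.
Qed.

Lemma sum_gradnorm_star (v : plane R -> R) : H1 Omega v ->
  \sum_(a : vtx m) gradnorm (star a) v ^+ 2 <= 3 * gradnorm Omega v ^+ 2.
Proof.
move=> [Lv [g hg]]; rewrite (gradnorm_sqr dO hg).
have Lg := is_wgrad_L2v hg.
have E a : gradnorm (star a) v ^+ 2 = int2 (star a) (fun x => dot (g x) (g x)).
  apply: gradnorm_sqr; first exact: dom_star.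
  apply: is_wgradS hg; [|exact: mO|exact: star_sub].
  exact: dom_measurable (dom_star a).
rewrite (eq_bigr _ (fun a _ => E a)); apply: sum_int2_star.
  exact: L2v_dot.
by move=> x; exact: dot_ge0.
Qed.

Definition star_mean a (phi : plane R -> R) : R :=
  if `[< interior_vertex Omega a >] then
    int2 (star a) phi / fine (mu2 R (star a))
  else 0.

Lemma star_mu_gt0 a : 0 < fine (mu2 R (star a)).
Proof.
have [_ soo] := dom_star a.
case: hm => _ _ _ /(_ a)[T TT aT] _.
have [x Tx] := otri_neq0 hm TT.
have sx : star a x.
  move: Tx; apply: interiorS => y Ty.
  by exists T.
have [e e0 he] := cbox_cover (proj1 (dom_star a)) sx.
have e2 : 0 < e / 2 by lra.
have sub : box x (e / 2) `<=` star a by apply: he => //; lra.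
have h1 : x.1 - e / 2 <= x.1 + e / 2 by apply: lerD => //; lra.
have h2 : x.2 - e / 2 <= x.2 + e / 2 by apply: lerD => //; lra.
have E : mu2 R (box x (e / 2)) = (e * e)%:E.
  rewrite /box (@mu2_cboxE R (x.1 - e / 2, x.2 - e / 2)
    (x.1 + e / 2, x.2 + e / 2) h1 h2) /=; congr EFin.
  have k (p q : R) : p + q / 2 - (p - q / 2) = q by field.
  by rewrite !k.
have L : ((e * e)%:E <= mu2 R (star a))%E.
  rewrite -E; apply: le_measure; rewrite ?inE; [exact: measurable_cbox| |exact: sub].
  exact: dom_measurable (dom_star a).
have ee : 0 < e * e by exact: mulr_gt0.
move: soo L; case: (mu2 R (star a)) => [r| |] //= _; rewrite lee_fin.
exact: lt_le_trans.
Qed.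

Lemma is_wgrad_star_mean a (phi : plane R -> R) (c : R) : test_fun Omega phi ->
  is_wgrad (star a) (fun x => phi x - c) (cgrad phi).
Proof.
move=> tphi; have ms := dom_measurable (dom_star a).
have h := is_wgrad_test_fun ms tphi; have Lp := test_fun_L2 ms tphi.
have Lc : L2 (star a) (fun=> - c).
  by apply: (L2_bounded ms (dom_star a).2 (M := `|- c|)); first exact: measurable_cst.
have := is_wgrad_lin 1 ms Lp Lc h (is_wgrad_cst (- c) ms).
rewrite (_ : vlin 1 (cgrad phi) (fun=> (0, 0)) = cgrad phi); last first.
  by apply/funext => x; rewrite /vlin /cgrad /= !mul1r !addr0.
by apply: is_wgrad_eq => x _; rewrite mul1r.
Qed.

Lemma H1star_test_fun a (phi : plane R -> R) : test_fun Omega phi ->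
  H1star Omega a (fun x => phi x - star_mean a phi).
Proof.
move=> tphi; have ms := dom_measurable (dom_star a).
have Lp := test_fun_L2 ms tphi.
have soo := (dom_star a).2.
have Lc (c : R) : L2 (star a) (fun=> c).
  by apply: (L2_bounded ms soo (M := `|c|)); first exact: measurable_cst.
split.
- split; first by apply: L2B.
  by exists (cgrad phi); exact: is_wgrad_star_mean.
- move=> Oa; have ip := L2_integ ms soo Lp; have ic := L2_integ ms soo (Lc (star_mean a phi)).
  rewrite (int2B ms ip ic) (int2_cst _ ms) /star_mean asboolT // divfK ?subrr //.
  by rewrite gt_eqF // star_mu_gt0.
- move=> nOa T b c TT aT bT cT bc sub.
  have z : star_mean a phi = 0 by rewrite /star_mean asboolF.
  have [sphi [K [cK KO K0]]] := tphi.
  split; first exact: measurable_cst.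
    by under eq_integral do rewrite expr0n /=; rewrite integral0.
  move=> eps eps0; exists phi; split; [exact: sphi| |].
    have -> : (fun x => phi x - star_mean a phi - phi x) = (fun=> 0).
      by apply/funext => x; rewrite z; ring.
    have mT := dom_measurable (dom_otri TT).
    have N0 : H1norm (otri T) (fun=> 0 : R) ^+ 2 = 0.
      rewrite H1norm_sqr (gradnorm_sqr (dom_otri TT) (is_wgrad_cst 0 mT)).
      have I0 (F : plane R -> R) : (forall x, F x = 0) -> int2 (otri T) F = 0.
        by move=> F0; rewrite -[RHS](int2_0 (otri T)); apply: eq_int2 => x _.
      rewrite !I0 ?addr0 // => x; rewrite /dot /= ?mulr0 ?addr0 //.
      by rewrite expr0n.
    by move/eqP: N0; rewrite expf_eq0 /= => /eqP ->.
  have -> : \int[@lebesgue_measure R]_(t in unitI R)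
      (phi (segpt (pos b) (pos c) t) - 0) ^+ 2 = 0; last by [].
  rewrite /Rintegral (eq_integral (fun=> 0%E)) ?integral0 // => t /set_mem tI.
  rewrite K0 ?subrr ?expr0n // => Kx.
  have hx : hull [set b; c]%SET (segpt (pos b) (pos c) t).
    move: tI; rewrite /unitI /= in_itv /= => /andP[t0 t1].
    exists (fun d => (d == b)%:R * (1 - t) + (d == c)%:R * t).
    have S (k : vtx m -> R) : \sum_d ((d == b)%:R * (1 - t) + (d == c)%:R * t) * k d =
        (1 - t) * k b + t * k c.
      under eq_bigr do rewrite mulrDl.
      rewrite big_split /= (bigD1 b) //= eqxx mul1r big1 ?addr0; last first.
        by move=> d /negbTE ->; rewrite !mul0r.
      rewrite (bigD1 c) //= eqxx mul1r big1 ?addr0 // => d /negbTE ->.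
      by rewrite !mul0r.
    split.
    + by move=> d; rewrite addr_ge0 // mulr_ge0 // ?subr_ge0.
    + by move=> d; rewrite !inE negb_or => /andP[/negbTE -> /negbTE ->];
        rewrite !mul0r addr0.
    + transitivity (\sum_d ((d == b)%:R * (1 - t) + (d == c)%:R * t) * 1).
        by apply: eq_bigr => d _; rewrite mulr1.
      by rewrite (S (fun=> 1)); ring.
    + by rewrite (S (fun d => (pos d).1)) /segpt /=; ring.
    + by rewrite (S (fun d => (pos d).2)) /segpt /=; ring.
  have [_ [_]] := sub _ hx; apply.
  exact: (open_nbhs_nbhs (conj (open_Omega hOmega) (KO _ Kx))).
Qed.

End Stars.
Section Residual.
Context {R : realType}.
Implicit Types (v w : plane R -> R).

Section Functional.
Variables (D : set (plane R)) (f z : plane R -> R).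
Hypotheses (dD : dom D) (Lf : L2 D f) (Hz : H1 D z).

Let mD : measurable D := dom_measurable dD.

Lemma residualE v g h : is_wgrad D v g -> is_wgrad D z h ->
  residual D f z v = int2 D (fun x => f x * v x) - int2 D (fun x => dot (h x) (g x)).
Proof. by move=> hv hz; rewrite /residual (int2_dot_wgrad dD hz hv). Qed.

Let combine (r r1 r2 A B A1 A2 B1 B2 c : R) :
  r = A - B -> r1 = A1 - B1 -> r2 = A2 - B2 ->
  A = c * A1 + A2 -> B = c * B1 + B2 -> r = c * r1 + r2.
Proof. by move=> -> -> -> -> ->; ring. Qed.

Lemma residual_lin c v w : H1 D v -> H1 D w ->
  residual D f z (fun x => c * v x + w x) =
  c * residual D f z v + residual D f z w.
Proof.
move=> [Lv [g hg]] [Lw [h hh]]; have [Lz [k hk]] := Hz.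
have hl := is_wgrad_lin c mD Lv Lw hg hh.
have gv := is_wgrad_L2v hg; have gw := is_wgrad_L2v hh.
have gz := is_wgrad_L2v hk.
apply: combine (residualE hl hk) (residualE hg hk) (residualE hh hk) _ _.
  have If := L2_mul mD Lf Lv; have Ig := L2_mul mD Lf Lw.
  apply: etrans (congr1 (fun r => r + _) (int2Z c mD If)).
  apply: etrans (int2D mD (integZ c mD If) Ig).
  by apply: eq_int2 => x _; ring.
have E (p q : plane R -> plane R) : int2 D (fun x => dot (p x) (q x)) =
    int2 D (fun x => dot (q x) (p x)).
  by apply: eq_int2 => x _; rewrite /dot; ring.
apply: etrans (E _ _) _; apply: etrans (int2_dot_linl c mD gv gw gz) _.
by congr (_ * _ + _); exact: E.
Qed.

Lemma residual_cst0 : residual D f z (fun=> 0) = 0.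
Proof.
have [Lz [k hk]] := Hz.
rewrite (residualE (is_wgrad_cst 0 mD) hk).
have E (F : plane R -> R) : (forall x, F x = 0) -> int2 D F = 0.
  by move=> F0; rewrite -[RHS](int2_0 D); apply: eq_int2 => x _.
by rewrite !E ?subrr // => x; rewrite /dot /= ?mulr0 ?addr0.
Qed.

Lemma eq_residual v w : (forall x, D x -> v x = w x) -> H1 D v ->
  residual D f z v = residual D f z w.
Proof.
move=> vw [_ [g hg]]; have [_ [k hk]] := Hz.
rewrite (residualE hg hk) (residualE (is_wgrad_eq vw hg) hk); congr (_ - _).
by apply: eq_int2 => x /vw ->.
Qed.

Lemma H1_0 : H1 D (fun=> 0).
Proof. by split; [exact: L2_0|exists (fun=> (0, 0)); exact: is_wgrad_cst]. Qed.

Lemma residual_sum (I : Type) (s : seq I) (V : I -> plane R -> R) :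
  (forall i, H1 D (V i)) -> H1 D (fun x => \sum_(i <- s) V i x) /\
  residual D f z (fun x => \sum_(i <- s) V i x) =
  \sum_(i <- s) residual D f z (V i).
Proof.
move=> HV; elim: s => [|i s [IH1 IH2]].
  rewrite (_ : (fun x => \sum_(i <- [::]) V i x) = fun=> 0); last first.
    by apply/funext => x; rewrite big_nil.
  by rewrite big_nil; split; [exact: H1_0|exact: residual_cst0].
rewrite (_ : (fun x => \sum_(j <- i :: s) V j x) =
    (fun x => 1 * V i x + \sum_(j <- s) V j x)); last first.
  by apply/funext => x; rewrite big_cons mul1r.
split; first by apply: H1_lin.
by rewrite residual_lin // mul1r IH2 big_cons.
Qed.

Let bound (A B a b p q N : R) : `|A| <= a * p -> `|B| <= b * q -> 0 <= a ->
  0 <= b -> p <= N -> q <= N -> `|A - B| <= (a + b) * N.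
Proof.
move=> h1 h2 a0 b0 pN qN; apply: le_trans (ler_normB _ _) _.
have : a * p <= a * N by rewrite ler_wpM2l.
have : b * q <= b * N by rewrite ler_wpM2l.
lra.
Qed.

Lemma residual_bound : exists2 C : R, 0 <= C & forall v, H1 D v ->
  `|residual D f z v| <= C * H1norm D v.
Proof.
have [Lz [k hk]] := Hz; exists (l2norm D f + vnorm D k).
  by rewrite addr_ge0 // sqrtr_ge0.
move=> v [Lv [g hg]]; rewrite (residualE hg hk).
have n0 : 0 <= l2norm D v by exact: sqrtr_ge0.
apply: bound (L2_CS mD Lf Lv)
  (vnorm_CS mD (is_wgrad_L2v hk) (is_wgrad_L2v hg)) _ _ _ _;
  try exact: sqrtr_ge0.
  rewrite -(@ler_pXn2r _ 2) ?nnegrE ?H1norm_ge0 //.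
  rewrite /H1norm [leRHS]sqr_sqrtr; first by rewrite lerDl sqr_ge0.
  by rewrite addr_ge0 // sqr_ge0.
rewrite -(gradnormE dD hg) -(@ler_pXn2r _ 2) ?nnegrE ?H1norm_ge0 ?gradnorm_ge0 //.
rewrite /H1norm [leRHS]sqr_sqrtr; first by rewrite lerDr sqr_ge0.
by rewrite addr_ge0 // sqr_ge0.
Qed.

End Functional.

Lemma sum_CS (I : finType) (p q : I -> R) :
  `|\sum_i p i * q i| <= Num.sqrt (\sum_i p i ^+ 2) * Num.sqrt (\sum_i q i ^+ 2).
Proof.
apply: discriminant_le; try by apply: sumr_ge0 => i _; exact: sqr_ge0.
move=> t; have -> : \sum_i p i ^+ 2 + 2 * (\sum_i p i * q i) * t +
    (\sum_i q i ^+ 2) * t ^+ 2 = \sum_i (p i + t * q i) ^+ 2.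
  rewrite mulr_sumr !mulr_suml -!big_split /=; apply: eq_bigr => i _; ring.
by apply: sumr_ge0 => i _; exact: sqr_ge0.
Qed.

Section Reliability.
Variables (Omega : set (plane R)) (m : mesh R) (psi : vtx m -> plane R -> R).
Hypothesis hOmega : polygon Omega.
Hypothesis hm : conforming Omega m.
Hypothesis hpsi : forall a, is_hat Omega a (psi a).
Variables (f uT : plane R -> R) (U : set (plane R -> R)).
Hypothesis hf : L2 Omega f.
Hypothesis hU : fe_space Omega m U.
Hypothesis huT : galerkin Omega f U uT.

Let dO : dom Omega := dom_Omega hOmega.
Let mO : measurable Omega := dom_measurable dO.

Lemma galerkin_H10 : H10 Omega uT.
Proof. by case: hU => _ h _; case: huT => /h[]. Qed.

Let HuT : H1 Omega uT. Proof. by case: galerkin_H10. Qed.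

Let fe_residual v : U v -> residual Omega f uT v = 0.
Proof. by case: huT => _ h Uv; rewrite /residual -h // subrr. Qed.

Lemma residual_psi a : Omega (pos a) -> residual Omega f uT (psi a) = 0.
Proof.
move=> Oa; apply: fe_residual; case: hU => _ _; apply.
  exact: H10_psi hOmega hm hpsi _ Oa.
by move=> T TT; case: (hpsi a) => _ /(_ T TT).
Qed.

Lemma res_loc_star_mean a (phi : plane R -> R) : test_fun Omega phi ->
  res_loc Omega psi f uT a (fun x => phi x - star_mean Omega a phi) =
  residual Omega f uT (fun x => psi a x * phi x).
Proof.
move=> tphi; have Hp := H1_psi hOmega hm hpsi a.
have Hpp := H1_psiM hOmega hm hpsi a tphi.
set c := star_mean Omega a phi.
rewrite /res_loc (_ : (fun x => psi a x * (phi x - c)) =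
   (fun x => - c * psi a x + psi a x * phi x)); last first.
  by apply/funext => x; ring.
rewrite (residual_lin dO hf HuT _ Hp Hpp).
suff -> : - c * residual Omega f uT (psi a) = 0 by rewrite add0r.
rewrite /c /star_mean; case: asboolP => [Oa|_].
  by rewrite residual_psi // mulr0.
by rewrite oppr0 mul0r.
Qed.

Let scale_bound (d g r : R) : 0 <= g ->
  (forall t : R, `|t| * g <= 1 -> `|t| * r <= d) -> 0 <= r -> r <= d * g.
Proof.
move=> g0 h r0; have d0 := h 0 ltac:(by rewrite normr0 mul0r).
rewrite normr0 mul0r in d0.
move: g0; rewrite le_eqVlt => /predU1P[g0|g0].
  rewrite -g0 mulr0; rewrite leNgt; apply/negP => rp.
  have q0 : 0 <= (d + 1) / r by rewrite divr_ge0 // addr_ge0.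
  have := h ((d + 1) / r) ltac:(by rewrite -g0 mulr0).
  by rewrite ger0_norm // divfK ?gt_eqF //; lra.
have := h g^-1; rewrite normfV gtr0_norm // mulVf ?gt_eqF // lexx => /(_ isT).
by rewrite mulrC ler_pdivrMr.
Qed.

Lemma res_loc_bound a (d : R) (phi : plane R -> R) : test_fun Omega phi ->
  (dual_norm a (H1star Omega a) (res_loc Omega psi f uT a) <= d%:E)%E ->
  `|residual Omega f uT (fun x => psi a x * phi x)| <=
    d * gradnorm (star a) phi.
Proof.
move=> tphi hd; have ds := dom_star hOmega hm a.
have ms := dom_measurable ds.
have Hs : H1 (star a) phi by exact: test_fun_H1 ms tphi.
apply: scale_bound; [exact: gradnorm_ge0| |exact: normr_ge0].
move=> t ht; pose phit x := t * phi x.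
have tphit : test_fun Omega phit by exact: test_funM (smooth_cst t) tphi.
have W := H1star_test_fun hOmega hm a tphit.
have hg : gradnorm (star a) (fun x => phit x - star_mean Omega a phit) <= 1.
  rewrite (gradnormE ds (is_wgrad_star_mean hOmega hm a _ tphit)).
  rewrite -(gradnormE ds (is_wgrad_test_fun ms tphit)).
  by rewrite (gradnormZ t ds Hs).
have E : residual Omega f uT (fun x => psi a x * phit x) =
    t * residual Omega f uT (fun x => psi a x * phi x).
  have Hp := H1_psiM hOmega hm hpsi a tphi.
  have := residual_lin dO hf HuT t Hp (H1_0 dO).
  rewrite (residual_cst0 f dO HuT) addr0 => <-; congr (residual _ _ _ _).
  by apply/funext => x; rewrite /phit; ring.
rewrite -normrM -E -(res_loc_star_mean a tphit) -lee_fin.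
apply: le_trans hd; apply: ereal_sup_ubound.
by exists (fun x => phit x - star_mean Omega a phit).
Qed.

Lemma reliability_test_fun (d : vtx m -> R) (phi : plane R -> R) :
  test_fun Omega phi ->
  (forall a, dual_norm a (H1star Omega a) (res_loc Omega psi f uT a) <= (d a)%:E)%E ->
  `|residual Omega f uT phi| <=
    Num.sqrt (\sum_a d a ^+ 2) * (Num.sqrt 3 * gradnorm Omega phi).
Proof.
move=> tphi hd.
have [HS ES] := residual_sum dO hf HuT (index_enum (vtx m))
  (fun a => H1_psiM hOmega hm hpsi a tphi).
have Hphi := test_fun_H1 mO tphi.
have -> : residual Omega f uT phi =
    \sum_a residual Omega f uT (fun x => psi a x * phi x).
  rewrite -ES; apply: (eq_residual f dO HuT _ Hphi) => x Ox.
  by rewrite -mulr_suml (sum_psi hm hpsi Ox) mul1r.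
apply: le_trans (ler_norm_sum _ _ _) _.
apply: le_trans (_ : \sum_a d a * gradnorm (star a) phi <= _).
  by apply: ler_sum => a _; exact: res_loc_bound.
apply: le_trans (ler_norm _) _; apply: le_trans (sum_CS _ _) _.
apply: ler_wpM2l; first exact: sqrtr_ge0.
rewrite -(@ler_pXn2r _ 2) ?nnegrE ?sqrtr_ge0 ?mulr_ge0 ?sqrtr_ge0 ?gradnorm_ge0 //.
rewrite sqr_sqrtr; last by apply: sumr_ge0 => a _; exact: sqr_ge0.
rewrite exprMn (sqr_sqrtr (ler0n R 3)).
have h := sum_gradnorm_star hOmega hm hpsi Hphi.
exact: h.
Qed.

Let density_bound (A K C : R) : 0 <= A -> 0 <= K -> 0 <= C ->
  (forall e, 0 < e -> A ^+ 2 <= K * (A + e) + C * e) -> A <= K.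
Proof.
move=> A0 K0 C0 h; rewrite leNgt; apply/negP => KA.
have Ap : 0 < A by exact: le_lt_trans KA.
pose e := A * (A - K) / (2 * (K + C + 1)).
have D0 : 0 < 2 * (K + C + 1) by lra.
have e0 : 0 < e by rewrite divr_gt0 // mulr_gt0 // subr_gt0.
have E : e * (2 * (K + C + 1)) = A * (A - K) by rewrite divfK // gt_eqF.
have := h e e0; have : 0 < A * (A - K) by rewrite mulr_gt0 // subr_gt0.
by rewrite expr2; nra.
Qed.

Let abs_triangle (r1 r2 X p q : R) : r1 = r2 + X -> `|r2| <= p -> `|X| <= q ->
  `|r1| <= p + q.
Proof. by move=> -> h1 h2; apply: le_trans (ler_normD _ _) _; exact: lerD. Qed.

Lemma reliability (d : vtx m -> R) v : H10 Omega v ->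
  residual Omega f uT v = gradnorm Omega v ^+ 2 ->
  (forall a, dual_norm a (H1star Omega a) (res_loc Omega psi f uT a) <= (d a)%:E)%E ->
  gradnorm Omega v <= Num.sqrt (\sum_a d a ^+ 2) * Num.sqrt 3.
Proof.
move=> [Hv dv] Ev hd; have [C C0 hC] := residual_bound dO hf HuT.
have K0 : 0 <= Num.sqrt (\sum_a d a ^+ 2) * Num.sqrt 3 by rewrite mulr_ge0 ?sqrtr_ge0.
apply: (density_bound (gradnorm_ge0 _ _) K0 C0) => e e0.
have [phi tphi hphi] := dv e e0.
have Hphi := test_fun_H1 mO tphi.
have Hd : H1 Omega (fun x => v x - phi x).
  have := H1_lin (-1) mO Hphi Hv; apply: eq_H1 => x _; ring.
have h1 := reliability_test_fun tphi hd.
have h2 := hC _ Hd.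
have E1 : residual Omega f uT v =
    residual Omega f uT phi + residual Omega f uT (fun x => v x - phi x).
  have := residual_lin dO hf HuT 1 Hphi Hd; rewrite mul1r => <-.
  by congr (residual _ _ _ _); apply/funext => x; ring.
have gle : gradnorm Omega phi <= gradnorm Omega v + e.
  have [_ [g hg]] := Hv; have hp := is_wgrad_test_fun mO tphi.
  have [_ [k hk]] := Hd.
  have Hk := is_wgrad_lin (-1) mO Hd.1 Hv.1 hk hg.
  have E2 : forall x, Omega x -> -1 * (v x - phi x) + v x = phi x.
    by move=> x _; ring.
  have Hk2 := is_wgrad_eq E2 Hk.
  have Lk := is_wgrad_L2v hk; have Lg := is_wgrad_L2v hg.
  rewrite (gradnormE dO Hk2) (gradnormE dO hg).
  have k0 : vnorm Omega k < e.
    rewrite -(gradnormE dO hk); apply: le_lt_trans hphi.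
    rewrite -(@ler_pXn2r _ 2) ?nnegrE ?H1norm_ge0 ?gradnorm_ge0 //.
    rewrite /H1norm [leRHS]sqr_sqrtr; first by rewrite lerDr sqr_ge0.
    by rewrite addr_ge0 // sqr_ge0.
  pose kk : plane R -> plane R := fun x => (-1 * (k x).1, -1 * (k x).2).
  have Lkk : L2v Omega kk by split; [exact: L2Z Lk.1|exact: L2Z Lk.2].
  have E3 : vlin (-1) k g = vlin 1 kk g.
    by apply/funext => x; rewrite /vlin /kk /= !mul1r.
  have E4 : vnorm Omega kk = vnorm Omega k.
    congr Num.sqrt; apply: eq_int2 => x _; rewrite /kk /dot /=; ring.
  rewrite E3; apply: le_trans (vnorm_triangle mO Lkk Lg) _.
  by rewrite E4 addrC lerD2l ltW.
have h3 := abs_triangle E1 h1 h2.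
rewrite Ev ger0_norm ?sqr_ge0 // in h3; apply: le_trans h3 _; apply: lerD.
  rewrite mulrA; apply: ler_wpM2l => //.
by apply: ler_wpM2l => //; exact: ltW.
Qed.

End Reliability.

End Residual.
Section DualNorms.
Context {R : realType}.

Lemma fin_num_sum_sqre (I : finType) (x : I -> \bar R) (y : I -> R) (c : R) :
  (forall i, 0 <= x i)%E ->
  (`|sqrte (\sum_i x i ^+ 2) - sqrte (\sum_i (y i)%:E ^+ 2)| <= c%:E)%E ->
  exists2 z : I -> R, forall i, x i = (z i)%:E &
    `|Num.sqrt (\sum_i z i ^+ 2) - Num.sqrt (\sum_i y i ^+ 2)| <= c.
Proof.
move=> x0.
have E (w : I -> R) : (sqrte (\sum_i (w i)%:E ^+ 2) =
    (Num.sqrt (\sum_i w i ^+ 2))%:E)%E.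
  by under eq_bigr do rewrite -EFin_expe; rewrite sumEFin.
rewrite (E y) => h.
have fx i : x i \is a fin_num.
  rewrite fin_numElt (lt_le_trans _ (x0 i)) ?ltNyr //= ltNge.
  apply/negP; rewrite leye_eq => /eqP xi; move: h.
  suff -> : (\sum_i x i ^+ 2 = +oo)%E by [].
  rewrite (bigD1 i) //= xi mulyy addye //.
  rewrite gt_eqF // (@lt_le_trans _ _ 0%E) //.
  by apply: sume_ge0 => j _; rewrite mule_ge0.
exists (fun i => fine (x i)) => [i|]; first by rewrite fineK.
move: h; rewrite (eq_bigr (fun i => ((fine (x i))%:E ^+ 2)%E)); last first.
  by move=> i _; rewrite fineK.
by rewrite E -EFinB abse_EFin lee_fin.
Qed.

Lemma dual_norm_ge0 (m : mesh R) (a : vtx m) (W : set (plane R -> R))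
  (l : (plane R -> R) -> R) : W (fun=> 0) -> gradnorm (star a) (fun=> 0) = 0 ->
  (0 <= dual_norm a W l)%E.
Proof.
move=> W0 g0; apply: (@le_trans _ _ (`|l (fun=> 0)|)%:E).
  by rewrite lee_fin.
by apply: ereal_sup_ubound; exists (fun=> 0) => //; split => //; rewrite g0.
Qed.

Lemma fin_num_choice (I : Type) (N : I -> \bar R) (c : I -> R) :
  (forall i, 0 <= N i)%E -> (forall i, N i <= (c i)%:E)%E ->
  exists2 y : I -> R, (forall i, N i = (y i)%:E) & forall i, 0 <= y i <= c i.
Proof.
move=> N0 hN.
have fin i : N i \is a fin_num.
  by rewrite ge0_fin_numE //; apply: le_lt_trans (hN i) _; exact: ltry.
exists (fun i => fine (N i)) => i; first by rewrite fineK.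
by rewrite -!lee_fin fineK // hN andbT.
Qed.

End DualNorms.

Section Contraction.
Context {R : realType}.

Lemma le_sqrt_sum_sqr (I : finType) (P : pred I) (x y : I -> R) :
  (forall i, P i -> 0 <= x i) -> (forall i, P i -> x i <= y i) ->
  Num.sqrt (\sum_(i | P i) x i ^+ 2) <= Num.sqrt (\sum_(i | P i) y i ^+ 2).
Proof.
move=> x0 xy; apply: ler_wsqrtr; apply: ler_sum => i Pi.
have yi := le_trans (x0 i Pi) (xy i Pi).
by rewrite ler_pXn2r ?nnegrE ?xy ?x0.
Qed.

Lemma sqrt_sum_sqrZ (I : finType) (P : pred I) (c : R) (x : I -> R) : 0 <= c ->
  Num.sqrt (\sum_(i | P i) (c * x i) ^+ 2) =
  c * Num.sqrt (\sum_(i | P i) x i ^+ 2).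
Proof.
move=> c0; under eq_bigr do rewrite exprMn.
by rewrite -mulr_sumr sqrtrM ?sqr_ge0 // sqrtr_sqr ger0_norm.
Qed.

Let combine (A B Sx Sx' Sy Sy' s o l st C1 C2 : R) :
  s ^+ 2 = 3 -> 0 <= s -> 0 < C1 -> 0 < C2 -> 0 < l -> C2 * l < st -> 0 <= Sx ->
  `|Sx - Sy| <= C2 * o -> `|Sx' - Sy'| <= C2 * o -> o <= l * Sx ->
  st * Sx <= Sx' -> Sy' <= C1 * (s * B) -> A <= Sy * s ->
  (st - C2 * l) * A <= 3 * C1 * (1 + C2 * l) * B.
Proof.
move=> s2 s0 C10 C20 l0 hst Sx0 h1 h2 ho h3 h4 h5.
have hCo : C2 * o <= C2 * (l * Sx) by rewrite ler_pM2l.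
have h6 : Sy <= (1 + C2 * l) * Sx.
  by move: h1; rewrite ler_distlC => /andP[_ ?]; lra.
have h7 : (st - C2 * l) * Sx <= C1 * (s * B).
  by move: h2; rewrite ler_distlC => /andP[? ?]; lra.
have d0 : 0 <= st - C2 * l by rewrite subr_ge0 ltW.
have e0 : 0 <= (1 + C2 * l) * s.
  by rewrite mulr_ge0 // addr_ge0 // mulr_ge0 // ltW.
have h8 : (st - C2 * l) * A <= (st - C2 * l) * ((1 + C2 * l) * Sx * s).
  by apply: ler_wpM2l => //; apply: le_trans h5 _; exact: ler_wpM2r.
apply: le_trans h8 _.
have -> : (st - C2 * l) * ((1 + C2 * l) * Sx * s) =
    (1 + C2 * l) * s * ((st - C2 * l) * Sx) by ring.
apply: le_trans (ler_wpM2l e0 h7) _.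
by rewrite -s2 le_eqVlt; apply/orP; left; apply/eqP; ring.
Qed.

Let contraction (A B E d e : R) : 0 <= A -> 0 <= B ->
  0 < d -> 0 < e -> d * A <= e * B -> A ^+ 2 = E ^+ 2 + B ^+ 2 ->
  E <= Num.sqrt (1 - d ^+ 2 / e ^+ 2) * A.
Proof.
move=> A0 B0 d0 e0 h E2.
have -> : Num.sqrt (1 - d ^+ 2 / e ^+ 2) * A =
    Num.sqrt (A ^+ 2 * (1 - d ^+ 2 / e ^+ 2)).
  by rewrite sqrtrM ?sqr_ge0 // sqrtr_sqr ger0_norm // mulrC.
apply: le_trans (ler_norm E) _; rewrite -sqrtr_sqr; apply: ler_wsqrtr.
have h2 : (d * A) ^+ 2 <= (e * B) ^+ 2.
  by rewrite ler_pXn2r ?nnegrE ?mulr_ge0 // ltW.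
have h3 : A ^+ 2 * (d ^+ 2 / e ^+ 2) <= B ^+ 2.
  rewrite mulrA ler_pdivrMr ?exprn_gt0 //.
  by move: h2; rewrite !exprMn mulrC [leRHS]mulrC.
lra.
Qed.

Lemma estimator_contraction (I : finType) (M : {set I}) (x x' y y' b : I -> R)
    (A B E o C1 C2 theta sigma lambda : R) :
  0 < C1 -> 0 < C2 -> 0 < theta -> 0 < sigma -> 0 < lambda ->
  C2 * lambda < sigma * theta -> 0 <= A -> 0 <= B ->
  (forall i, 0 <= x i) -> (forall i, 0 <= y' i) ->
  `|Num.sqrt (\sum_i x i ^+ 2) - Num.sqrt (\sum_i y i ^+ 2)| <= C2 * o ->
  `|Num.sqrt (\sum_i x' i ^+ 2) - Num.sqrt (\sum_i y' i ^+ 2)| <= C2 * o ->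
  o <= lambda * Num.sqrt (\sum_i x i ^+ 2) ->
  theta ^+ 2 * \sum_i x i ^+ 2 <= \sum_(i in M) x i ^+ 2 ->
  (forall i, i \in M -> sigma * x i <= x' i) ->
  (forall i, y' i <= C1 * b i) -> \sum_i b i ^+ 2 <= 3 * B ^+ 2 ->
  A <= Num.sqrt (\sum_i y i ^+ 2) * Num.sqrt 3 ->
  A ^+ 2 = E ^+ 2 + B ^+ 2 ->
  E <= Num.sqrt (1 - (sigma * theta - C2 * lambda) ^+ 2 /
                     (3 * C1 * (1 + C2 * lambda)) ^+ 2) * A.
Proof.
move=> C10 C20 t0 s0 l0 hst A0 B0 x0 y0 h1 h2 ho hM hs hy hb hA.
move=> E2; apply: (contraction A0 B0 _ _ _ E2).
- by rewrite subr_gt0.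
- by rewrite !mulr_gt0 // addr_gt0 // mulr_gt0.
have s3 := sqr_sqrtr (ler0n R 3).
apply: (combine s3 (sqrtr_ge0 _) C10 C20 l0 hst
  (sqrtr_ge0 _) h1 h2 ho _ _ hA).
- have hM' := ler_wsqrtr hM.
  rewrite sqrtrM ?sqr_ge0 // sqrtr_sqr gtr0_norm // in hM'.
  rewrite -mulrA; apply: le_trans (ler_wpM2l (ltW s0) hM') _.
  rewrite -(sqrt_sum_sqrZ _ _ (ltW s0)).
  apply: le_trans (le_sqrt_sum_sqr _ hs) _.
    by move=> i _; rewrite mulr_ge0 // ltW.
  apply: ler_wsqrtr; rewrite [leRHS](bigID (mem M)) /= lerDl.
  by apply: sumr_ge0 => i _; exact: sqr_ge0.
- apply: le_trans (le_sqrt_sum_sqr (fun i _ => y0 i) (fun i _ => hy i)) _.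
  rewrite (sqrt_sum_sqrZ _ _ (ltW C10)); apply: (ler_wpM2l (ltW C10)).
  apply: le_trans (ler_wsqrtr hb) _.
  by rewrite sqrtrM // sqrtr_sqr ger0_norm.
Qed.

Section Pythagoras.
Variables (D : set (plane R)) (u v w : plane R -> R).
Hypotheses (dD : dom D) (Hu : H1 D u) (Hv : H1 D v) (Hw : H1 D w).

Let mD : measurable D := dom_measurable dD.

Let int2_dotC (g h : plane R -> plane R) :
  int2 D (fun x => dot (g x) (h x)) = int2 D (fun x => dot (h x) (g x)).
Proof. by apply: eq_int2 => x _; rewrite /dot; ring. Qed.

Let square (a b c r s s' t p q : R) : a = 1 * b + c -> b = 1 * r + s' ->
  c = 1 * s + t -> s' = s -> s = -1 * p + q -> q = p -> a = r + t.
Proof. by move=> -> -> -> -> -> ->; ring. Qed.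

Lemma gradnorm_pythagoras :
  int2 D (fun x => dot (wgrad D u x) (wgrad D (fun x => v x - w x) x)) =
  int2 D (fun x => dot (wgrad D v x) (wgrad D (fun x => v x - w x) x)) ->
  gradnorm D (fun x => u x - w x) ^+ 2 =
  gradnorm D (fun x => u x - v x) ^+ 2 + gradnorm D (fun x => v x - w x) ^+ 2.
Proof.
have [[Lu [g hg]] [Lv [h hh]] [Lw [k hk]]] := And3 Hu Hv Hw.
have sub (p q : plane R -> R) : (fun x => -1 * q x + p x) = (fun x => p x - q x).
  by apply/funext => x; ring.
have huv : is_wgrad D (fun x => u x - v x) (vlin (-1) h g).
  by rewrite -sub; exact: is_wgrad_lin.
have hvw : is_wgrad D (fun x => v x - w x) (vlin (-1) k h).
  by rewrite -sub; exact: is_wgrad_lin.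
have Luv := is_wgrad_L2v huv; have Lvw := is_wgrad_L2v hvw.
have LL (p q : plane R -> R) : L2 D p -> L2 D q -> L2 D (fun x => p x - q x).
  exact: L2B mD.
have huw : is_wgrad D (fun x => u x - w x)
    (vlin 1 (vlin (-1) h g) (vlin (-1) k h)).
  have := is_wgrad_lin 1 mD (LL _ _ Lu Lv) (LL _ _ Lv Lw) huv hvw.
  by apply: is_wgrad_eq => x _; ring.
have Luw := is_wgrad_L2v huw.
move=> orth.
have e0 : int2 D (fun x => dot (g x) (vlin (-1) k h x)) =
    int2 D (fun x => dot (h x) (vlin (-1) k h x)).
  apply: etrans (esym (int2_dot_wgrad dD hg hvw)) _.
  by apply: etrans orth _; exact: int2_dot_wgrad dD hh hvw.
apply: etrans (gradnorm_sqr dD huw) _.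
apply: etrans _ (esym (congr2 +%R (gradnorm_sqr dD huv) (gradnorm_sqr dD hvw))).
exact: square (int2_dot_linl 1 mD Luv Lvw Luw)
  (etrans (int2_dotC _ _) (int2_dot_linl 1 mD Luv Lvw Luv))
  (etrans (int2_dotC _ _) (int2_dot_linl 1 mD Luv Lvw Lvw)) (int2_dotC _ _)
  (int2_dot_linl (-1) mD (is_wgrad_L2v hh) (is_wgrad_L2v hg) Lvw) e0.
Qed.
Let residual_val (r F a b c d e : R) : r = F - a -> b = F -> b = c -> a = d ->
  e = -1 * d + c -> r = e.
Proof. by move=> -> <- -> -> ->; ring. Qed.

Lemma residual_galerkin (f : plane R -> R) :
  int2 D (fun x => dot (wgrad D u x) (wgrad D (fun x => u x - w x) x)) =
  int2 D (fun x => f x * (u x - w x)) ->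
  residual D f w (fun x => u x - w x) = gradnorm D (fun x => u x - w x) ^+ 2.
Proof.
have [[Lu [g hg]] [Lw [k hk]]] := conj Hu Hw => hf.
have hd : is_wgrad D (fun x => u x - w x) (vlin (-1) k g).
  rewrite (_ : (fun x => _) = fun x => -1 * w x + u x).
    exact: is_wgrad_lin.
  by apply/funext => x; ring.
exact: residual_val (erefl _) hf (int2_dot_wgrad dD hg hd)
  (int2_dot_wgrad dD hk hd) (etrans (gradnorm_sqr dD hd)
  (int2_dot_linl (-1) mD (is_wgrad_L2v hk) (is_wgrad_L2v hg) (is_wgrad_L2v hd))).
Qed.

End Pythagoras.
End Contraction.

Section ZeroFunction.
Context {R : realType}.

Lemma gradnorm_0 (D : set (plane R)) : dom D -> gradnorm D (fun=> 0) = 0.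
Proof.
move=> dD; rewrite (gradnormE dD (is_wgrad_cst 0 (dom_measurable dD))).
rewrite /vnorm (_ : (fun x : plane R => _) = fun=> 0) ?int2_0 ?sqrtr0 //.
by apply/funext => x; rewrite /dot /= mulr0 addr0.
Qed.

Lemma test_fun_0 (D : set (plane R)) : test_fun D (fun=> 0).
Proof.
split; first exact: smooth_cst.
by exists set0; split; [exact: compact0|exact: sub0set|].
Qed.

Lemma H1star_0 (Omega : set (plane R)) (m : mesh R) (a : vtx m) :
  polygon Omega -> conforming Omega m -> H1star Omega a (fun=> 0).
Proof.
move=> hOmega hm; have := H1star_test_fun hOmega hm a (test_fun_0 Omega).
suff -> : star_mean Omega a (fun=> 0) = 0 by rewrite subr0.
rewrite /star_mean; have -> : int2 (star a) (fun=> 0) = 0 := int2_0 _.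
by rewrite mul0r; case: ifP.
Qed.

End ZeroFunction.
Theorem proposition4p1 (R : realType) (Omega : set (plane R))
  (f u : plane R -> R) (m : mesh R) (kappa : R)
  (psi : vtx m -> plane R -> R) (nrm : {set vtx m} -> plane R)
  (U : set (plane R -> R)) (p : {set vtx m} -> nat) (uT : plane R -> R)
  (Ubar : set (plane R -> R)) (ubar : plane R -> R)
  (M : {set vtx m}) (C1 C2 theta sigma lambda : R)
  (hOmega : polygon Omega)
  (hf : L2 Omega f)
  (hu : galerkin Omega f (H10 Omega) u)
  (hm : conforming Omega m)
  (hreg : shape_regular kappa m)
  (hpsi : forall a, is_hat Omega a (psi a))
  (hnrm : is_edge_normal nrm)
  (hU : fe_space Omega m U)
  (hp : is_local_degree U p)
  (huT : galerkin Omega f U uT)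
  (hUbar : closed_subspace (H10 Omega) (H1norm Omega) Ubar)
  (hUUbar : U `<=` Ubar)
  (hubar : galerkin Omega f Ubar ubar)
  (hC1 : 0 < C1) (hC2 : 0 < C2)
  (heff : efficiency_constant Omega psi f u uT Ubar ubar C1)
  (hosc : osc_constant Omega psi nrm p f uT U C2)
  (htheta : 0 < theta <= 1) (hsigma : 0 < sigma <= 1)
  (hlambda : 0 < lambda < sigma * theta / C2)
  (small_osc :
    ((osc p f)%:E <= lambda%:E * sqrte (\sum_(a : vtx m)
       dual_norm a (H1star Omega a) (res_breve psi nrm p f uT a) ^+ 2))%E)
  (marking :
    ((theta ^+ 2)%:E * (\sum_(a : vtx m)
       dual_norm a (H1star Omega a) (res_breve psi nrm p f uT a) ^+ 2)
     <= \sum_(a in M)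
       dual_norm a (H1star Omega a) (res_breve psi nrm p f uT a) ^+ 2)%E)
  (saturation : forall a, a \in M ->
    (sigma%:E * dual_norm a (H1star Omega a) (res_breve psi nrm p f uT a)
     <= dual_norm a (H1star_cap Omega Ubar a) (res_breve psi nrm p f uT a))%E) :
  gradnorm Omega (fun x => u x - ubar x) <=
  Num.sqrt (1 - (sigma * theta - C2 * lambda) ^+ 2 /
                (3 * C1 * (1 + C2 * lambda)) ^+ 2) *
  gradnorm Omega (fun x => u x - uT x).
Proof.
have dO := dom_Omega hOmega; have mO := dom_measurable dO.
have [/andP[t0 _] /andP[s0 _] /andP[l0 hl]] := And3 htheta hsigma hlambda.
have hst : C2 * lambda < sigma * theta by rewrite mulrC -ltr_pdivlMr.
have [[Ub0 Ublin] UbH10 _] := hUbar.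
have Hu : H10 Omega u := hu.1.
have HuT : H10 Omega uT := galerkin_H10 hU huT.
have Hub : H10 Omega ubar by exact: UbH10 hubar.1.
have sub (v w : plane R -> R) : (fun x => -1 * w x + v x) = (fun x => v x - w x).
  by apply/funext => x; ring.
have Hv : H10 Omega (fun x => ubar x - uT x).
  by rewrite -sub; exact: H10_lin dO HuT Hub.
have HuuT : H10 Omega (fun x => u x - uT x).
  by rewrite -sub; exact: H10_lin dO HuT Hu.
have Uv : Ubar (fun x => ubar x - uT x).
  by rewrite -sub; exact: Ublin (hUUbar _ huT.1) hubar.1.
have orth := etrans (hu.2 _ Hv) (esym (hubar.2 _ Uv)).
have pyth := gradnorm_pythagoras dO Hu.1 Hub.1 HuT.1 orth.
have z0 (a : vtx m) : H1star Omega a (fun=> 0) := H1star_0 a hOmega hm.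
have g0 (a : vtx m) := gradnorm_0 (dom_star hOmega hm a).
have c0 (a : vtx m) : H1star_cap Omega Ubar a (fun=> 0).
  by split; [exact: z0|exists (fun=> 0); [exact: Ub0|]].
pose l a := res_loc Omega psi f uT a.
pose lb a := res_breve psi nrm p f uT a.
have [y ey _] := fin_num_choice (fun a => dual_norm_ge0 (l a) (z0 a) (g0 a))
  (fun a => (heff a).1).
have [y' ey' hy'] := fin_num_choice (fun a => dual_norm_ge0 (l a) (c0 a) (g0 a))
  (fun a => (heff a).2).
have [h1 hW] := hosc.
have h2 : osc_bound Omega psi nrm p f uT (fun a => H1star_cap Omega Ubar a) C2.
  apply: hW => a; right.
  by exists Ubar; [split; [exact: hUbar|exact: hUUbar]|reflexivity].
have breve_fin (W : vtx m -> set (plane R -> R)) (yy : vtx m -> R) :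
    (forall a, W a (fun=> 0)) ->
    (forall a, dual_norm a (W a) (l a) = (yy a)%:E) ->
    osc_bound Omega psi nrm p f uT W C2 ->
    exists2 x : vtx m -> R, forall a, dual_norm a (W a) (lb a) = (x a)%:E &
      `|Num.sqrt (\sum_a x a ^+ 2) - Num.sqrt (\sum_a yy a ^+ 2)| <= C2 * osc p f.
  move=> W0 eW hb; apply: fin_num_sum_sqre.
    by move=> a; exact: dual_norm_ge0 (W0 a) (g0 a).
  move: hb; rewrite /osc_bound; congr (`|_ - sqrte _| <= _)%E.
  by apply: eq_bigr => a _; rewrite -eW.
have [x ex hx] := breve_fin _ y z0 ey h1.
have [x' ex' hx'] := breve_fin _ y' c0 ey' h2.
have sumE (P : pred (vtx m)) :
    (\sum_(a | P a) dual_norm a (H1star Omega a) (lb a) ^+ 2 =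
     (\sum_(a | P a) x a ^+ 2)%:E)%E.
  by rewrite -sumEFin; apply: eq_bigr => a _; rewrite ex EFin_expe.
have x0 a : 0 <= x a.
  by rewrite -lee_fin -ex; exact: dual_norm_ge0 (z0 a) (g0 a).
have y'0 a : 0 <= y' a by case/andP: (hy' a).
have ho : osc p f <= lambda * Num.sqrt (\sum_a x a ^+ 2).
  by move: small_osc; rewrite sumE -EFinM lee_fin.
have hM : theta ^+ 2 * \sum_a x a ^+ 2 <= \sum_(a in M) x a ^+ 2.
  by move: marking; rewrite !sumE -EFinM lee_fin.
have hs a : a \in M -> sigma * x a <= x' a.
  by move=> /saturation; rewrite ex ex' -EFinM lee_fin.
have hA : gradnorm Omega (fun x => u x - uT x) <=
    Num.sqrt (\sum_a y a ^+ 2) * Num.sqrt 3.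
  apply: (reliability hOmega hm hpsi hf hU huT HuuT) => [|a]; last by rewrite -ey.
  exact: (residual_galerkin dO Hu.1 HuT.1 (hu.2 _ HuuT)).
have hb := sum_gradnorm_star hOmega hm hpsi Hv.1.
have hyb a : y' a <= C1 * gradnorm (star a) (fun x => ubar x - uT x).
  by case/andP: (hy' a).
exact: estimator_contraction hC1 hC2 t0 s0 l0 hst (gradnorm_ge0 _ _)
  (gradnorm_ge0 _ _) x0 y'0 hx hx' ho hM hs hyb hb hA pyth.
Qed.
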